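(* There is a data structure in the Word RAM model of computation that maintains a $0$-$1$-weighted rooted forest $(F,w)$ with $n$ vertices under the operations \textsf{cut}, \textsf{update-weight} and \textsf{tree-sum}, with total running time $\mathcal{O}(m+n)$ for any sequence of $m$ operations.
   Context: A $0$-$1$-weighted rooted forest $(F,w)$ is a rooted forest $F$ with weights $w\colon V(F)\to\{0,1\}\subseteq\mathbb{Z}$. Operations: $\textsf{cut}(v)$ deletes the edge between $v$ and its parent (legal only if $v$ is not a root); $\textsf{update-weight}(v,x)$ with $x\in\{0,1\}$ sets $w(v)\gets x$; $\textsf{tree-sum}(v)$ returns the sum of weights of all vertices in the tree of the current forest containing $v$. The Word RAM has words of $\Theta(\log n)$ bits with constant-time arithmetic, bitwise operations, comparisons and indirect addressing. The running time includes initialization. *)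

(* Defs.v *)
From mathcomp Require Import all_boot.
From Stdlib Require Import PeanoNat.

Set Implicit Arguments.
Unset Strict Implicit.
Unset Printing Implicit Defensive.

(* Abstract data type: 0-1-weighted rooted forest on vertices 0..n-1.        *)
(* par v = Some u : u is the parent of v;  par v = None : v is a root.       *)

Definition up (par : nat -> option nat) (v : nat) : nat := odflt v (par v).

Definition anc (par : nat -> option nat) (k v : nat) : nat := iter k (up par) v.

(* par describes a rooted forest on {0,..,n-1}: parents are vertices and
   every vertex reaches a root by following parents (acyclicity). *)
Definition forest (n : nat) (par : nat -> option nat) : Prop :=
  (forall v u, v < n -> par v = Some u -> u < n) /\
  (forall v, v < n -> exists k, par (anc par k v) = None).

(* the root of the tree containing v (n steps suffice in a forest on n vertices) *)
Definition root_of (n : nat) (par : nat -> option nat) (v : nat) : nat :=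
  anc par n v.

Definition tree_sum (n : nat) (par : nat -> option nat) (wt : nat -> bool)
    (v : nat) : nat :=
  \sum_(u < n | root_of n par u == root_of n par v) (wt u : nat).

Inductive op : Type :=
| Cut (v : nat)
| UpdateWeight (v : nat) (x : bool)
| TreeSum (v : nat).

Definition cut_par (par : nat -> option nat) (v : nat) : nat -> option nat :=
  fun u => if u == v then None else par u.

Definition set_wt (wt : nat -> bool) (v : nat) (x : bool) : nat -> bool :=
  fun u => if u == v then x else wt u.

Fixpoint legal_seq (n : nat) (par : nat -> option nat) (ops : seq op) : Prop :=
  match ops with
  | [::] => True
  | Cut v :: ops' => v < n /\ par v <> None /\ legal_seq n (cut_par par v) ops'
  | UpdateWeight v _ :: ops' => v < n /\ legal_seq n par ops'
  | TreeSum v :: ops' => v < n /\ legal_seq n par ops'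
  end.

Fixpoint answers (n : nat) (par : nat -> option nat) (wt : nat -> bool)
    (ops : seq op) : seq nat :=
  match ops with
  | [::] => [::]
  | Cut v :: ops' => answers n (cut_par par v) wt ops'
  | UpdateWeight v x :: ops' => answers n par (set_wt wt v x) ops'
  | TreeSum v :: ops' => tree_sum n par wt v :: answers n par wt ops'
  end.

Definition is_query (o : op) : bool := if o is TreeSum _ then true else false.

(* Word RAM with word size w: memory cells indexed by nat, holding words     *)
(* (naturals < 2^w), zero-initialised; constant-time arithmetic (mod 2^w),   *)
(* bitwise operations, comparisons, indirect addressing, input/output.       *)

Inductive instr : Type :=
| IConst (d k : nat)
| IAdd (d a b : nat)
| ISub (d a b : nat)
| IMul (d a b : nat)
| IDiv (d a b : nat)       (* mem[d] := mem[a] / mem[b]  (0 if mem[b] = 0) *)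
| IMod (d a b : nat)
| IAnd (d a b : nat)
| IOr  (d a b : nat)
| IXor (d a b : nat)
| IShl (d a b : nat)
| IShr (d a b : nat)
| ILt  (d a b : nat)
| IEq  (d a b : nat)
| ILoad (d a : nat)
| IStore (a s : nat)
| IJz (a l : nat)
| IJmp (l : nat)
| IRead (d : nat)
| IWrite (s : nat)
| IHalt.

Record config : Type := Config {
  pc : nat;
  mem : nat -> nat;
  inp : seq (nat * nat * nat);
  consumed : nat;
  out : seq nat
}.

Definition upd (m : nat -> nat) (a x : nat) : nat -> nat :=
  fun i => if i == a then x else m i.

Definition end_rec : nat * nat * nat := (3, 0, 0).

Definition step (w : nat) (P : seq instr) (c : config) : option config :=
  let M := mem c in
  let W := 2 ^ w in
  let bin d f a b := Some (Config (pc c).+1 (upd M d (f (M a) (M b) %% W))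
                                  (inp c) (consumed c) (out c)) in
  match nth IHalt P (pc c) with
  | IConst d k => Some (Config (pc c).+1 (upd M d (k %% W)) (inp c) (consumed c) (out c))
  | IAdd d a b => bin d addn a b
  | ISub d a b => bin d (fun x y => x + (W - y %% W)) a b
  | IMul d a b => bin d muln a b
  | IDiv d a b => bin d divn a b
  | IMod d a b => bin d modn a b
  | IAnd d a b => bin d Nat.land a b
  | IOr d a b => bin d Nat.lor a b
  | IXor d a b => bin d Nat.lxor a b
  | IShl d a b => bin d (fun x y => x * 2 ^ y) a b
  | IShr d a b => bin d (fun x y => x %/ 2 ^ y) a b
  | ILt d a b => bin d (fun x y => nat_of_bool (x < y)) a b
  | IEq d a b => bin d (fun x y => nat_of_bool (x == y)) a b
  | ILoad d a => Some (Config (pc c).+1 (upd M d (M (M a))) (inp c) (consumed c) (out c))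
  | IStore a s => Some (Config (pc c).+1 (upd M (M a) (M s)) (inp c) (consumed c) (out c))
  | IJz a l => Some (Config (if M a == 0 then l else (pc c).+1) M (inp c) (consumed c) (out c))
  | IJmp l => Some (Config l M (inp c) (consumed c) (out c))
  | IRead d =>
      let '(x, y, z) := head end_rec (inp c) in
      Some (Config (pc c).+1 (upd (upd (upd M d x) d.+1 y) d.+2 z)
                   (behead (inp c)) (consumed c).+1 (out c))
  | IWrite s => Some (Config (pc c).+1 M (inp c) (consumed c) (rcons (out c) (M s)))
  | IHalt => None   (* also reached when pc is outside the program *)
  end.

Definition halted (w : nat) (P : seq instr) (c : config) : bool :=
  if step w P c is None then true else false.

Definition run (w : nat) (P : seq instr) (t : nat) (c : config) : config :=
  iter t (fun c' => odflt c' (step w P c')) c.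

(* Input encoding.  Record 0: (n,0,0).  Records 1..n: for vertex v,          *)
(* (parent of v, or n if v is a root; weight of v; 0).  Then one record per  *)
(* operation: cut(v) = (0,v,0), update-weight(v,x) = (1,v,x),                *)
(* tree-sum(v) = (2,v,0); finally the end marker (3,0,0).                   *)

Definition enc_op (o : op) : nat * nat * nat :=
  match o with
  | Cut v => (0, v, 0)
  | UpdateWeight v x => (1, v, nat_of_bool x)
  | TreeSum v => (2, v, 0)
  end.

Definition encode (n : nat) (par : nat -> option nat) (wt : nat -> bool)
    (ops : seq op) : seq (nat * nat * nat) :=
  (n, 0, 0) :: [seq (odflt n (par v), nat_of_bool (wt v), 0) | v <- iota 0 n]
    ++ map enc_op ops ++ [:: end_rec].

Definition init_config (input : seq (nat * nat * nat)) : config :=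
  Config 0 (fun _ => 0) input 0 [::].

(* Main.v *)
(* Hang all trees below a virtual root and number the vertices in preorder, so
   that the subtree of a vertex x is an interval [x, R x) of positions.  Cutting x
   marks its interval, and two vertices are in the same tree iff they lie in the
   same marked intervals.  Positions are grouped into blocks of B ~ log n, and the
   part of a tree inside a block is a "piece".  The piece of a position is found in
   O(1) from bit masks: if some marked interval starting in the block contains the
   position, the innermost one determines the piece; otherwise the last end of a
   marked interval entering the block from the left does.  Each tree keeps the
   circular list of its pieces ordered by position, and each piece the label of its
   tree, under which the sum of weights is stored.

   Cutting x splits at most two pieces (in the blocks of x and of R x); the new tree
   consists of a contiguous segment of the list.  Walking along the segment and its
   complement simultaneously, the smaller one is relabelled and summed with a table
   of population counts.  Since a tree with p pieces splits into p1 + p2 <= p + 2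
   pieces, p - 2 is superadditive, and starting from O(n / log n) pieces all cuts
   together cost O(n).

   The program is written in a small structured language whose compiler to Word RAM
   code is proved correct, with running time measured in loop iterations. *)
Require Import Defs.
From mathcomp Require Import all_boot zify.
From Stdlib Require Import Lia.
From Stdlib Require PeanoNat.

Set Implicit Arguments.
Unset Strict Implicit.
Unset Printing Implicit Defensive.

(** * A structured language compiled to Word RAM code *)

(** The names of pieces do much of the work. They record where and how a piece starts, and a split
    leaves the old name to one half. Inside a class, numerical order agrees with the order of
    positions, so the pieces cut off with [x] are exactly those of its class named from [2 * x + 1]
    up to, but excluding, [2 * R x] ([cut_range]), and two comparisons tell the sides apart. Pieces
    that become empty are kept, so a cut adds at most two names. Of the tree, the cut machinery uses
    only [R_bound] and [R_laminar]. The roots of the input are separated from the virtual root in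
    advance by at most [n] ordinary cuts, which the same potential pays for. The block length
    satisfies [2 ^ B <= N + 1] and [N < 2 ^ B.+1]. The first bound keeps the tables indexed by masks
    linear; the second bounds the logarithm of the number of blocks by [B], so the initial potential
    is at most [N]. A cut both walks and relabels the smaller side, hence the potential is counted
    twice. That answers appear before the next record is read is enforced in the semantics, by the
    side condition of [Rd]. *)

Inductive bop := Add | Sub | Mul | Div | Mod | And | Shl | Lt | Eq.

Inductive expr :=
| EC (k : nat)
| EV (x : nat)
| EA (i : nat) (e : expr)
| EB (o : bop) (e1 e2 : expr).

Inductive cmd :=
| Skip
| Asg (x : nat) (e : expr)
| Sto (i : nat) (e1 e2 : expr)
| Seq (c1 c2 : cmd)
| If (e : expr) (c1 c2 : cmd)
| While (e : expr) (c : cmd)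
| Rd (x : nat)
| Wr (e : expr).

Record st := St {
  vr : nat -> nat;
  ar : nat -> nat -> nat;
  si : seq (nat * nat * nat);
  sc : nat;
  so : seq nat }.

Definition bsem (o : bop) (x y : nat) : nat :=
  match o with
  | Add => x + y | Sub => x - y | Mul => x * y | Div => x %/ y | Mod => x %% y
  | And => Nat.land x y | Shl => x * 2 ^ y | Lt => (x < y : bool)
  | Eq => (x == y : bool)
  end.

Fixpoint ev (e : expr) (s : st) : nat :=
  match e with
  | EC k => k
  | EV x => vr s x
  | EA i e => ar s i (ev e s)
  | EB o e1 e2 => bsem o (ev e1 s) (ev e2 s)
  end.

Definition upd2 (a : nat -> nat -> nat) (i x y : nat) : nat -> nat -> nat :=
  fun j => if j == i then upd (a j) x y else a j.

Definition setv (s : st) (x y : nat) : st :=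
  St (upd (vr s) x y) (ar s) (si s) (sc s) (so s).
Definition seta (s : st) (i x y : nat) : st :=
  St (vr s) (upd2 (ar s) i x y) (si s) (sc s) (so s).
Definition rdst (s : st) (x : nat) : st :=
  let '(a, b, c) := head end_rec (si s) in
  St (upd (upd (upd (vr s) x a) x.+1 b) x.+2 c) (ar s) (behead (si s)) (sc s).+1 (so s).
Definition wrst (s : st) (y : nat) : st :=
  St (vr s) (ar s) (si s) (sc s) (rcons (so s) y).

Lemma powE a b : PeanoNat.Nat.pow a b = a ^ b.
Proof. by elim: b => //= b ->; rewrite expnS. Qed.

Lemma land_ltl a b : Nat.land a b < a.+1.
Proof. by have := PeanoNat.Nat.land_le_l a b; lia. Qed.

Section Language.

Variables (w : nat) (q : nat -> nat).
Let W := 2 ^ w.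

(** These are the cases in which arithmetic modulo [W] can differ from that of [nat]; the remaining
    operations return at most an argument or 1. *)
Definition bsafe (o : bop) (x y : nat) : Prop :=
  match o with
  | Add => x + y < W | Sub => y <= x | Mul => x * y < W | Shl => x * 2 ^ y < W
  | _ => True
  end.

(** Entry [x] of any array lies below address [32 * x + 96], so the bound on the index makes the
    address a machine word. *)
Fixpoint safe (e : expr) (s : st) : Prop :=
  match e with
  | EC k => k < W
  | EV x => True
  | EA i e => safe e s /\ 32 * ev e s + 96 <= W
  | EB o e1 e2 => [/\ safe e1 s, safe e2 s & bsafe o (ev e1 s) (ev e2 s)]
  end.

(* The cost index counts loop iterations only: between two iterations every
   machine instruction is executed at most once. *)
Inductive exec : cmd -> st -> nat -> st -> Prop :=
| X_skip s : exec Skip s 0 s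
| X_asg s x e : safe e s -> exec (Asg x e) s 0 (setv s x (ev e s))
| X_sto s i e1 e2 : safe e1 s -> safe e2 s -> 32 * ev e1 s + 96 <= W ->
    exec (Sto i e1 e2) s 0 (seta s i (ev e1 s) (ev e2 s))
| X_seq s1 s2 s3 t1 t2 c1 c2 : exec c1 s1 t1 s2 -> exec c2 s2 t2 s3 ->
    exec (Seq c1 c2) s1 (t1 + t2) s3
| X_ift s s' t e c1 c2 : safe e s -> ev e s != 0 -> exec c1 s t s' ->
    exec (If e c1 c2) s t s'
| X_iff s s' t e c1 c2 : safe e s -> ev e s = 0 -> exec c2 s t s' ->
    exec (If e c1 c2) s t s'
| X_whf s e c : safe e s -> ev e s = 0 -> exec (While e c) s 0 s
| X_wht s1 s2 s3 t1 t2 e c : safe e s1 -> ev e s1 != 0 -> exec c s1 t1 s2 ->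
    exec (While e c) s2 t2 s3 -> exec (While e c) s1 (t1 + t2).+1 s3
| X_rd s x : q (sc s).+1 <= size (so s) -> exec (Rd x) s 0 (rdst s x)
| X_wr s e : safe e s -> exec (Wr e) s 0 (wrst s (ev e s)).

Definition bins (o : bop) : nat -> nat -> nat -> instr :=
  match o with
  | Add => IAdd | Sub => ISub | Mul => IMul | Div => IDiv | Mod => IMod
  | And => IAnd | Shl => IShl | Lt => ILt | Eq => IEq
  end.

(* Cells 0-31 hold variables, cells 32-63 temporaries, and entry x of array i
   sits at address 64 + 32 x + i. *)
Definition addr_code (i t : nat) : seq instr :=
  [:: IConst t.+1 32; IMul t t t.+1; IConst t.+1 (64 + i); IAdd t t t.+1].

(** The value is left in cell [t]; the cells behind it are scratch. The machine has no move
    instruction, so a variable is copied by adding a constant zero. *)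
Fixpoint cexpr (e : expr) (t : nat) : seq instr :=
  match e with
  | EC k => [:: IConst t k]
  | EV x => [:: IConst t.+1 0; IAdd t x t.+1]
  | EA i e => cexpr e t ++ addr_code i t ++ [:: ILoad t t]
  | EB o e1 e2 => cexpr e1 t ++ cexpr e2 t.+1 ++ [:: bins o t t t.+1]
  end.

Fixpoint wfe (e : expr) (t : nat) : bool :=
  match e with
  | EC _ => t < 64
  | EV x => (x < 32) && (t.+1 < 64)
  | EA i e => [&& i < 32, t.+1 < 64 & wfe e t]
  | EB _ e1 e2 => [&& t.+1 < 64, wfe e1 t & wfe e2 t.+1]
  end.

(** The size of the code does not depend on its position, so [ccmd] can compute forward jump targets
    before the code they jump over is placed. *)
Fixpoint csize (c : cmd) : nat :=
  match c with
  | Skip => 0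
  | Asg x e => size (cexpr e 32) + 2
  | Sto i e1 e2 => size (cexpr e1 32) + (4 + (size (cexpr e2 33) + 1))
  | Seq c1 c2 => csize c1 + csize c2
  | If e c1 c2 => size (cexpr e 32) + (1 + (csize c1 + (1 + csize c2)))
  | While e c => size (cexpr e 32) + (1 + (csize c + 1))
  | Rd x => 1
  | Wr e => size (cexpr e 32) + 1
  end.

Fixpoint ccmd (c : cmd) (p : nat) : seq instr :=
  match c with
  | Skip => [::]
  | Asg x e => cexpr e 32 ++ [:: IConst 33 0; IAdd x 32 33]
  | Sto i e1 e2 => cexpr e1 32 ++ addr_code i 32 ++ cexpr e2 33 ++ [:: IStore 32 33]
  | Seq c1 c2 => ccmd c1 p ++ ccmd c2 (p + csize c1)
  | If e c1 c2 =>
      let p1 := p + size (cexpr e 32) + 1 in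
      let p2 := p1 + csize c1 + 1 in
      cexpr e 32 ++ [:: IJz 32 p2] ++ ccmd c1 p1 ++ [:: IJmp (p2 + csize c2)] ++ ccmd c2 p2
  | While e c =>
      let p1 := p + size (cexpr e 32) + 1 in
      cexpr e 32 ++ [:: IJz 32 (p1 + csize c + 1)] ++ ccmd c p1 ++ [:: IJmp p]
  | Rd x => [:: IRead x]
  | Wr e => cexpr e 32 ++ [:: IWrite 32]
  end.

(** A record fills three consecutive variables, hence the bound 30 for [Rd]. *)
Fixpoint wfc (c : cmd) : bool :=
  match c with
  | Skip => true
  | Asg x e => (x < 32) && wfe e 32
  | Sto i e1 e2 => [&& i < 32, wfe e1 32 & wfe e2 33]
  | Seq c1 c2 => wfc c1 && wfc c2
  | If e c1 c2 => [&& wfe e 32, wfc c1 & wfc c2]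
  | While e c => wfe e 32 && wfc c
  | Rd x => x < 30
  | Wr e => wfe e 32
  end.

Lemma size_ccmd c p : size (ccmd c p) = csize c.
Proof.
elim: c p => //= *; rewrite ?size_cat //= ?size_cat //=;
  repeat match goal with H : forall p, size (ccmd _ p) = _ |- _ => rewrite !H; clear H end;
  lia.
Qed.

(** * Correctness of the compiler *)

Section Machine.

Variable P : seq instr.
Hypothesis W_gt : 128 < W.

(** [q c] is the number of answers owed once [c] records are consumed. [steps] demands it of every
    intermediate configuration, because the online condition of the theorem speaks of all times. *)
Definition good (c : config) : Prop := q (consumed c) <= size (out c).

Inductive steps : config -> nat -> config -> Prop :=
| steps0 c : good c -> steps c 0 c
| stepsS c1 c2 c3 t : good c1 -> step w P c1 = Some c2 -> steps c2 t c3 ->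
    steps c1 t.+1 c3.

Lemma steps_trans c1 c2 c3 t1 t2 :
  steps c1 t1 c2 -> steps c2 t2 c3 -> steps c1 (t1 + t2) c3.
Proof.
elim=> {c1 c2 t1} [c _|c1 c2 c2' t1 g st _ IH] //= s23.
rewrite addSn; exact: stepsS g st (IH s23).
Qed.

Lemma steps_good c t c' : steps c t c' -> good c'.
Proof. by elim. Qed.

Lemma steps_run c t c' : steps c t c' ->
  run w P t c = c' /\ (forall t', t' <= t -> good (run w P t' c)).
Proof.
elim=> {c c' t} [c g|c1 c2 c3 t g st _ [r H]]; first by split=> // -[].
have E t' : run w P t'.+1 c1 = run w P t' c2 by rewrite /run iterSr st.
by split=> [|[//|t'] le]; rewrite E //; apply: H.
Qed.

Definition codeat (p : nat) (code : seq instr) : Prop :=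
  exists pre post, P = pre ++ code ++ post /\ size pre = p.

Lemma codeat_cat p a b : codeat p (a ++ b) -> codeat p a /\ codeat (p + size a) b.
Proof.
move=> [pre [post [E <-]]]; split.
  by exists pre, (b ++ post); rewrite E -!catA.
by exists (pre ++ a), post; rewrite E -!catA size_cat.
Qed.

Lemma codeat_cons p i b : codeat p (i :: b) -> nth IHalt P p = i /\ codeat p.+1 b.
Proof.
move=> [pre [post [E <-]]]; split; first by rewrite E nth_cat ltnn subnn.
by exists (pre ++ [:: i]), post; rewrite E -!catA size_cat addn1.
Qed.

Definition bounded (m : nat -> nat) : Prop := forall a, m a < W.

(** Only the temporaries from [t] to 63 may change; this protects left operands, which wait in lower
    temporaries. *)
Definition agree (t : nat) (m m' : nat -> nat) : Prop :=
  forall a, (a < t) || (64 <= a) -> m' a = m a.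

Lemma agree_trans t t' m1 m2 m3 : t <= t' -> agree t m1 m2 -> agree t' m2 m3 -> agree t m1 m3.
Proof.
move=> le A1 A2 a H; rewrite A2 ?A1 //; lia.
Qed.

(** The last clause bounds the records still to be read, so that reading them keeps the memory
    [bounded]. *)
Definition rel (s : st) (m : nat -> nat) : Prop :=
  [/\ bounded m, (forall x, x < 32 -> m x = vr s x),
      (forall i x, i < 32 -> m (64 + 32 * x + i) = ar s i x) &
      (forall r, r \in si s -> [/\ r.1.1 < W, r.1.2 < W & r.2 < W])].

Lemma rel_agree s m m' t : 32 <= t -> bounded m' -> rel s m -> agree t m m' -> rel s m'.
Proof.
move=> t32 b' [b H1 H2 H3] A; split=> // [x lx|i x li]; rewrite A;
  [exact: H1 | lia | exact: H2 | lia].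
Qed.

Lemma bounded_upd m d x : bounded m -> x < W -> bounded (upd m d x).
Proof. by move=> b lx a; rewrite /upd; case: ifP. Qed.

Lemma step_bin o d a b p m i c u : nth IHalt P p = bins o d a b -> bounded m ->
  bsafe o (m a) (m b) ->
  step w P (Config p m i c u) = Some (Config p.+1 (upd m d (bsem o (m a) (m b))) i c u) /\
  bsem o (m a) (m b) < W.
Proof.
move=> E bm sf; rewrite /step /= E.
have := bm a; have := bm b => lb la.
suff H : bsem o (m a) (m b) < W /\ (match o with Sub => m a + (W - m b %% W) | _ => bsem o (m a) (m b) end) %% W = bsem o (m a) (m b).
  by case: H => H1 H2; split=> //; case: o E sf H1 H2 => /= _ _ _; rewrite ?powE => ->.
case: o E sf => /= _ sf.
- by rewrite modn_small.
- rewrite (modn_small lb); split; first lia.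
  have -> : m a + (W - m b) = m a - m b + W by lia.
  by rewrite modnDr modn_small //; lia.
- by rewrite modn_small.
- have H : m a %/ m b < W by apply: leq_ltn_trans (leq_div _ _) la.
  by rewrite modn_small.
- have H : m a %% m b < W by apply: leq_ltn_trans (leq_mod _ _) la.
  by split=> //; rewrite (modn_small H).
- have H : Nat.land (m a) (m b) < W by apply: leq_trans (land_ltl _ _) la.
  by rewrite modn_small.
- by rewrite modn_small.
- have H : (m a < m b : nat) < W by case: (m a < m b); lia.
  by rewrite modn_small.
- have H : (m a == m b : nat) < W by case: (m a == m b); lia.
  by rewrite modn_small.
Qed.

Lemma step_const d k p m i c u : nth IHalt P p = IConst d k -> k < W ->
  step w P (Config p m i c u) = Some (Config p.+1 (upd m d k) i c u).
Proof. by move=> E lk; rewrite /step /= E powE modn_small. Qed.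

Definition goodio (c : nat) (u : seq nat) : Prop := q c <= size u.

Lemma addr_steps k t p m i c u : codeat p (addr_code k t) -> bounded m ->
  goodio c u -> 32 * m t + 96 <= W -> k < 32 ->
  exists m', [/\ steps (Config p m i c u) 4 (Config (p + 4) m' i c u),
    m' t = 64 + 32 * m t + k, bounded m' & forall a, a != t -> a != t.+1 -> m' a = m a].
Proof.
rewrite /addr_code => /codeat_cons[E1 /codeat_cons[E2 /codeat_cons[E3 /codeat_cons[E4 _]]]].
move=> bm g sf lk.
set m1 := upd m t.+1 32.
have b1 : bounded m1 by apply: bounded_upd => //; lia.
have e1 : m1 t = m t by rewrite /m1 /upd; case: eqP => //; lia.
have e1' : m1 t.+1 = 32 by rewrite /m1 /upd eqxx.
have [|S2 l2] := @step_bin Mul t t t.+1 p.+1 m1 i c u E2 b1.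
  by rewrite /= e1 e1'; lia.
set m2 := upd m1 t _ in S2.
have b2 : bounded m2 by apply: bounded_upd.
set m3 := upd m2 t.+1 (64 + k).
have b3 : bounded m3 by apply: bounded_upd => //; lia.
have e3 : m3 t = 32 * m t.
  rewrite /m3 /m2 {1 2}/upd eqxx /= e1 e1' mulnC; case: eqP => //; lia.
have e3' : m3 t.+1 = 64 + k by rewrite /m3 /upd eqxx.
have [|S4 l4] := @step_bin Add t t t.+1 p.+3 m3 i c u E4 b3.
  by rewrite /= e3 e3'; lia.
exists (upd m3 t (bsem Add (m3 t) (m3 t.+1))); split.
- have -> : p + 4 = p.+4 by lia.
  apply: stepsS; [exact: g | apply: step_const E1 _; lia |].
  apply: stepsS; [exact: g | exact: S2 |].
  apply: stepsS; [exact: g | apply: step_const E3 _; lia |].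
  apply: stepsS; [exact: g | exact: S4 |].
  exact: steps0.
- by rewrite /upd eqxx /= e3 e3'; lia.
- exact: bounded_upd.
- by move=> a /negbTE n1 /negbTE n2; rewrite /m3 /m2 /m1 /upd n1 n2.
Qed.

Lemma cexpr_steps e s t p m i c u : codeat p (cexpr e t) -> wfe e t -> 32 <= t ->
  rel s m -> safe e s -> goodio c u ->
  exists m', [/\ steps (Config p m i c u) (size (cexpr e t)) (Config (p + size (cexpr e t)) m' i c u),
    m' t = ev e s, bounded m' & agree t m m'].
Proof.
elim: e t p m => [k|x|k e IH|o e1 IH1 e2 IH2] t p m /=.
- move=> /codeat_cons[E _] lt t32 R lk g; exists (upd m t k).
  have b : bounded (upd m t k) by apply: bounded_upd; case: R.
  split=> //; first by rewrite addn1; apply: stepsS (step_const _ _ _ _ E lk) _ => //;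
    apply: steps0.
    by rewrite /upd eqxx.
  by move=> a H; rewrite /upd; case: eqP => //; lia.
- move=> /codeat_cons[E1 /codeat_cons[E2 _]] /andP[lx lt] t32 R _ g.
  set m1 := upd m t.+1 0.
  have b1 : bounded m1 by apply: bounded_upd; [case: R|lia].
  have e1 : m1 x = vr s x by rewrite /m1 /upd; case: eqP => [|_]; [lia | case: R => _ ->].
  have e1' : m1 t.+1 = 0 by rewrite /m1 /upd eqxx.
  have [|S2 l2] := @step_bin Add t x t.+1 p.+1 m1 i c u E2 b1.
    by rewrite /= e1 e1' addn0 -e1; apply: b1.
  exists (upd m1 t (bsem Add (m1 x) (m1 t.+1))); split.
  + rewrite addn2; apply: stepsS; [exact: g | apply: step_const E1 _; lia |].
    by apply: stepsS; [exact: g | exact: S2 | exact: steps0].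
  + by rewrite /upd eqxx /= e1 e1' addn0.
  + exact: bounded_upd.
  + by move=> a H; rewrite /m1 /upd; do 2![case: eqP => [|_]; first lia].
- move=> /codeat_cat[C1 /(codeat_cat (a := addr_code k t))[C2 /codeat_cons[E3 _]]] /and3P[lk lt wf] t32 R [sf ad] g.
  have [m1 [S1 e1 b1 A1]] := IH _ _ _ C1 wf t32 R sf g.
  have [|//|m2 [S2 e2 b2 A2]] := @addr_steps k t _ m1 i c u C2 b1 g.
    by rewrite e1.
  have R2 : rel s m2.
    apply: (@rel_agree s m m2 t) => //; apply: (agree_trans (leqnn _) A1).
    by move=> a H; apply: A2; apply/eqP; lia.
  have S3 : step w P (Config (p + size (cexpr e t) + 4) m2 i c u) =
      Some (Config (p + size (cexpr e t) + 4).+1 (upd m2 t (ar s k (ev e s))) i c u).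
    rewrite /step /= E3; congr (Some (Config _ (upd _ _ _) _ _ _)).
    by rewrite e2 e1; case: R2 => _ _ ->.
  exists (upd m2 t (ar s k (ev e s))); split.
  + rewrite size_cat (_ : size _ + size _ = size (cexpr e t) + 4 + 1); last by rewrite /=; lia.
    apply: steps_trans (steps_trans S1 S2) _.
    have -> : p + (size (cexpr e t) + 4 + 1) = (p + size (cexpr e t) + 4).+1 by lia.
    by apply: stepsS S3 _ => //; apply: steps0.
  + by rewrite /upd eqxx.
  + apply: bounded_upd => //; case: R2 => b _ H _; rewrite -H //; exact: b.
  + apply: (agree_trans (leqnn _) A1) => a H.
    by rewrite /upd; case: eqP => [|ne]; [lia | apply: A2; apply/eqP; lia].
- move=> /codeat_cat[C1 /codeat_cat[C2 /codeat_cons[E3 _]]] /and3P[lt wf1 wf2] t32 R [sf1 sf2 bs] g.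
  have [m1 [S1 e1' b1 A1]] := IH1 _ _ _ C1 wf1 t32 R sf1 g.
  have R1 := rel_agree t32 b1 R A1.
  have [//|m2 [S2 e2' b2 A2]] := IH2 _ _ _ C2 wf2 _ R1 sf2 g.
    by lia.
  have e1'' : m2 t = ev e1 s by rewrite A2 // leqnn.
  have [|S3 l3] := @step_bin o t t t.+1 _ m2 i c u E3 b2.
    by rewrite e1'' e2'.
  exists (upd m2 t (bsem o (m2 t) (m2 t.+1))); split.
  + rewrite !size_cat /= [in X in steps _ X _]addnA; apply: steps_trans.
      apply: steps_trans S1 S2.
    have -> : p + (size (cexpr e1 t) + (size (cexpr e2 t.+1) + 1)) =
      (p + size (cexpr e1 t) + size (cexpr e2 t.+1)).+1 by lia.
    by apply: stepsS S3 _ => //; apply: steps0.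
  + by rewrite /upd eqxx e1'' e2'.
  + exact: bounded_upd.
  + apply: (agree_trans (leqnn _) A1) => a H.
    by rewrite /upd; case: eqP => [|ne]; [lia | apply: A2; lia].
Qed.

(** Each of the [tau] iterations pays for one more pass through the code, and the added 1 for the
    pass that contains no iteration. *)
Lemma ccmd_steps c s tau s' : exec c s tau s' -> forall p m,
  codeat p (ccmd c p) -> wfc c -> rel s m -> goodio (sc s) (so s) ->
  exists t m', [/\ t <= csize c * tau.+1,
    steps (Config p m (si s) (sc s) (so s)) t
          (Config (p + csize c) m' (si s') (sc s') (so s')) & rel s' m'].
Proof.
elim=> {c s tau s'} /=.
- move=> s p m _ _ R g; exists 0, m; rewrite addn0; split=> //; exact: steps0.
- move=> s x e sf p m /codeat_cat[C1 /codeat_cons[E2 /codeat_cons[E3 _]]] /andP[lx wf] R g.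
  have [m1 [S1 e1 b1 A1]] := cexpr_steps (si s) C1 wf (leqnn _) R sf g.
  have R1 := rel_agree (leqnn _) b1 R A1.
  set m2 := upd m1 33 0.
  have b2 : bounded m2 by apply: bounded_upd => //; lia.
  have [|S3 l3] := @step_bin Add x 32 33 _ m2 (si s) (sc s) (so s) E3 b2.
    by rewrite /= /m2 /upd /= addn0; apply: b1.
  exists (size (cexpr e 32) + 2), (upd m2 x (bsem Add (m2 32) (m2 33))); split.
  + lia.
  + apply: steps_trans S1 _; rewrite addnA addn2.
    apply: stepsS; [exact: g | apply: step_const E2 _; lia |].
    by apply: stepsS; [exact: g | exact: S3 | exact: steps0].
  + case: R1 => _ H1 H2 H3; split=> //.
    * exact: bounded_upd.
    * move=> y ly; rewrite /= /m2 /upd /= addn0 e1; case: eqP => // _.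
      by case: eqP => [|_]; [lia | apply: H1].
    * move=> k y lk; rewrite /= /m2 /upd; do 2![case: eqP => [|_]; first lia]; exact: H2.
- move=> s k e1 e2 sf1 sf2 ad p m
    /codeat_cat[C1 /(codeat_cat (a := addr_code k 32))[C2 /codeat_cat[C3 /codeat_cons[E4 _]]]] /and3P[lk wf1 wf2] R g.
  have [m1 [S1 e1' b1 A1]] := cexpr_steps (si s) C1 wf1 (leqnn _) R sf1 g.
  have [|//|m2 [S2 e2' b2 A2]] := @addr_steps k 32 _ m1 (si s) (sc s) (so s) C2 b1 g.
    by rewrite e1'.
  have R2 : rel s m2.
    apply: (@rel_agree s m m2 32) => //; apply: (agree_trans (leqnn _) A1).
    by move=> a H; apply: A2; apply/eqP; lia.
  have [//|m3 [S3 e3 b3 A3]] := cexpr_steps (si s) C3 wf2 _ R2 sf2 g.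
  have [|_ R3v R3a R3i] := rel_agree _ b3 R2 A3; first by [].
  exists (size (cexpr e1 32) + (4 + (size (cexpr e2 33) + 1))),
    (upd m3 (64 + 32 * ev e1 s + k) (ev e2 s)); split.
  + lia.
  + do 3![apply: steps_trans; first by eassumption].
    apply: (@stepsS _ (Config (p + (size (cexpr e1 32) + (4 + (size (cexpr e2 33) + 1))))
       (upd m3 (64 + 32 * ev e1 s + k) (ev e2 s)) (si s) (sc s) (so s))) => //.
      rewrite /step /= E4; congr (Some (Config _ (upd _ _ _) _ _ _)) => //=.
      * lia.
      * by rewrite A3 // e2' e1'.
    exact: steps0.
  + split=> //.
    * by apply: bounded_upd => //; rewrite -e3.
    * by move=> y ly; rewrite /upd; case: eqP => [|_]; [lia | apply: R3v].
    * move=> j y lj; rewrite /= /upd2 /upd; case: (j =P k) => [->|ne].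
        rewrite eqn_add2r eqn_add2l eqn_pmul2l //; case: eqP => // _; exact: R3a.
      by case: eqP => [|_]; [lia | apply: R3a].
- move=> s1 s2 s3 t1 t2 c1 c2 _ IH1 _ IH2 p m /codeat_cat[C1 C2] /andP[wf1 wf2] R g.
  have [u1 [m1 [l1 S1 R1]]] := IH1 _ _ C1 wf1 R g.
  rewrite size_ccmd in C2.
  have [u2 [m2 [l2 S2 R2]]] := IH2 _ _ C2 wf2 R1 (steps_good S1).
  exists (u1 + u2), m2; split=> //; last by rewrite addnA; apply: steps_trans S1 S2.
  nia.
- move=> s s' t e c1 c2 sf nz _ IH p m /codeat_cat[C1 /codeat_cons[E2 /codeat_cat[C3 /codeat_cons[E4 _]]]]
    /and3P[wf wf1 wf2] R g.
  have [m1 [S1 e1 b1 A1]] := cexpr_steps (si s) C1 wf (leqnn _) R sf g.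
  have R1 := rel_agree (leqnn _) b1 R A1.
  rewrite -addn1 in C3; rewrite -addn1 size_ccmd in E4.
  have [u2 [m2 [l2 S2 R2]]] := IH _ _ C3 wf1 R1 g.
  exists (size (cexpr e 32) + (1 + (u2 + 1))), m2; split=> //; first nia.
  apply: steps_trans S1 _; apply: (@stepsS _ (Config (p + size (cexpr e 32) + 1) m1 (si s) (sc s) (so s))) => //.
    by rewrite /step /= E2 e1 (negbTE nz) addn1.
  have g2 := steps_good S2; apply: steps_trans S2 _; apply: stepsS; first exact: g2.
    by rewrite /step /= E4.
  rewrite !addnA; exact: steps0.
- move=> s s' t e c1 c2 sf z _ IH p m /codeat_cat[C1 /codeat_cons[E2 /codeat_cat[_ /codeat_cons[_ C5]]]]
    /and3P[wf wf1 wf2] R g.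
  have [m1 [S1 e1 b1 A1]] := cexpr_steps (si s) C1 wf (leqnn _) R sf g.
  have R1 := rel_agree (leqnn _) b1 R A1.
  rewrite -addn1 -addn1 size_ccmd in C5.
  have [u2 [m2 [l2 S2 R2]]] := IH _ _ C5 wf2 R1 g.
  exists (size (cexpr e 32) + (1 + u2)), m2; split=> //; first nia.
  apply: steps_trans S1 _; rewrite !addnA in S2 *; apply: stepsS S2 => //.
  by rewrite /step /= E2 e1 z eqxx.
- move=> s e c sf z p m /codeat_cat[C1 /codeat_cons[E2 _]] /andP[wf _] R g.
  have [m1 [S1 e1 b1 A1]] := cexpr_steps (si s) C1 wf (leqnn _) R sf g.
  have R1 := rel_agree (leqnn _) b1 R A1.
  exists (size (cexpr e 32) + 1), m1; split=> //; first nia.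
  apply: steps_trans S1 _; apply: stepsS; [exact: g | by rewrite /step /= E2 e1 z eqxx |].
  rewrite !addnA; exact: steps0.
- move=> s1 s2 s3 t1 t2 e c sf nz _ IH1 _ IH2 p m C /andP[wf wf1] R g.
  have [C1 /codeat_cons[E2 /codeat_cat[C3 /codeat_cons[E4 _]]]] := codeat_cat C.
  have [m1 [S1 e1 b1 A1]] := cexpr_steps (si s1) C1 wf (leqnn _) R sf g.
  have R1 := rel_agree (leqnn _) b1 R A1.
  rewrite -addn1 in C3; rewrite -addn1 size_ccmd in E4.
  have [u2 [m2 [l2 S2 R2]]] := IH1 _ _ C3 wf1 R1 g.
  have [|u3 [m3 [l3 S3 R3]]] := IH2 p m2 C _ R2 (steps_good S2); first by rewrite /= wf wf1.
  exists (size (cexpr e 32) + (1 + (u2 + (1 + u3)))), m3; split=> //; first nia.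
  apply: steps_trans S1 _; apply: (@stepsS _ (Config (p + size (cexpr e 32) + 1) m1 (si s1) (sc s1) (so s1))) => //.
    by rewrite /step /= E2 e1 (negbTE nz) addn1.
  have g2 := steps_good S2; apply: steps_trans S2 _; apply: stepsS S3; first exact: g2.
  by rewrite /step /= E4.
- move=> s x ok p m /codeat_cons[E _] lx [b H1 H2 H3] g.
  case: s ok b H1 H2 H3 g => v a i c u /= ok b H1 H2 H3 g.
  rewrite /rdst /=; case Eh: (head end_rec i) => [[x0 y0] z0].
  have [l1 l2 l3] : [/\ x0 < W, y0 < W & z0 < W].
    (* An exhausted input delivers [end_rec], whose entries are words as well. *)
    case: i Eh H3 {g} => [|r i] /= => [[<- <- <-] _|-> H]; first by split; lia.
    by have := H _ (mem_head _ _).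
  exists 1, (upd (upd (upd m x x0) x.+1 y0) x.+2 z0); split=> //.
    apply: stepsS; first exact: g.
      by rewrite /step /= E Eh.
    by rewrite addn1; apply: steps0.
  split=> /=.
  + by do 3!apply: bounded_upd => //.
  + by move=> y ly; rewrite /upd; do 3!case: eqP => // _; apply: H1.
  + by move=> k y lk; rewrite /upd; do 3![case: eqP => [|_]; first lia]; apply: H2.
  + by move=> r Hr; apply: H3; apply: mem_behead.
- move=> s e sf p m /codeat_cat[C1 /codeat_cons[E2 _]] wf R g.
  have [m1 [S1 e1 b1 A1]] := cexpr_steps (si s) C1 wf (leqnn _) R sf g.
  have R1 := rel_agree (leqnn _) b1 R A1.
  exists (size (cexpr e 32) + 1), m1; split=> //; first by lia.
  apply: steps_trans S1 _; apply: stepsS; first exact: g.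
    by rewrite /step /= E2.
  rewrite addnA addn1 e1; apply: steps0; rewrite /good /= size_rcons; exact: leqW.
Qed.

End Machine.

(** * A program logic for total correctness within a time budget *)

Definition wp (c : cmd) (s : st) (T : nat) (Q : st -> Prop) : Prop :=
  exists t s', [/\ t <= T, exec c s t s' & Q s'].

Lemma wp_mono c s T T' (Q Q' : st -> Prop) : wp c s T Q -> T <= T' ->
  (forall s', Q s' -> Q' s') -> wp c s T' Q'.
Proof. by move=> [t [s' [l X H]]] l' QQ; exists t, s'; split; [lia | | apply: QQ]. Qed.

Lemma wp_seq c1 c2 s T1 T2 Q :
  wp c1 s T1 (fun s' => wp c2 s' T2 Q) -> wp (Seq c1 c2) s (T1 + T2) Q.
Proof.
move=> [t1 [s1 [l1 X1 [t2 [s2 [l2 X2 H]]]]]].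
by exists (t1 + t2), s2; split=> //; [lia | apply: X_seq X1 X2].
Qed.

Lemma wp_seq0 c1 c2 s T Q :
  wp c1 s 0 (fun s' => wp c2 s' T Q) -> wp (Seq c1 c2) s T Q.
Proof. exact: wp_seq. Qed.

Lemma wp_skip s T (Q : st -> Prop) : Q s -> wp Skip s T Q.
Proof. by move=> H; exists 0, s; split=> //; apply: X_skip. Qed.

Lemma wp_asg s x e T (Q : st -> Prop) :
  safe e s -> Q (setv s x (ev e s)) -> wp (Asg x e) s T Q.
Proof. by move=> sf H; eexists 0, _; split; [| apply: X_asg |]. Qed.

Lemma wp_sto s i e1 e2 T (Q : st -> Prop) :
  safe e1 s -> safe e2 s -> 32 * ev e1 s + 96 <= W ->
  Q (seta s i (ev e1 s) (ev e2 s)) -> wp (Sto i e1 e2) s T Q.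
Proof. by move=> sf1 sf2 ad H; eexists 0, _; split; [| apply: X_sto |]. Qed.

Lemma wp_if s e c1 c2 T Q : safe e s ->
  (ev e s != 0 -> wp c1 s T Q) -> (ev e s = 0 -> wp c2 s T Q) ->
  wp (If e c1 c2) s T Q.
Proof.
move=> sf H1 H2; case: (ev e s =P 0) => [z|/eqP nz].
  by have [t [s' [l X H]]] := H2 z; exists t, s'; split=> //; apply: X_iff.
by have [t [s' [l X H]]] := H1 nz; exists t, s'; split=> //; apply: X_ift.
Qed.

Lemma wp_rd s x T (Q : st -> Prop) :
  q (sc s).+1 <= size (so s) -> Q (rdst s x) -> wp (Rd x) s T Q.
Proof. by move=> ok H; eexists 0, _; split; [| apply: X_rd |]. Qed.

Lemma wp_wr s e T (Q : st -> Prop) :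
  safe e s -> Q (wrst s (ev e s)) -> wp (Wr e) s T Q.
Proof. by move=> sf H; eexists 0, _; split; [| apply: X_wr |]. Qed.

(** The index of the invariant is both termination measure and remaining budget: an iteration of
    inner cost [t] must lower it by more than [t], the extra unit paying for the iteration
    itself. *)
Lemma wp_while (Inv : nat -> st -> Prop) e c (Q : st -> Prop) :
  (forall k s, Inv k s -> [/\ safe e s, ev e s = 0 -> Q s &
     ev e s != 0 -> exists t, wp c s t (fun s' => exists k', k' + t < k /\ Inv k' s')]) ->
  forall k s, Inv k s -> wp (While e c) s k Q.
Proof.
move=> H k; elim/ltn_ind: k => k IH s Is.
have [sf H0 H1] := H _ _ Is.
case: (ev e s =P 0) => [z|/eqP nz].
  by exists 0, s; split=> //; [apply: X_whf | apply: H0].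
have [t [t1 [s1 [l1 X1 [k' [lk Ik']]]]]] := H1 nz.
have [|t2 [s2 [l2 X2 Q2]]] := IH k' _ s1 Ik'; first by lia.
by exists (t1 + t2).+1, s2; split=> //; [lia | apply: X_wht X1 X2].
Qed.

End Language.

(** * Bit masks *)

Fixpoint bits (m : nat) (f : nat -> bool) : nat :=
  if m is m'.+1 then bits m' f + f m' * 2 ^ m' else 0.

(* One more than the largest [i < m] with [f i], and 0 if there is none. *)
Fixpoint mx (f : nat -> bool) (m : nat) : nat :=
  if m is m'.+1 then if f m' then m else mx f m' else 0.

Section Bits.

Implicit Types f h : nat -> bool.

Lemma bits_lt m f : bits m f < 2 ^ m.
Proof. by elim: m => //= m IH; rewrite expnS; case: (f m); lia. Qed.

Lemma eq_bits m f (g : nat -> bool) : (forall i, i < m -> f i = g i) -> bits m f = bits m g.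
Proof. by elim: m => //= m IH H; rewrite IH ?H // => i li; apply: H; lia. Qed.

Lemma bits0 m f : (forall i, i < m -> f i = false) -> bits m f = 0.
Proof. by elim: m => //= m IH H; rewrite IH ?H // => i li; apply: H; lia. Qed.

Lemma bitsT m : bits m xpredT = 2 ^ m - 1.
Proof. by elim: m => //= m ->; have := expn_gt0 2 m; rewrite expnS; lia. Qed.

Lemma bits_add m f (g : nat -> bool) h :
  (forall i, i < m -> h i = f i || g i) -> (forall i, i < m -> f i && g i = false) ->
  bits m h = bits m f + bits m g.
Proof.
elim: m => //= m IH H1 H2; rewrite IH => [|i li|i li]; [|apply: H1; lia|apply: H2; lia].
by rewrite H1 //; have := H2 m (ltnSn _); case: (f m); case: (g m) => //=; lia.
Qed.

Lemma bits_sub m f (g : nat -> bool) h :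
  (forall i, i < m -> h i = f i && ~~ g i) -> (forall i, i < m -> g i -> f i) ->
  bits m f - bits m g = bits m h.
Proof.
move=> H1 H2; have -> : bits m f = bits m h + bits m g.
  apply: bits_add => i li; rewrite H1 //; move: (H2 i li); case: (f i); case: (g i) => // H.
  by have := H isT.
by rewrite addnK.
Qed.

Lemma bits1 m i : i < m -> bits m (fun j => j == i) = 2 ^ i.
Proof.
elim: m => //= m IH; rewrite ltnS leq_eqVlt => /orP[/eqP->|li].
  rewrite eqxx mul1n bits0 // => j lj; apply/eqP; lia.
by rewrite IH //; case: eqP => [|_]; lia.
Qed.

Lemma bits_set m f h i : i < m -> f i = false ->
  (forall j, j < m -> h j = f j || (j == i)) -> bits m f + 2 ^ i = bits m h.
Proof.
move=> li fi H; rewrite -(bits1 li); symmetry; apply: bits_add => // j lj.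
by case: eqP => [->|]; rewrite ?fi ?andbF.
Qed.

Lemma bits_mod m f j : j <= m -> bits m f %% 2 ^ j = bits m (fun i => f i && (i < j)).
Proof.
elim: m => [|m IH]; first by case: j => //= _; rewrite modn_small.
rewrite leq_eqVlt => /orP[/eqP->|lj].
  rewrite modn_small ?bits_lt //; apply: eq_bits => i ->; by rewrite andbT.
rewrite /= (_ : m < j = false) ?andbF ?mul0n ?addn0; last by lia.
rewrite -IH //.
have -> : f m * 2 ^ m = (f m * 2 ^ (m - j)) * 2 ^ j by rewrite -mulnA -expnD subnK.
by rewrite addnC modnMDl.
Qed.

Lemma bits_lo m f j : j <= m -> bits m (fun i => f i && (i < j)) = bits j f.
Proof.
elim: m => [|m IH]; first by case: j.
rewrite leq_eqVlt => /orP[/eqP->|lj]; first by apply: eq_bits => i ->; rewrite andbT.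
by rewrite /= IH // (_ : m < j = false) ?andbF ?mul0n ?addn0 //; lia.
Qed.

Lemma bits_bit m f i : i < m -> (bits m f %/ 2 ^ i) %% 2 = f i.
Proof.
move=> li.
have H := @bits_mod m f i.+1 li; rewrite bits_lo // in H.
rewrite (divn_eq (bits m f) (2 ^ i.+1)) H /= expnS.
have -> : bits m f %/ (2 * 2 ^ i) * (2 * 2 ^ i) + (bits i f + f i * 2 ^ i) =
   (bits m f %/ (2 * 2 ^ i) * 2 + f i) * 2 ^ i + bits i f by lia.
rewrite divnMDl ?expn_gt0 // (divn_small (bits_lt i f)) addn0 modnMDl.
by case: (f i).
Qed.

Lemma bits_shift m f : bits m.+1 f = f 0 + 2 * bits m (fun i => f i.+1).
Proof. by elim: m => [|m IH] //=; [lia | rewrite -/(bits m.+1 f) IH expnS; lia]. Qed.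

Lemma bits_half m f : bits m.+1 f %/ 2 = bits m (fun i => f i.+1).
Proof. by rewrite bits_shift; case: (f 0); lia. Qed.

Lemma bits_odd m f : bits m.+1 f %% 2 = f 0.
Proof. by rewrite bits_shift; case: (f 0); lia. Qed.

Lemma bits_land m f (g : nat -> bool) : Nat.land (bits m f) (bits m g) = bits m (fun i => f i && g i).
Proof.
elim: m f g => // m IH f g; rewrite !bits_shift -IH.
set a := bits m _; set b := bits m _.
have b2 (p : bool) x : p + 2 * x = (2 * x + PeanoNat.Nat.b2n p)%coq_nat by case: p => /=; lia.
apply: PeanoNat.Nat.bits_inj => -[|i]; rewrite PeanoNat.Nat.land_spec !b2.
  by rewrite !PeanoNat.Nat.testbit_0_r.
by rewrite !PeanoNat.Nat.testbit_succ_r PeanoNat.Nat.land_spec.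
Qed.

Lemma mx0 f m : (forall i, i < m -> f i = false) -> mx f m = 0.
Proof. by elim: m => //= m IH H; rewrite H // IH // => i li; apply: H; lia. Qed.

Lemma mx_eq0 f m i : mx f m = 0 -> i < m -> f i = false.
Proof.
elim: m => //= m IH; case E: (f m) => // H; rewrite ltnS leq_eqVlt => /orP[/eqP->//|]; exact: IH.
Qed.

Lemma mxS f m i : mx f m = i.+1 -> [/\ i < m, f i & forall j, i < j < m -> f j = false].
Proof.
elim: m => //= m IH; case: ifP => [fm|fm /IH[li fi H]].
  by case=> <-; split=> // j; lia.
split=> // [|j]; first lia.
by case: (j =P m) => [->//|ne lj]; apply: H; lia.
Qed.

Lemma mx_intro f m i : i < m -> f i -> (forall j, i < j < m -> f j = false) -> mx f m = i.+1.
Proof.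
elim: m => //= m IH li fi H.
case: (i =P m) => [<-|ne]; first by rewrite fi.
by rewrite H ?IH //; try lia; move=> j lj; apply: H; lia.
Qed.

Lemma mx_gt0 f m i : i < m -> f i -> 0 < mx f m.
Proof. by move=> li fi; case E: (mx f m) => //; rewrite (mx_eq0 E) in fi. Qed.

Lemma mx_shift f m : mx f m.+1 =
  if mx (fun i => f i.+1) m is i.+1 then i.+2 else f 0.
Proof.
elim: m => [|m IH]; first by rewrite /=; case: (f 0).
by rewrite [LHS]/= -/(mx f m.+1) IH /=; case: (f m.+1).
Qed.

Section Tables.
Variables (K : nat) (tm tp : nat -> nat).
Hypotheses (tm0 : tm 0 = 0) (tmS : forall i, 0 < i < 2 ^ K -> tm i = (tm (i %/ 2)).+1).
Hypotheses (tp0 : tp 0 = 0) (tpS : forall i, 0 < i < 2 ^ K -> tp i = tp (i %/ 2) + i %% 2).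

(** Halving a mask drops bit 0 and shifts the others down ([bits_half]), so the recurrence of the
    table is the recursion [mx_shift]. *)
Lemma tm_bits m f : m <= K -> tm (bits m f) = mx f m.
Proof.
elim: m f => [|m IH] f lm; first exact: tm0.
rewrite mx_shift.
have lt : bits m.+1 f < 2 ^ K by apply: leq_trans (bits_lt _ _) _; rewrite leq_exp2l.
case: (posnP (bits m.+1 f)) => [z|p].
  have := bits_half m f; have := bits_odd m f; rewrite z tm0 div0n mod0n => <- z'.
  by rewrite -IH ?(ltnW lm) // -z' tm0.
rewrite tmS ?p // bits_half IH ?(ltnW lm) //.
case E: (mx _ m) => //; move: p; rewrite bits_shift bits0 => [|i li]; last exact: (mx_eq0 E li).
by case: (f 0).
Qed.

Lemma tp_bits m f : m <= K -> tp (bits m f) = \sum_(i < m) f i.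
Proof.
elim: m f => [|m IH] f lm; first by rewrite big_ord0 tp0.
have lt : bits m.+1 f < 2 ^ K by apply: leq_trans (bits_lt _ _) _; rewrite leq_exp2l.
rewrite big_ord_recl -(IH (fun i => f i.+1)) ?(ltnW lm) // -bits_half.
case: (posnP (bits m.+1 f)) => [z|p].
  by have := bits_odd m f; rewrite z div0n mod0n tp0 => <-.
by rewrite tpS ?p // bits_odd addnC.
Qed.
End Tables.

End Bits.

(** * Marked intervals and pieces of blocks *)

Lemma half2 g : (2 * g) %/ 2 = g. Proof. lia. Qed.
Lemma half21 g : (2 * g + 1) %/ 2 = g. Proof. lia. Qed.
Lemma odd2 g : odd (2 * g) = false. Proof. lia. Qed.
Lemma odd21 g : odd (2 * g + 1) = true. Proof. lia. Qed.
Definition nodeE := (half2, half21, odd2, odd21).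

Lemma node_split k : k = if odd k then 2 * (k %/ 2) + 1 else 2 * (k %/ 2).
Proof. by case E: (odd k); lia. Qed.

Section Geometry.

Variables (N B : nat) (R : nat -> nat).
Hypothesis B_gt0 : 0 < B.
Hypothesis R_bound : forall x, x < N -> x < R x <= N.
Hypothesis R_laminar : forall x y, x < N -> x <= y < R x -> R y <= R x.

Definition base (x : nat) : nat := x %/ B * B.
Definition off (x : nat) : nat := x %% B.

Lemma base_le x : base x <= x. Proof. exact: leq_trunc_div. Qed.
Lemma base_gt x : x < base x + B.
Proof. by rewrite addnC -mulSn ltn_ceil. Qed.
Lemma base_mod x : x = base x + off x. Proof. exact: divn_eq. Qed.
Lemma off_lt x : off x < B. Proof. by rewrite ltn_mod. Qed.
Lemma base_add x i : i < B -> base (base x + i) = base x.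
Proof. by move=> li; rewrite /base divnMDl // (divn_small li) addn0. Qed.
Lemma base_id x : base (base x) = base x.
Proof. by rewrite -{1}[base x]addn0 base_add. Qed.
Lemma base_mono x y : x <= y -> base x <= base y.
Proof. by move=> H; rewrite leq_mul2r leq_div2r ?orbT. Qed.
Lemma base_lt x y : base x < base y -> x < base y.
Proof.
move=> H; apply: leq_trans (base_gt x) _; rewrite /base in H *.
by rewrite -mulSnr leq_mul2r; move: H; rewrite ltn_mul2r => /andP[_ ->]; rewrite orbT.
Qed.
Lemma base_eq x y : base x <= y < base x + B -> base y = base x.
Proof.
by move=> H; have -> : y = base x + (y - base x) by [lia]; rewrite base_add //; lia.
Qed.

Definition ini (d y : nat) : bool := d <= y < R d.

(* A piece of a block is named by a node: 2g+1 for the positions whose innermost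
   marked interval starts at g inside the block, and 2g for the positions from g
   on that lie in no marked interval starting in the block, up to the next end
   [R d] of a marked interval entering the block from the left.  [inn d k] says
   that the interval of d contains the piece k. *)
Definition inn (d k : nat) : bool :=
  (d < (if odd k then (k %/ 2).+1 else base (k %/ 2))) && (k %/ 2 < R d).

Implicit Type D : nat -> bool.

(** An interval that starts inside the block gives the positions behind its end back to the piece
    surrounding it. Outside such intervals the class changes only at these ends, so no others are
    recorded. *)
Definition Em D (g : nat) : bool :=
  (off g == 0) || has (fun d => D d && (R d == g)) (iota 0 (base g)).

(* Nodes of existing pieces; some of these pieces may be empty. *)
Definition live D (k : nat) : bool :=
  (k %/ 2 <= N) && (if odd k then D (k %/ 2) else Em D (k %/ 2)).

(* The node of the piece containing y, as the program computes it. *)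
Definition F D (y : nat) : nat :=
  let b := base y in
  if mx (fun i => D (b + i) && ini (b + i) y) B is i.+1 then 2 * (b + i) + 1
  else 2 * (b + (mx (fun e => Em D (b + e)) (off y).+1).-1).

(** The pieces belong to the same tree; this is the equivalence that labels have to represent. *)
Definition ns D (k k' : nat) : Prop := forall d, D d -> inn d k = inn d k'.

Lemma EmP D g : reflect (off g = 0 \/ exists2 d, d < base g & D d /\ R d = g) (Em D g).
Proof.
apply: (iffP orP) => [[/eqP->|/hasP[d]]|[->|[d ld [Dd Rd]]]]; [by left| |by left|right].
  by rewrite mem_iota => /andP[_ ld] /andP[Dd /eqP Rd]; right; exists d.
by apply/hasP; exists d; rewrite ?mem_iota ?Dd ?Rd ?eqxx //; lia.
Qed.

Lemma Em_intro D d g : d < base g -> D d -> R d = g -> Em D g.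
Proof. by move=> *; apply/EmP; right; exists d. Qed.

Lemma Em_base D g : Em D (base g).
Proof. by apply/EmP; left; rewrite /off /base modnMl. Qed.

Lemma modB_eq0 g : off g = 0 -> base g = g.
Proof. by move=> H; rewrite [RHS]base_mod H addn0. Qed.

Section Marks.

Variable D : nat -> bool.
Hypothesis D_lt : forall d, D d -> d < N.

Lemma F_cases y :
  (exists g, [/\ F D y = 2 * g + 1, base g = base y, D g, ini g y &
     forall d, D d -> g < d -> base d = base y -> ini d y = false]) \/
  (exists g, [/\ F D y = 2 * g, base g = base y, Em D g, g <= y &
     (forall d, D d -> base d = base y -> ini d y = false) /\
     (forall e, g < e <= y -> Em D e = false)]).
Proof.
rewrite /F; case E1: (mx _ B) => [|i]; [right|left].
  case E2: (mx _ _) => [|e].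
    have := mx_eq0 (i := 0) E2 (ltn0Sn _); by rewrite addn0 Em_base.
  have [le Ee H] := mxS E2; rewrite /= in le Ee H *.
  have := base_mod y => By.
  have lB : off y < B by apply: off_lt.
  exists (base y + e); split=> //; first by rewrite base_add //; lia.
    by lia.
  split=> [d Dd bd|e' le'].
    have H1 := base_le d; have H2 := base_gt d.
    have := mx_eq0 (i := d - base y) E1; rewrite (_ : base y + (d - base y) = d) ?Dd; last lia.
    by apply; lia.
  have -> : e' = base y + (e' - base y) by lia.
  apply: H; lia.
have [le /andP[Dg Ig] H] := mxS E1.
exists (base y + i); split=> //; first by rewrite base_add.
move=> d Dd gd bd; have H1 := base_le d; have H2 := base_gt d.
have := H (d - base y); rewrite (_ : base y + (d - base y) = d) ?Dd /=; last lia.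
by apply; lia.
Qed.

Lemma F_base y : base (F D y %/ 2) = base y.
Proof. by case: (F_cases y) => -[g [-> bg _ _ _]]; rewrite nodeE. Qed.

Lemma F_le y : F D y %/ 2 <= y.
Proof.
by case: (F_cases y) => -[g [-> _ _ H _]]; rewrite nodeE //; move: H; rewrite /ini; lia.
Qed.

Lemma F_live y : y <= N -> live D (F D y).
Proof.
move=> ly; rewrite /live (leq_trans (F_le y) ly).
by case: (F_cases y) => -[g [-> _ H _ _]]; rewrite !nodeE.
Qed.

(** This lets a node stand for all its positions. For an odd node at [g], an interval through [y]
    starts no later than [g] because [g] is innermost, and an interval through [g] reaches [y] by
    laminarity. For an even node, no interval starting in the block contains [y], and no entering
    interval ends between [g] and [y]. *)
Lemma F_match y d : D d -> ini d y = inn d (F D y).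
Proof.
move=> Dd; have Hd := R_bound (D_lt Dd).
have := base_le y; have := base_le d; have := base_gt d; have := base_gt y => *.
case: (F_cases y) => -[g [-> bg Dg Ig H]]; rewrite /inn !nodeE.
  have Hg := R_bound (D_lt Dg).
  rewrite /ini in Ig *; apply/idP/idP => I.
    case: (leqP d g) => [|gd]; first lia.
    by have := H d Dd gd; rewrite /ini I; have := base_mono (ltnW gd);
       have := @base_mono d y; lia.
  have := R_laminar (D_lt Dd) (y := g); lia.
case: H => H1 H2; rewrite bg /ini; apply/idP/idP => I.
  case: (ltnP d (base y)) => [|gd]; first by lia.
  have bd : base d = base y by apply: base_eq; lia.
  by have := H1 d Dd bd; rewrite /ini I.
case: (leqP (R d) y) => [Ry|]; last lia.
have := H2 (R d); rewrite (@Em_intro D d) //; [by lia|].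
have -> : base (R d) = base y by apply: base_eq; have := base_le g; lia.
lia.
Qed.

(** An odd node lies in its own interval, which contains no even node of the block and no odd node
    starting earlier. Of two even nodes, the later one sits at the end of an interval that contains
    the earlier one. *)
Lemma node_uniq k k' : live D k -> live D k' -> base (k %/ 2) = base (k' %/ 2) ->
  ns D k k' -> k = k'.
Proof.
wlog le : k k' / k %/ 2 <= k' %/ 2 => [IH|].
  case: (leqP (k %/ 2) (k' %/ 2)) => [|/ltnW] le L L' bb S; first exact: IH.
  by apply/esym/IH => // d Dd; rewrite S.
move=> /andP[_ L] /andP[_ L'] bb S; rewrite (node_split k) (node_split k').
move: L L' S bb le; rewrite /ns /inn; move: (k %/ 2) (k' %/ 2) => g g'.
have Hg := base_le g; have Hg' := base_le g'; have Hgg := base_gt g.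
case: (odd k); case: (odd k') => L L' S bb le.
- have := S _ L'; have := S _ L; have := R_bound (D_lt L'); have := R_bound (D_lt L); lia.
- have := S _ L; have := R_bound (D_lt L); lia.
- have := S _ L'; have := R_bound (D_lt L'); lia.
- case: (ltngtP g g') le => // [lt _|-> //].
  case/EmP: L' => [/modB_eq0|[d ld [Dd Rd]]]; first lia.
  by have := S _ Dd; rewrite Rd; lia.
Qed.

(** With this, [F] after a new mark is computed by exhibiting a live node with the right intervals,
    without looking at the two maxima again. *)
Lemma F_char k y : y <= N -> live D k -> base (k %/ 2) = base y ->
  (forall d, D d -> ini d y = inn d k) -> F D y = k.
Proof.
move=> ly L b H; apply: node_uniq => //; first exact: F_live.
  by rewrite F_base b.
by move=> d Dd; rewrite -F_match // H.
Qed.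

End Marks.

(** * The effect of a new mark on the pieces *)

Section Cut.

Variables (D : nat -> bool) (x : nat).
Hypothesis D_lt : forall d, D d -> d < N.
Hypotheses (x_lt : x < N) (x_new : D x = false).

Let r := R x.
Definition mark : nat -> bool := fun d => D d || (d == x).
Let k0 := F D x.
Let k1 := 2 * x + 1.
Let hi := 2 * r.
(* The right end of the new interval splits the piece [pre2] of its block, unless
   some marked interval already ends there. *)
Definition split2 : bool := (base x != base r) && ~~ Em D r.
(** The split piece cannot be obtained as [F D r] or [F D r.-1], since these positions may lie in
    marked intervals that start in the block of [r]. The bound [off r], without successor, asks for
    a start strictly before [r]. *)
Definition pre2 : nat := 2 * (base r + (mx (fun e => Em D (base r + e)) (off r)).-1).
Let j := pre2.

Let Hr : x < r <= N. Proof. exact: R_bound. Qed.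
Let bxr : base x <= base r. Proof. apply: base_mono; lia. Qed.

Lemma mark_lt d : mark d -> d < N.
Proof. by case/orP => [|/eqP->//]; apply: D_lt. Qed.

Lemma Em_mark g : Em mark g = Em D g || (split2 && (g == r)).
Proof.
apply/EmP/orP => [[H|[d ld [/orP[Dd|/eqP dx] Rd]]]|[/EmP[H|[d ld [Dd Rd]]]|/andP[/andP[H _] /eqP->]]].
- by left; apply/EmP; left.
- by left; apply: Em_intro ld Dd Rd.
- have gr : g = r by rewrite -Rd dx.
  case E: (Em D g); first by left.
  right; rewrite gr eqxx andbT; apply/andP; split; last by rewrite -gr E.
  by apply/eqP => bb; have := base_le x; move: ld; rewrite bb -gr dx; lia.
- by left.
- by right; exists d => //; rewrite /mark Dd.
- right; exists x; last by rewrite /mark eqxx orbT.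
  by apply: base_lt; rewrite ltn_neqAle H.
Qed.

Lemma live_mark k : live mark k = [|| live D k, k == k1 | split2 && (k == hi)].
Proof.
rewrite /live; case O: (odd k).
  rewrite (_ : k == hi = false) ?andbF ?orbF; last by apply/eqP; lia.
  rewrite /mark andb_orr; congr (_ || _).
  by apply/andP/eqP => [[_ /eqP]|->]; rewrite ?nodeE; [lia | split; lia].
rewrite Em_mark (_ : k == k1 = false); last by apply/eqP; lia.
rewrite andb_orr /=; congr (_ || _).
case: split2; rewrite /= ?andbF //.
by apply/andP/eqP => [[_ /eqP]|->]; rewrite ?nodeE; [lia | split; lia].
Qed.

Lemma k1_new : live D k1 = false.
Proof. by rewrite /live !nodeE x_new andbF. Qed.

Lemma hi_new : split2 -> live D hi = false.
Proof. by move=> /andP[_ /negbTE E]; rewrite /live !nodeE E andbF. Qed.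

Lemma inn_k1 d : inn d k1 = ini d x.
Proof. by rewrite /inn !nodeE /ini ltnS. Qed.

Lemma inn_k0 d : D d -> inn d k0 = ini d x.
Proof. by move=> Dd; rewrite (F_match D_lt). Qed.

Lemma split2_base : split2 -> x < base r < r.
Proof.
move=> /andP[bb E]; apply/andP; split; first by apply: base_lt; rewrite ltn_neqAle bb.
have := base_le r; rewrite leq_eqVlt => /orP[/eqP e|//].
by rewrite -e Em_base in E.
Qed.

Lemma pre2P : split2 -> exists g, [/\ j = 2 * g, base g = base r, Em D g, g < r &
  forall e, g < e <= r -> Em D e = false].
Proof.
move=> s2; have := split2_base s2; have := base_mod r => Br lr.
have lB : off r < B by apply: off_lt.
rewrite /j /pre2; case E: (mx _ _) => [|e].
  have := mx_eq0 (i := 0) E; rewrite addn0 Em_base => H.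
  by have /H : 0 < off r by lia.
have [le Ee H] := mxS E.
exists (base r + e); split=> //; first by rewrite base_add //; lia.
  lia.
move=> e' le'; case: (e' =P r) => [->|ne]; first by case/andP: s2 => _ /negbTE.
have -> : e' = base r + (e' - base r) by lia.
apply: H; lia.
Qed.

Lemma pre2_live : split2 -> live D j.
Proof. by move=> s2; have [g [-> bg Eg lg _]] := pre2P s2; rewrite /live !nodeE Eg; lia. Qed.

Lemma pre2_lt : split2 -> j < hi.
Proof. by move=> s2; have [g [-> _ _ lg _]] := pre2P s2; rewrite /hi; lia. Qed.

(** So the split piece belongs to the tree being cut. An entering interval that reaches beyond [g]
    also reaches beyond [r], as its end would otherwise be recorded between them; by laminarity it
    then contains [x]. *)
Lemma inn_pre2 d : split2 -> D d -> inn d j = ini d x.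
Proof.
move=> s2 Dd; have [g [-> bg Eg lg H]] := pre2P s2; rewrite /inn !nodeE bg /ini.
have lr := split2_base s2; have Hd := R_bound (D_lt Dd); have := base_le g => bg'.
apply/idP/idP => I; last first.
  by have := R_laminar (D_lt Dd) (y := x); rewrite -/r; lia.
case: (leqP (R d) r) => [Rr|Rr].
  have := H (R d); rewrite (@Em_intro D d) //; [lia|].
  have -> : base (R d) = base r by apply: base_eq; have := base_gt r; lia.
  lia.
case: (leqP d x) => [|dx]; first lia.
by have := R_laminar x_lt (y := d); rewrite -/r; lia.
Qed.

Lemma inn_hi d : split2 -> D d -> inn d hi = ini d x.
Proof.
move=> s2 Dd; rewrite -inn_pre2 //; have [g [-> bg Eg lg H]] := pre2P s2; rewrite /inn !nodeE bg.
case: (ltnP d (base r)) => //= ld; apply/idP/idP; first lia.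
move=> I; case: (leqP (R d) r) => // Rr.
have := H (R d); rewrite (@Em_intro D d) //; [lia|].
have -> : base (R d) = base r.
  by apply: base_eq; have := base_gt r; have := base_le g; lia.
lia.
Qed.

Lemma inn_x_k0 : inn x k0 = false.
Proof.
rewrite /k0; case: (F_cases D x) => -[g [-> bg Dg Ig _]]; rewrite /inn !nodeE.
  have : g != x by apply/eqP => e; rewrite e x_new in Dg.
  by move: Ig; rewrite /ini; lia.
by rewrite bg; have := base_le x; lia.
Qed.

Lemma inn_x_hi : inn x hi = false.
Proof. by rewrite /inn !nodeE; rewrite -/r ltnn andbF. Qed.

Lemma inn_x_pre2 : split2 -> inn x j.
Proof.
move=> s2; have lr := split2_base s2; have [g [-> bg _ lg _]] := pre2P s2.
by rewrite /inn !nodeE bg -/r; lia.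
Qed.

(* Two nodes in the same old intervals can be separated by the new interval
   only if they lie in the class being cut. *)
Lemma separated k k' : ns D k k' -> inn x k -> ~~ inn x k' -> ns D k k1.
Proof.
move=> S I I' d Dd; rewrite inn_k1; have Hd := R_bound (D_lt Dd).
move: (S _ Dd) I I'; rewrite /inn /ini -/r.
have := R_laminar (D_lt Dd) (y := x); have := R_laminar x_lt (y := d); rewrite -/r => L1 L2.
have := base_le (k %/ 2); have := base_le (k' %/ 2).
case: (odd k); case: (odd k') => *; lia.
Qed.

Lemma F_mark y : y <= N -> F mark y =
  if (F D y == k0) && ini x y then k1
  else if [&& split2, F D y == j & r <= y] then hi else F D y.
Proof.
move=> ly; have Lk := F_live D ly; have bk := F_base D y; have Mk := F_match D_lt y.
have X : ini x y = (x <= y < r) by [].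
case: ifP => [/andP[/eqP E I]|C1].
  apply: F_char => //; first exact: mark_lt.
  - by rewrite live_mark eqxx orbT.
  - by rewrite nodeE -bk E F_base.
  - move=> d /orP[Dd|/eqP->]; rewrite inn_k1; last by rewrite I /ini -/r; lia.
    by rewrite Mk // E inn_k0.
case: ifP => [/and3P[s2 /eqP E ry]|C2].
  apply: F_char => //; first exact: mark_lt.
  - by rewrite live_mark s2 eqxx !orbT.
  - by have [g [jg bg _ _ _]] := pre2P s2; rewrite nodeE -bk E jg nodeE.
  - move=> d /orP[Dd|/eqP->]; first by rewrite Mk // E inn_pre2 // inn_hi.
    by rewrite inn_x_hi X; lia.
apply: F_char => //; [exact: mark_lt | by rewrite live_mark Lk |].
move=> d /orP[Dd|/eqP-> {d}]; first exact: Mk.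
apply/idP/idP => I; apply/negPn/negP => I'.
(* Here [y] is in the new interval and its node is not. The node then lies in the same old intervals
   as [x], so in the block of [x] it is [k0]. In a later block an odd node would have its own start
   at most [x], and an even node starts before [r] and is inside after all. *)
- have MX d : D d -> ini d x = inn d (F D y).
    move=> Dd; rewrite -Mk //; have Hd := R_bound (D_lt Dd).
    move: (Mk d Dd) I I'; rewrite /inn /ini -/r.
    have := R_laminar (D_lt Dd) (y := x); have := R_laminar x_lt (y := d); rewrite -/r => L1 L2.
    have := base_le (F D y %/ 2); have := F_le D y; case: (odd (F D y)); lia.
  case: (base y =P base x) => [byx|byx].
    have : k0 = F D y by apply: F_char => //; [lia | rewrite bk].
    by move=> E; rewrite -E eqxx I in C1.
  have lb : base x < base y by have := @base_mono x y; move: I; rewrite X; lia.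
  have := base_lt lb => xy; have := base_le x => bx.
  have := base_le (F D y %/ 2); rewrite bk => bF.
  case: (F_cases D y) => -[g [E bg Dg Ig _]].
    have := MX g Dg; rewrite /inn /ini E !nodeE; have := R_bound (D_lt Dg); have := base_le g; lia.
  by move: I'; rewrite /inn E !nodeE bg; move: I; rewrite X -/r; lia.
(* Here the node is in the new interval and [y] is not. Laminarity excludes an odd node; an even one
   starts before [r] with [y] behind [r] and no recorded end between, so it is [pre2]. *)
- case: (F_cases D y) => -[g [E bg Dg Ig H]]; move: I; rewrite /inn E !nodeE -/r => I.
    have := R_laminar x_lt (y := g); rewrite -/r; move: Ig I'; rewrite X /ini; lia.
  have bgg := base_le g; have bgy := base_gt y; have bx := base_le x.
  have ry : r <= y by move: I'; rewrite X; lia.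
  case: H => _ H.
  have br : base r = base y by apply: base_eq; lia.
  have s2 : split2 by rewrite /split2 -/r H ?andbT; [apply/eqP; lia | lia].
  have [g' [jg bg' Eg' lg' H']] := pre2P s2.
  move: C2; rewrite s2 ry andbT E jg => /eqP; apply; congr (2 * _).
  case: (ltngtP g g') => // lg.
    by have := H g'; rewrite Eg'; lia.
  by have := H' g; rewrite Dg; lia.
Qed.

(** This makes the new tree a contiguous segment of the sorted list of the old one, and reduces the
    test for the side of a piece to two comparisons. *)
Lemma cut_range k : live mark k -> ns D k k1 -> inn x k = (k1 <= k < hi).
Proof.
move=> L S; have bx := base_le x; have := node_split k; have := base_le (k %/ 2).
move: L S; rewrite /live /ns; case O: (odd k) => /andP[_ L] S bk Ek.
  rewrite /inn O -/r; case/orP: L => [L|/eqP L]; last by apply/idP/idP; lia.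
  have := S _ L; rewrite inn_k1 /inn O /ini; have := R_bound (D_lt L).
  have : k %/ 2 != x by apply/eqP => e; rewrite e x_new in L.
  lia.
rewrite /inn O -/r.
suff H : x < k %/ 2 -> x < base (k %/ 2) by apply/idP/idP; lia.
(* An even node behind [x] in the block of [x] would sit at the end of an old interval that contains
   [x] but not the node, against [S]. *)
move=> lk; rewrite ltnNge; apply/negP => lb.
have bb : base x = base (k %/ 2) by apply: base_eq; have := base_gt (k %/ 2); lia.
case/EmP: L => [/modB_eq0|[d ld [/orP[Dd|/eqP dx] Rd]]]; [lia| |lia].
by have := S _ Dd; rewrite inn_k1 /inn O /ini Rd; lia.
Qed.

Lemma k0_lt : k0 < k1.
Proof.
rewrite /k0; case: (F_cases D x) => -[g [-> bg Dg Ig _]]; rewrite /k1; last lia.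
have : g != x by apply/eqP => e; rewrite e x_new in Dg.
by move: Ig; rewrite /ini; lia.
Qed.

(** Hence inserting [k1] directly behind [k0] keeps the list of the class sorted. A node between
    them would lie in the block of [x] and coincide with [k0] by [node_uniq]. *)
Lemma k0_adjacent k : live D k -> ns D k k1 -> k0 < k < k1 -> False.
Proof.
move=> L S lk; have Lk := F_live D (ltnW x_lt).
have bk : base (k %/ 2) = base x.
  have := F_base D x => b0; apply: base_eq; have := base_le (k0 %/ 2); rewrite b0.
  by have := base_gt x; move: lk; rewrite /k1; lia.
suff : k = k0 by lia.
apply: (node_uniq D_lt) => //; first by rewrite bk F_base.
by move=> d Dd; rewrite S // inn_k1 inn_k0.
Qed.

(** The counterpart of [k0_adjacent] for inserting [hi] directly behind [pre2]. *)
Lemma pre2_adjacent k : split2 -> live D k -> ns D k k1 -> j < k < hi -> False.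
Proof.
move=> s2 L S lk; have Lj := pre2_live s2.
have [g [Ej bg _ lg _]] := pre2P s2.
have bk : base (k %/ 2) = base r.
  by apply: base_eq; have := base_le g; have := base_gt r; move: lk; rewrite Ej /hi; lia.
suff : k = j by lia.
apply: (node_uniq D_lt) => //; first by rewrite bk Ej nodeE.
by move=> d Dd; rewrite S // inn_k1 inn_pre2.
Qed.

End Cut.
End Geometry.

Lemma split2E B R D x : split2 B R D x = (base B x != base B (R x)) && ~~ Em B R D (R x).
Proof. by []. Qed.

(** * Circular lists and the potential *)

Section Rings.

Definition lnk (nx pv : nat -> nat) (a b : nat) : bool := (nx a == b) && (pv b == a).

Definition ring (nx pv : nat -> nat) (s : seq nat) : bool := cycle (lnk nx pv) s.

Lemma eq_path_lnk nx pv nx' pv' a s :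
  (forall c, c \in belast a s -> nx' c = nx c) -> (forall c, c \in s -> pv' c = pv c) ->
  path (lnk nx' pv') a s = path (lnk nx pv) a s.
Proof.
elim: s a => //= b s IH a H1 H2.
rewrite /lnk H1 ?mem_head // H2 ?mem_head // -/(lnk _ _ _ _); congr (_ && _).
by apply: IH => c Hc; [apply: H1 | apply: H2]; rewrite inE Hc orbT.
Qed.

Lemma eq_ring nx pv nx' pv' s :
  (forall c, c \in s -> nx' c = nx c) -> (forall c, c \in s -> pv' c = pv c) ->
  ring nx' pv' s = ring nx pv s.
Proof.
case: s => // a s H1 H2; rewrite /ring /=; apply: eq_path_lnk => c.
  by rewrite belast_rcons; apply: H1.
by rewrite mem_rcons; apply: H2.
Qed.

Lemma ring_catC nx pv s1 s2 : ring nx pv (s1 ++ s2) = ring nx pv (s2 ++ s1).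
Proof. by rewrite /ring -(rot_cycle (size s1)) rot_size_cat. Qed.

Definition ins_nx (nx : nat -> nat) (a b : nat) := upd (upd nx a b) b (nx a).
Definition ins_pv (nx pv : nat -> nat) (a b : nat) := upd (upd pv b a) (nx a) b.

Lemma ring_insert nx pv s1 s2 a b : ring nx pv (s1 ++ a :: s2) ->
  uniq (s1 ++ a :: s2) -> b \notin s1 ++ a :: s2 ->
  ring (ins_nx nx a b) (ins_pv nx pv a b) (s1 ++ a :: b :: s2).
Proof.
(* The ring is rotated to start at [a], so that the insertion happens at the front. *)
rewrite [ring nx pv _]ring_catC [ring (ins_nx _ _ _) _ _]ring_catC uniq_catC mem_cat orbC -mem_cat /ring /=.
move: (s2 ++ s1) => s; rewrite inE negb_or => C /andP[a_s us] /andP[ba b_s].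
have ins_a : ins_nx nx a b a = b.
  by rewrite /ins_nx /upd eq_sym (negbTE ba) eqxx.
have ins_b : ins_nx nx a b b = nx a by rewrite /ins_nx /upd eqxx.
have pv_b : nx a != b -> ins_pv nx pv a b b = a.
  by rewrite /ins_pv /upd eqxx eq_sym => /negbTE->.
have pv_o : ins_pv nx pv a b (nx a) = b by rewrite /ins_pv /upd eqxx.
case: s C a_s us b_s => [|o s] /=.
  (* In a ring of one element [nx a] is [a] itself, so two of the assignments concern the same cell
     as [a]. *)
  rewrite /lnk andbT => /andP[/eqP na _] _ _ _.
  rewrite na in pv_o pv_b ins_b.
  by rewrite ins_a ins_b pv_o pv_b ?eqxx // eq_sym.
rewrite !inE !negb_or => /andP[/andP[/eqP na pa] C] /andP[ao a_s] /andP[o_s us] /andP[bo b_s].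
rewrite na in pv_o pv_b ins_b.
rewrite {1 2}/lnk ins_a ins_b pv_o pv_b ?eqxx /=; last by rewrite eq_sym.
apply: etrans C; apply: eq_path_lnk => c.
  rewrite belast_rcons inE => Hc; rewrite /ins_nx /upd.
  case: eqP => [cb|_]; first by move: Hc; rewrite cb (negbTE bo) (negbTE b_s).
  case: eqP => [ca|_] //; by move: Hc; rewrite ca (negbTE ao) (negbTE a_s).
rewrite mem_rcons inE => Hc; rewrite /ins_pv /upd na.
case: eqP => [co|_]; first by move: Hc; rewrite co eq_sym (negbTE ao) (negbTE o_s).
by case: eqP => [cb|_] //; move: Hc; rewrite cb (negbTE ba) (negbTE b_s).
Qed.

(** The four assignments close the arc from [xs] to [ys] and its complement alike, so either side
    may be passed as the arc. *)
Definition cut_nx (nx pv : nat -> nat) (xs ys : nat) := upd (upd nx (pv xs) (nx ys)) ys xs.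
Definition cut_pv (nx pv : nat -> nat) (xs ys : nat) := upd (upd pv (nx ys) (pv xs)) xs ys.

Lemma ring_cut nx pv x1 a x2 b : ring nx pv ((x1 :: a) ++ x2 :: b) ->
  uniq ((x1 :: a) ++ x2 :: b) ->
  [/\ pv x1 = last x2 b, nx (last x1 a) = x2,
      ring (cut_nx nx pv x1 (last x1 a)) (cut_pv nx pv x1 (last x1 a)) (x1 :: a) &
      ring (cut_nx nx pv x1 (last x1 a)) (cut_pv nx pv x1 (last x1 a)) (x2 :: b)].
Proof.
rewrite /ring /= rcons_cat cat_path /= rcons_path.
move=> /and4P[Pa /andP[/eqP n1 /eqP p2] Pb /andP[/eqP n2 /eqP p1]].
rewrite cat_uniq /= mem_cat negb_or inE negb_or.
move=> /and4P[/and3P[x1a x12 x1b] ua /norP[x2a dab] /andP[x2b ub]].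
set y1 := last x1 a in n1 p2 *; set y2 := last x2 b in n2 p1 *.
have y1a : y1 \in x1 :: a by apply: mem_last.
have y2b : y2 \in x2 :: b by apply: mem_last.
have y12 : y2 != y1.
  apply/eqP => e; move: y1a y2b; rewrite -e !inE => /orP[/eqP->|y2a].
    by rewrite (negbTE x12) (negbTE x1b).
  case/orP => [/eqP e'|H]; first by rewrite -e' y2a in x2a.
  by move/hasPn: dab => /(_ _ H); rewrite y2a.
split=> //; rewrite rcons_path.
  apply/andP; split; last first.
    by rewrite /lnk /cut_nx /cut_pv /upd -/y1 !eqxx.
  apply: etrans Pa; apply: eq_path_lnk => c Hc; rewrite /cut_nx /cut_pv /upd n1 p1.
    have cy1 : c != y1.
      move: ua x1a Hc; rewrite /y1; case/lastP: (a) => [//|a' z].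
      rewrite last_rcons belast_rcons rcons_uniq mem_rcons !inE !negb_or => /andP[za _] /andP[xz xa].
      by case/orP => [/eqP->|H]; [rewrite eq_sym // 1?eq_sym | apply: contraNneq za => <-].
    rewrite (negbTE cy1); case: eqP => // e; move: (mem_belast Hc); rewrite e => y2a.
    move: y2a y2b; rewrite !inE => /orP[/eqP->|y2a]; first by rewrite (negbTE x12) (negbTE x1b).
    case/orP => [/eqP e'|H]; first by rewrite -e' y2a in x2a.
    by move/hasPn: dab => /(_ _ H); rewrite y2a.
  case: eqP => [e|_]; first by rewrite e (negbTE x1a) in Hc.
  by case: eqP => [e|_] //; rewrite e (negbTE x2a) in Hc.
apply/andP; split; last first.
  by rewrite /lnk /cut_nx /cut_pv /upd -/y2 n1 p1 (negbTE y12) (eq_sym x2 x1) (negbTE x12) !eqxx.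
apply: etrans Pb; apply: eq_path_lnk => c Hc; rewrite /cut_nx /cut_pv /upd n1 p1.
  have cy2 : c != y2.
    move: ub x2b Hc; rewrite /y2; case/lastP: (b) => [//|b' z].
    rewrite last_rcons belast_rcons rcons_uniq mem_rcons !inE !negb_or => /andP[za _] /andP[xz xa].
    by case/orP => [/eqP->|H]; [rewrite eq_sym // 1?eq_sym | apply: contraNneq za => <-].
  rewrite (negbTE cy2); case: eqP => // e; move: (mem_belast Hc); rewrite e => y1b.
  move: y1b y1a; rewrite !inE => /orP[/eqP->|y1b].
    by rewrite eq_sym (negbTE x12) (negbTE x2a).
  case/orP => [/eqP e'|H]; first by rewrite -e' y1b in x1b.
  by move/hasPn: dab => /(_ _ y1b); rewrite H.
case: eqP => [e|_]; first by rewrite e (negbTE x1b) in Hc.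
by case: eqP => [e|_] //; rewrite e (negbTE x2b) in Hc.
Qed.

Lemma ring_mem nx pv s a : ring nx pv s -> a \in s -> nx a \in s /\ pv a \in s.
Proof.
move=> C H; have /andP[/eqP-> _] := next_cycle C H; have /andP[_ /eqP->] := prev_cycle C H.
by rewrite mem_next mem_prev.
Qed.

Lemma ring_nth nx pv s i : ring nx pv s -> i.+1 < size s ->
  nx (nth 0 s i) = nth 0 s i.+1 /\ pv (nth 0 s i.+1) = nth 0 s i.
Proof.
case: s => // a s; rewrite /ring /= rcons_path => /andP[/(pathP 0) P _] lt.
by have /andP[/eqP-> /eqP->] := P i lt.
Qed.

End Rings.

Lemma sorted_insert s1 a b s2 : sorted ltn (s1 ++ a :: s2) -> a < b -> all (ltn b) s2 ->
  sorted ltn (s1 ++ a :: b :: s2).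
Proof.
rewrite !(sorted_pairwise ltn_trans) !pairwise_cat /= => /and3P[H1 H2 /andP[H3 H4]] ab H5.
rewrite H2 H4 H5 ab H3 /= !andbT.
apply/allrelP => y z ys; rewrite !inE => /orP[/eqP->|/orP[/eqP->|zs]].
- by move/allrelP: H1; apply; rewrite ?mem_head.
- by apply: ltn_trans ab; move/allrelP: H1; apply; rewrite ?mem_head.
- by move/allrelP: H1; apply; rewrite // inE zs orbT.
Qed.

Lemma sorted_split s a : sorted ltn s ->
  s = [seq y <- s | y < a] ++ [seq y <- s | a <= y].
Proof.
elim: s => //= b s IH P; have := IH (path_sorted P).
case: (ltnP b a) => ba /= E; first by congr (_ :: _).
have H : all (leq a) s.
  have := order_path_min ltn_trans P => /allP H; apply/allP => y /H /=; lia.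
rewrite (eq_in_filter (a2 := pred0)) ?filter_pred0 /=; last first.
  by move=> y /(allP H) /=; lia.
by congr (_ :: _); rewrite (eq_in_filter (a2 := predT)) ?filter_predT // => y /(allP H).
Qed.

(* A cut turns a class of p pieces into classes of p1 and p2 pieces with
   p1 + p2 <= p + 2, so p - 2 is superadditive and relabelling the smaller side
   costs O(log p) per unit of p - 2. *)
Definition phi (p : nat) : nat := (p - 2) * trunc_log 2 (p - 2).

(** The smaller part is at most half of the sum, so each of its elements gains at least 1 in the
    logarithm. *)
Lemma phi0_split a b : minn a b + (a * trunc_log 2 a + b * trunc_log 2 b) <=
  (a + b) * trunc_log 2 (a + b).
Proof.
wlog le : a b / a <= b => [H|].
  case/orP: (leq_total a b) => le; first exact: H.
  by rewrite minnC [a + b]addnC [X in _ + X]addnC; apply: H.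
rewrite (minn_idPl le); case: (posnP a) => [->|a0]; first by rewrite !(add0n, mul0n).
have H1 : (trunc_log 2 a).+1 <= trunc_log 2 (a + b).
  rewrite -trunc_log2_double //; apply: leq_trunc_log; lia.
have H2 : trunc_log 2 b <= trunc_log 2 (a + b) by apply: leq_trunc_log; lia.
nia.
Qed.

Lemma phi_split p p1 p2 : 0 < p1 -> 0 < p2 ->
  (p1 + p2 <= p + 1) || [&& 1 < p1, 1 < p2 & p1 + p2 <= p + 2] ->
  minn p1 p2 + (phi p1 + phi p2) <= phi p + 2.
Proof.
move=> h1 h2 H; have := phi0_split (p1 - 2) (p2 - 2); rewrite -/(phi p1) -/(phi p2) => H'.
have le : (p1 - 2) + (p2 - 2) <= p - 2 by lia.
have : (p1 - 2 + (p2 - 2)) * trunc_log 2 (p1 - 2 + (p2 - 2)) <= phi p.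
  by rewrite /phi; apply: leq_mul => //; apply: leq_trunc_log.
lia.
Qed.

Lemma sum_block (g : nat -> nat) b m M : (forall y, y < M -> g y != 0 -> b <= y < b + m) ->
  (forall y, M <= y -> g y = 0) ->
  \sum_(o < m) g (b + o) = \sum_(0 <= y < M) g y.
Proof.
move=> H1 H2; rewrite -(big_mkord xpredT (fun o => g (b + o))).
have -> : \sum_(0 <= o < m) g (b + o) = \sum_(b <= y < b + m) g y.
  rewrite (_ : \sum_(b <= y < b + m) g y = \sum_(0 + b <= y < b + m) g y) // big_addn addKn.
  by apply: eq_bigr => i _; rewrite addnC.
have Z u v : v <= b \/ b + m <= u \/ M <= u -> \sum_(u <= y < v) g y = 0.
  move=> H; rewrite big_nat; apply: big1 => y Hy; case: (leqP M y) => My; first exact: H2.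
  by apply/eqP/negPn/negP => /(H1 _ My); lia.
transitivity (\sum_(0 <= y < b + m + M) g y).
  rewrite (big_cat_nat (m := 0) (n := b + m) (p := b + m + M)) /=; [|lia..].
  rewrite (big_cat_nat (m := 0) (n := b) (p := b + m)) /=; [|lia..].
  by rewrite (Z 0 b) ?(Z (b + m)) ?addn0 //; [right; left | left].
rewrite (big_cat_nat (n := M) (p := b + m + M)) /=; [|lia..].
by rewrite (Z M) ?addn0 //; right; right.
Qed.

(** * The program *)

Declare Scope ex_scope.
Delimit Scope ex_scope with X.
Notation "$ x" := (EV x) (at level 1, x at level 0, format "$ x") : ex_scope.
Notation "# k" := (EC k) (at level 1, k at level 0, format "# k") : ex_scope.
Notation "a + b" := (EB Add a b) : ex_scope.
Notation "a - b" := (EB Sub a b) : ex_scope.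
Notation "a * b" := (EB Mul a b) : ex_scope.
Notation "a %/ b" := (EB Div a b) : ex_scope.
Notation "a %% b" := (EB Mod a b) : ex_scope.
Notation "a < b" := (EB Lt a b) : ex_scope.
Notation "a == b" := (EB Eq a b) : ex_scope.
Notation "a && b" := (EB And a b) : ex_scope.
Notation "a <<< b" := (EB Shl a b) (at level 47) : ex_scope.
Notation "i '.[|' e ']'" := (EA i e) (at level 2, format "i .[| e ]") : ex_scope.
Notation "x <-- e" := (Asg x e%X) (at level 55).
Notation "i '.[=' e1 ']' '<--' e2" := (Sto i e1%X e2%X) (at level 55, e1 at level 50).
Notation "c1 ;; c2" := (Seq c1 c2) (at level 60, right associativity).

(* Indexed by vertices: parent, first child and next sibling (both shifted by one,
   0 is nil), position, initial weight.  By positions: parent, interval end, mask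
   of the ancestors in the same block, and (at starts of blocks) masks of marks,
   of interval ends and of weights.  By nodes: mask of positions, successor and
   predecessor in the class, class label.  By labels: sum of weights.  By masks:
   one plus the most significant bit, population count. *)
Notation aPar := 0 (only parsing).
Notation aFst := 1 (only parsing).
Notation aSib := 2 (only parsing).
Notation aIn := 3 (only parsing).
Notation aPp := 4 (only parsing).
Notation aR := 5 (only parsing).
Notation aW := 6 (only parsing).
Notation aAM := 7 (only parsing).
Notation aMM := 8 (only parsing).
Notation aEM := 9 (only parsing).
Notation aWm := 10 (only parsing).
Notation aPm := 11 (only parsing).
Notation aNx := 12 (only parsing).
Notation aPv := 13 (only parsing).
Notation aLab := 14 (only parsing).
Notation aCs := 15 (only parsing).
Notation aTm := 16 (only parsing).
Notation aTp := 17 (only parsing).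

Notation vn := 0 (only parsing).
Notation vN := 1 (only parsing).
Notation vB := 2 (only parsing).
Notation vq := 3 (only parsing).
Notation vi := 4 (only parsing).
Notation vr0 := 5 (only parsing).
Notation vr1 := 6 (only parsing).
Notation vr2 := 7 (only parsing).
Notation vx := 8 (only parsing).
Notation vb := 9 (only parsing).
Notation vo := 10 (only parsing).
Notation vm := 11 (only parsing).
Notation vk := 12 (only parsing).
Notation vc := 13 (only parsing).
Notation ve := 14 (only parsing).
Notation vb2 := 15 (only parsing).
Notation vo2 := 16 (only parsing).
Notation vk1 := 17 (only parsing).
Notation vhi := 18 (only parsing).
Notation vt := 19 (only parsing).
Notation vu := 20 (only parsing).
Notation va := 21 (only parsing).
Notation vz := 22 (only parsing).
Notation vxs := 23 (only parsing).
Notation vys := 24 (only parsing).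
Notation vS := 25 (only parsing).
Notation vy := 26 (only parsing).
Notation vf := 27 (only parsing).

(** The mask of ancestors meets the mask of marks in the marked intervals that start in the block
    and contain the position; the most significant bit is the innermost. The residue modulo
    [2 ^ (o + 1)] keeps the recorded ends up to the position. *)
Definition find_cmd : cmd :=
  vo <-- ($vx %% $vB);;
  vb <-- ($vx - $vo);;
  vm <-- (aAM.[|$vx] && aMM.[|$vb]);;
  If ($vm)%X (vk <-- (#2 * ($vb + (aTm.[|$vm] - #1)) + #1))
           (vk <-- (#2 * ($vb + (aTm.[|aEM.[|$vb] %% (#1 <<< ($vo + #1))] - #1)))).

Definition query_cmd : cmd := find_cmd;; Wr (aCs.[|aLab.[|$vk]])%X.

(** The old weight is recovered from the mask. Adding the new weight before subtracting the old one
    avoids an underflow. *)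
Definition update_cmd : cmd :=
  find_cmd;;
  vc <-- aLab.[|$vk];;
  vt <-- ((aWm.[|$vb] %/ (#1 <<< $vo)) %% #2);;
  aCs.[=$vc] <-- (aCs.[|$vc] + $vr2 - $vt);;
  aWm.[=$vb] <-- (aWm.[|$vb] + ($vr2 <<< $vo) - ($vt <<< $vo)).

(** The positions handed to the new piece have offsets from that of [x] up to the end of the
    interval or of the block, whichever comes first; the difference of two residues of the piece
    mask selects them. *)
Definition split1_cmd : cmd :=
  ve <-- aR.[|$vx];;
  vo2 <-- ($ve %% $vB);;
  vb2 <-- ($ve - $vo2);;
  vk1 <-- (#2 * $vx + #1);;
  vhi <-- (#2 * $ve);;
  vc <-- aLab.[|$vk];;
  If ($vb == $vb2)%X (vt <-- $vo2) (vt <-- $vB);;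
  vu <-- aPm.[|$vk];;
  vt <-- ($vu %% (#1 <<< $vt) - $vu %% (#1 <<< $vo));;
  aPm.[=$vk1] <-- $vt;;
  aPm.[=$vk] <-- ($vu - $vt);;
  aMM.[=$vb] <-- (aMM.[|$vb] + (#1 <<< $vo)).

Definition insert_cmd (p y : nat) : cmd :=
  vt <-- aNx.[|$p];;
  aNx.[=$p] <-- $y;;
  aNx.[=$y] <-- $vt;;
  aPv.[=$y] <-- $p;;
  aPv.[=$vt] <-- $y;;
  aLab.[=$y] <-- $vc.

Definition split2_cmd : cmd :=
  If ($vb == $vb2)%X Skip
    (If ((aEM.[|$vb2] %/ (#1 <<< $vo2)) %% #2)%X Skip
      (va <-- (#2 * ($vb2 + (aTm.[|aEM.[|$vb2] %% (#1 <<< $vo2)] - #1)));;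
       vu <-- aPm.[|$va];;
       vt <-- ($vu %% (#1 <<< $vo2));;
       aPm.[=$va] <-- $vt;;
       aPm.[=$vhi] <-- ($vu - $vt);;
       aEM.[=$vb2] <-- (aEM.[|$vb2] + (#1 <<< $vo2));;
       insert_cmd va vhi)).

(** The comparison of [cut_range], with a product as conjunction and a difference from 1 as
    negation. *)
Definition inside (e : expr) : expr := ((#1 - (e < $vk1)) * (e < $vhi))%X.

(* Walks from both ends of the cut at once, so that the smaller side is found in
   time proportional to its size. *)
Definition walk_cmd : cmd :=
  va <-- $vk1;;
  vz <-- $vk;;
  While (inside (aNx.[|$va]) * (#1 - inside (aPv.[|$vz])))%X
    (va <-- aNx.[|$va];; vz <-- aPv.[|$vz]);;
  If (inside (aNx.[|$va]))%X (vxs <-- $vz;; vys <-- $vk) (vxs <-- $vk1;; vys <-- $va).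

Definition relink_cmd : cmd :=
  vt <-- aPv.[|$vxs];;
  vu <-- aNx.[|$vys];;
  aNx.[=$vt] <-- $vu;;
  aNx.[=$vys] <-- $vxs;;
  aPv.[=$vu] <-- $vt;;
  aPv.[=$vxs] <-- $vys.

(** The position [x] is a fresh label, since labels in use are 0 or earlier marks. It goes to the
    smaller side, which need not contain [x]: a label only names a class. The flag makes the loop
    visit the last node before it stops, even if that is also the first. *)
Definition relabel_cmd : cmd :=
  vS <-- #0;;
  vy <-- $vxs;;
  vf <-- #1;;
  While ($vf)%X
    (aLab.[=$vy] <-- $vx;;
     vt <-- ($vy %/ #2);;
     vt <-- ($vt - $vt %% $vB);;
     vS <-- ($vS + aTp.[|aWm.[|$vt] && aPm.[|$vy]]);;
     vf <-- (#1 - ($vy == $vys));;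
     vy <-- aNx.[|$vy]);;
  aCs.[=$vx] <-- $vS;;
  aCs.[=$vc] <-- (aCs.[|$vc] - $vS).

Definition prep_cmd : cmd := find_cmd;; split1_cmd;; insert_cmd vk vk1;; split2_cmd.

Definition cut_cmd : cmd := prep_cmd;; walk_cmd;; relink_cmd;; relabel_cmd.

Lemma asgS w q s x e v c T Q : safe w e s -> ev e s = v ->
  wp w q c (setv s x v) T Q -> wp w q (x <-- e;; c) s T Q.
Proof. by move=> sf <- H; apply: wp_seq0; apply: wp_asg. Qed.

Lemma asg1 w q s x e v T (Q : st -> Prop) : safe w e s -> ev e s = v ->
  Q (setv s x v) -> wp w q (x <-- e) s T Q.
Proof. by move=> sf <- H; apply: wp_asg. Qed.

Lemma stoS w q s i e1 e2 a v c T Q : safe w e1 s -> safe w e2 s -> ev e1 s = a -> ev e2 s = v ->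
  32 * a + 96 <= 2 ^ w -> wp w q c (seta s i a v) T Q -> wp w q (i.[=e1] <-- e2;; c) s T Q.
Proof. by move=> sf1 sf2 <- <- l H; apply: wp_seq0; apply: wp_sto. Qed.

Lemma sto1 w q s i e1 e2 a v T (Q : st -> Prop) : safe w e1 s -> safe w e2 s -> ev e1 s = a ->
  ev e2 s = v -> 32 * a + 96 <= 2 ^ w -> Q (seta s i a v) -> wp w q (i.[=e1] <-- e2) s T Q.
Proof. by move=> sf1 sf2 <- <- l H; apply: wp_sto. Qed.

Arguments asgS {w q s x e v c T Q}.
Arguments asg1 {w q s x e v T Q}.
Arguments stoS {w q s i e1 e2 a v c T Q}.
Arguments sto1 {w q s i e1 e2 a v T Q}.

Definition frame (xs : seq nat) (s s' : st) : Prop :=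
  forall y, y \notin xs -> vr s' y = vr s y.
Definition sameio (s s' : st) : Prop := [/\ si s' = si s, sc s' = sc s & so s' = so s].

(** * Correctness of the operations *)

Ltac sx := rewrite /= /upd2 /upd /=.

Ltac frame_tac := by move=> ?; rewrite !inE /=; sx; do !case: eqP.

Section Structure.

Variables (w : nat) (q : nat -> nat) (N B : nat) (R : nat -> nat).
Hypothesis W_ge : 1024 * (N + 2) <= 2 ^ w.
Hypothesis B_gt0 : 0 < B.
Hypothesis B_le : 2 ^ B <= N + 1.
Hypothesis R_bound : forall x, x < N -> x < R x <= N.
Hypothesis R_laminar : forall x y, x < N -> x <= y < R x -> R y <= R x.

Local Notation base := (base B).
Local Notation off := (off B).
Local Notation wp := (wp w q).
Local Notation F := (F B R).
Local Notation live := (live N B R).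
Local Notation Em := (Em B R).
Local Notation inn := (inn B R).
Local Notation ns := (ns B R).

Definition statics (s : st) : Prop :=
  [/\ vr s vB = B,
      forall x, x < N -> ar s aR x = R x,
      forall x, x < N -> ar s aAM x = bits B (fun o => ini R (base x + o) x),
      ar s aTm 0 = 0 /\ (forall i, 0 < i < 2 ^ B -> ar s aTm i = (ar s aTm (i %/ 2)).+1) &
      ar s aTp 0 = 0 /\ (forall i, 0 < i < 2 ^ B -> ar s aTp i = ar s aTp (i %/ 2) + i %% 2)].

(** Piece masks are prescribed only on positions below [N]: the last block may reach further, and
    its initial mask consists of ones throughout. *)
Definition masks (D wt : nat -> bool) (s : st) : Prop :=
  [/\ forall b, b <= N -> base b = b -> ar s aMM b = bits B (fun o => D (b + o)),
      forall b, b <= N -> base b = b -> ar s aEM b = bits B (fun o => Em D (b + o)),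
      forall b, b <= N -> base b = b -> ar s aWm b = bits B (fun o => wt (b + o)) &
      forall k, live D k -> exists f, ar s aPm k = bits B f /\
        forall o, o < B -> base (k %/ 2) + o < N -> f o = (F D (base (k %/ 2) + o) == k)].

Lemma expB i : i <= B -> 0 < 2 ^ i <= N + 1.
Proof. by move=> li; rewrite expn_gt0 /=; apply: leq_trans B_le; rewrite leq_exp2l. Qed.

Lemma bitsB f : bits B f <= N.
Proof. by have := bits_lt B f; lia. Qed.

Lemma addr_ok a : a <= 2 * N + 1 -> 32 * a + 96 <= 2 ^ w.
Proof. lia. Qed.

Lemma find_spec D wt s x T : statics s -> masks D wt s -> vr s vx = x -> x < N ->
  wp find_cmd s T (fun s' =>
    [/\ frame [:: vb; vo; vm; vk] s s', ar s' = ar s, sameio s s' &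
        [/\ vr s' vb = base x, vr s' vo = off x & vr s' vk = F D x]]).
Proof.
move=> [sB sR sA [sm0 smS] _] [mM mE _ _] Hx lx.
have xB := base_mod B x; have lB : off x < B by apply: off_lt.
have bx := base_le B x.
have bN : base x <= N by lia.
have bb := base_id B_gt0 x.
apply: (asgS (v := off x)); [by sx | by sx; rewrite sB Hx |].
apply: (asgS (v := base x)); [by sx; split=> //; lia | by sx; lia |].
have HM : ar s aMM (base x) = bits B (fun o => D (base x + o)) by apply: mM.
have HA : ar s aAM x = bits B (fun o => ini R (base x + o) x) by apply: sA.
have HE : ar s aEM (base x) = bits B (fun o => Em D (base x + o)) by apply: mE.
have ep := @expB (off x).+1 lB.
set m := bits B (fun o => D (base x + o) && ini R (base x + o) x).
have HAM : Nat.land (ar s aAM x) (ar s aMM (base x)) = m.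
  by rewrite HA HM bits_land; apply: eq_bits => i _; rewrite andbC.
apply: (asgS (v := m)); [by sx; rewrite Hx; do !split=> //; lia | by sx; rewrite Hx |].
have Tm f j : j <= B -> ar s aTm (bits j f) = mx f j.
  by move=> lj; apply: (tm_bits (K := B)).
have Lm f j : j <= B -> mx f j <= j.
  by move=> lj; elim: j {lj} => //= j IH; case: (f j) => //; apply: leq_trans IH _.
have lN : B <= N + 1 by apply: leq_trans B_le; apply: ltnW; apply: ltn_expl.
have FE : F D x = if mx (fun i => D (base x + i) && ini R (base x + i) x) B is i.+1
     then 2 * (base x + i) + 1
     else 2 * (base x + (mx (fun e => Em D (base x + e)) (off x).+1).-1) by [].
have := Tm (fun i => D (base x + i) && ini R (base x + i) x) B (leqnn _); rewrite -/m => Em'.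
have Lm' := Lm (fun i => D (base x + i) && ini R (base x + i) x) B (leqnn _).
apply: wp_if; sx=> //.
  move=> nz; have gt0 : 0 < ar s aTm m by rewrite smS //;
    have := bits_lt B (fun i => D (base x + i) && ini R (base x + i) x); rewrite -/m; lia.
  have lm : m <= N by apply: bitsB.
  apply: (asg1 (v := F D x)).
  - by sx; do !split=> //; lia.
  - sx; rewrite FE -Em'; case: (ar s 16 m) gt0 => //; lia.
  - by split=> // y; rewrite !inE /=; sx; do !case: eqP.
move=> z; rewrite z sm0 in Em'; rewrite -Em' in FE.
have Em0 : bits B (fun o => Em D (base x + o)) %% 2 ^ (off x + 1) =
    bits (off x).+1 (fun o => Em D (base x + o)).
  by rewrite addn1 bits_mod // bits_lo.
have TE := Tm (fun o => Em D (base x + o)) (off x).+1 lB.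
have LE := Lm (fun o => Em D (base x + o)) (off x).+1 lB.
have gE : 0 < mx (fun o => Em D (base x + o)) (off x).+1.
  by apply: (@mx_gt0 _ _ 0) => //; rewrite addn0 Em_base.
have lE : bits (off x).+1 (fun o => Em D (base x + o)) <= N.
  by have := bits_lt (off x).+1 (fun o => Em D (base x + o)); lia.
apply: (asg1 (v := F D x)).
- by sx; rewrite HE mul1n Em0 TE addn1; do !split=> //; lia.
- by sx; rewrite HE mul1n Em0 TE FE; lia.
- by split=> // y; rewrite !inE /=; sx; do !case: eqP.
Qed.

Definition aframe (xs : seq nat) (s s' : st) : Prop :=
  forall i, i \notin xs -> ar s' i = ar s i.

Lemma split1_spec D wt s x T : statics s -> masks D wt s -> (forall d, D d -> d < N) ->
  x < N -> D x = false ->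
  vr s vx = x -> vr s vb = base x -> vr s vo = off x -> vr s vk = F D x ->
  wp split1_cmd s T (fun s' =>
    [/\ frame [:: ve; vo2; vb2; vk1; vhi; vc; vt; vu] s s', aframe [:: aPm; aMM] s s', sameio s s',
        [/\ vr s' vb2 = base (R x), vr s' vo2 = off (R x), vr s' vk1 = 2 * x + 1,
            vr s' vhi = 2 * R x & vr s' vc = ar s aLab (F D x)] &
        [/\ forall b, b <= N -> base b = b -> ar s' aMM b = bits B (fun o => mark D x (b + o)),
            (forall k, k != F D x -> k != 2 * x + 1 -> ar s' aPm k = ar s aPm k) &
            exists f0 f1, [/\ ar s' aPm (F D x) = bits B f0, ar s' aPm (2 * x + 1) = bits B f1 &
              forall o, o < B -> base x + o < N ->
                f0 o = (F D (base x + o) == F D x) && ~~ ini R x (base x + o) /\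
                f1 o = (F D (base x + o) == F D x) && ini R x (base x + o)]]]).
Proof.
move=> [sB sR _ _ _] [mM mE mW mP] D_lt lx Dx Hx Hb Ho Hk.
have xB := base_mod B x; have lB : off x < B by apply: off_lt.
have rB := base_mod B (R x); have lrB : off (R x) < B by apply: off_lt.
have bx := base_le B x; have br := base_le B (R x); have Hr := R_bound lx.
have := base_mono B (ltnW (proj1 (andP Hr))) => bxr.
have Hb' := base_id B_gt0 x.
have Fle : F D x <= 2 * x + 1 by have := F_le R B_gt0 D x; clear; lia.
have Fb := F_base R B_gt0 D x.
have Lk0 := F_live R B_gt0 D (ltnW lx).
have k0lt := k0_lt B_gt0 R_bound lx Dx.
have [f [Pf Hf]] := mP _ Lk0; rewrite Fb in Hf.
have HM : ar s aMM (base x) = bits B (fun o => D (base x + o)) by apply: mM; lia.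
have ep i : i <= B -> 0 < 2 ^ i <= N + 1 by apply: expB.
have epo := ep _ (ltnW lB); have epB := ep _ (leqnn B); have epo2 := ep _ (ltnW lrB).
apply: (asgS (v := R x)); [by sx; rewrite Hx; split=> //; lia | by sx; rewrite Hx sR |].
apply: (asgS (v := off (R x))); [by sx | by sx; rewrite sB |].
apply: (asgS (v := base (R x))); [by sx; split=> //; lia | by sx; lia |].
apply: (asgS (v := 2 * x + 1)); [by sx; rewrite Hx; do !split=> //; lia | by sx; rewrite Hx |].
apply: (asgS (v := 2 * R x)); [by sx; do !split=> //; lia | by sx |].
apply: (asgS (v := ar s aLab (F D x))); [by sx; rewrite Hk; do !split=> //; lia | by sx;
  rewrite Hk |].
set hO := if base x == base (R x) then off (R x) else B.
have lhO : hO <= B by rewrite /hO; case: ifP => // _; apply: ltnW.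
have ohO : off x < hO by rewrite /hO; case: eqP => // e; lia.
apply: wp_seq0; apply: (wp_mono (T := 0) (Q := fun s' => s' = setv (setv (setv (setv (setv (setv (setv s
   ve (R x)) vo2 (off (R x))) vb2 (base (R x))) vk1 (2 * x + 1)) vhi (2 * R x))
   vc (ar s aLab (F D x))) vt hO)) => //.
  apply: wp_if; sx; rewrite ?Hb //.
  - by move=> e; apply: (asg1 (v := hO)) => //; sx; rewrite /hO; case: (base x == _) e.
  - by move=> e; apply: (asg1 (v := hO)) => //; sx; rewrite /hO sB; case: (base x == _) e.
move=> _ ->.
apply: (asgS (v := bits B f)); [by sx; rewrite Hk; do !split=> //; lia | by sx; rewrite Hk |].
set f1 := fun o => f o && (off x <= o < hO).
set f0 := fun o => f o && ~~ (off x <= o < hO).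
have Ef1 : bits B f %% 2 ^ hO - bits B f %% 2 ^ (off x) = bits B f1.
  rewrite !bits_mod //; last by lia.
  apply: bits_sub => i li; rewrite /f1; case: (f i) => //=; lia.
have Ef0 : bits B f - bits B f1 = bits B f0.
  by apply: bits_sub => i li; rewrite /f1 /f0; case: (f i) => //=; lia.
have ehO := ep _ lhO.
apply: (asgS (v := bits B f1)).
- sx; rewrite Ho !mul1n; do !split=> //; try lia.
  by rewrite !bits_mod //; [| lia]; have := bits_add (m := B) (f := f1)
    (g := fun i => f i && (i < off x)) (h := fun i => f i && (i < hO)); rewrite /f1 => ->;
    [apply: leq_addl | move=> i li; case: (f i) => //=; lia | move=> i li; case: (f i) => //=; lia].
- by sx; rewrite Ho !mul1n.
have l1 : bits B f1 <= bits B f.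
  have -> := @bits_add B f1 f0 f; first by apply: leq_addr.
    by move=> i li; rewrite /f1 /f0; case: (f i) => //=; lia.
  by move=> i li; rewrite /f1 /f0; case: (f i) => //=; lia.
apply: (stoS (a := 2 * x + 1) (v := bits B f1)); [by sx | by sx | by sx | by sx | lia |].
apply: (stoS (a := F D x) (v := bits B f0)); [by sx | by sx; split | by sx;
  rewrite Hk | by sx | lia |].
have bM := @bitsB (fun o => D (base x + o)).
have EM : bits B (fun o => D (base x + o)) + 2 ^ (off x) = bits B (fun o => mark D x (base x + o)).
  apply: bits_set => //; first by rewrite -xB.
  by move=> j lj; rewrite /mark -(eqn_add2l (base x) j) -xB.
apply: (sto1 (a := base x) (v := bits B (fun o => mark D x (base x + o)))).
- by sx.
- by sx; rewrite Ho Hb HM mul1n; do !split=> //; lia.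
- by sx; rewrite Hb.
- by sx; rewrite Ho Hb HM mul1n.
- lia.
have k01 : (2 * x + 1 == F D x) = false by apply/eqP; lia.
split=> //; try frame_tac.
- split=> //.
  + move=> b lb bb; sx; case: eqP => [->//|ne]; rewrite mM //; apply: eq_bits => o lo.
    rewrite /mark (_ : b + o == x = false) ?orbF //; apply/eqP => e.
    by apply: ne; rewrite -e -bb base_add.
  + by move=> k /negbTE h1 /negbTE h2; sx; rewrite h1 h2.
  + exists f0, f1; sx; rewrite eqxx k01 eqxx; split=> // o lo lN.
    rewrite /f0 /f1 Hf //.
    have -> : ini R x (base x + o) = (off x <= o < hO).
      rewrite /ini /hO; case: eqP => [e|ne]; first by apply/idP/idP; lia.
      have : base x < base (R x) by lia.
      move/(base_lt B_gt0) => h; have hg := base_gt B_gt0 x.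
      by have := @base_lt B B_gt0 (base x + o) (R x); rewrite base_add // => h'; apply/idP/idP; lia.
    by [].
Qed.

Lemma insert_spec p y s P Y c T : p != vt -> y != vt -> vr s p = P -> vr s y = Y -> vr s vc = c ->
  P <= 2 * N + 1 -> Y <= 2 * N + 1 -> ar s aNx P <= 2 * N + 1 ->
  wp (insert_cmd p y) s T (fun s' =>
    [/\ frame [:: vt] s s', aframe [:: aNx; aPv; aLab] s s', sameio s s' &
      [/\ ar s' aNx = ins_nx (ar s aNx) P Y, ar s' aPv = ins_pv (ar s aNx) (ar s aPv) P Y &
          ar s' aLab = upd (ar s aLab) Y c]]).
Proof.
move=> /negbTE np /negbTE ny Hp Hy Hc lP lY ln.
apply: (asgS (v := ar s aNx P)); [by sx; rewrite Hp; split=> //; lia | by sx; rewrite Hp |].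
apply: (stoS (a := P) (v := Y)); [by sx | by sx | by sx; rewrite np | by sx; rewrite ny | lia |].
apply: (stoS (a := Y) (v := ar s aNx P)); [by sx | by sx | by sx; rewrite ny | by sx | lia |].
apply: (stoS (a := Y) (v := P)); [by sx | by sx | by sx; rewrite ny | by sx; rewrite np | lia |].
apply: (stoS (a := ar s aNx P) (v := Y)); [by sx | by sx | by sx | by sx; rewrite ny | lia |].
apply: (sto1 (a := Y) (v := c)); [by sx | by sx | by sx; rewrite ny | by sx; rewrite Hc | lia |].
by split=> //; frame_tac.
Qed.

Local Notation split2 := (split2 B R).
Local Notation pre2 := (pre2 B R).

Lemma split2_spec D s x c T : statics s ->
  (forall b, b <= N -> base b = b -> ar s aEM b = bits B (fun o => Em D (b + o))) ->
  (forall d, D d -> d < N) -> x < N -> D x = false ->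
  vr s vb = base x -> vr s vb2 = base (R x) -> vr s vo2 = off (R x) ->
  vr s vhi = 2 * R x -> vr s vc = c ->
  (split2 D x -> ar s aNx (pre2 D x) <= 2 * N + 1 /\ exists f, ar s aPm (pre2 D x) = bits B f) ->
  wp split2_cmd s T (fun s' =>
    [/\ frame [:: va; vu; vt] s s', aframe [:: aPm; aEM; aNx; aPv; aLab] s s', sameio s s',
        (forall b, b <= N -> base b = b ->
           ar s' aEM b = bits B (fun o => Em (mark D x) (b + o))) &
        if split2 D x then
          [/\ (forall k, k != pre2 D x -> k != 2 * R x -> ar s' aPm k = ar s aPm k),
              (forall f, ar s aPm (pre2 D x) = bits B f ->
                 ar s' aPm (pre2 D x) = bits B (fun o => f o && (o < off (R x))) /\
                 ar s' aPm (2 * R x) = bits B (fun o => f o && ~~ (o < off (R x)))),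
              ar s' aNx = ins_nx (ar s aNx) (pre2 D x) (2 * R x),
              ar s' aPv = ins_pv (ar s aNx) (ar s aPv) (pre2 D x) (2 * R x) &
              ar s' aLab = upd (ar s aLab) (2 * R x) c]
        else forall i, i != aEM -> ar s' i = ar s i]).
Proof.
move=> [_ _ _ [sm0 smS] _] mE D_lt lx Dx Hb Hb2 Ho2 Hhi Hc Hs2.
have rB := base_mod B (R x); have lrB : off (R x) < B by apply: off_lt.
have br := base_le B (R x); have Hr := R_bound lx.
have brN : base (R x) <= N by clear -br Hr; lia.
have rN : R x <= N by clear -Hr; lia.
have bb := base_id B_gt0 (R x).
have HE : ar s aEM (base (R x)) = bits B (fun o => Em D (base (R x) + o)) by apply: mE.
have EM0 : split2 D x = false -> forall b, b <= N -> base b = b ->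
    ar s aEM b = bits B (fun o => Em (mark D x) (b + o)).
  move=> s2 b lb bb'; rewrite mE //; apply: eq_bits => o lo.
  by rewrite (Em_mark B_gt0 R_bound lx Dx) s2 orbF.
have epo2 := @expB (off (R x)) (ltnW lrB).
have epW : 2 ^ off (R x) < 2 ^ w by clear -epo2 W_ge; lia.
have oneW : 1 < 2 ^ w by clear -W_ge; lia.
have twoW : 2 < 2 ^ w by clear -W_ge; lia.
have adb : 32 * base (R x) + 96 <= 2 ^ w by clear -brN W_ge; lia.
apply: wp_if; sx; first by [].
  rewrite Hb Hb2 => e; have s2 : split2 D x = false.
    by rewrite split2E; case: (base x == _) e.
  by rewrite s2; apply: wp_skip; split=> //; apply: EM0.
rewrite Hb Hb2 => e.
have ebx : (base x != base (R x)) by case: (base x == _) e.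
apply: wp_if; sx; first by rewrite Ho2 Hb2 mul1n; do !split.
  rewrite Hb2 Ho2 mul1n HE bits_bit // -rB => e'; have s2 : split2 D x = false.
    by rewrite split2E; case: (Em D (R x)) e' => //; rewrite andbF.
  by rewrite s2; apply: wp_skip; split=> //; apply: EM0.
rewrite Hb2 Ho2 mul1n HE bits_bit // -rB => e'.
have s2 : split2 D x by rewrite split2E ebx; case: (Em D (R x)) e'.
rewrite s2; have [ln [f Pf]] := Hs2 s2.
have [g [jg bg Eg lg _]] := pre2P B_gt0 R_bound lx Dx s2.
have jN : pre2 D x <= 2 * N + 1 by rewrite jg; clear -lg rN; lia.
have hN : 2 * R x <= 2 * N + 1 by clear -rN; lia.
have jE : pre2 D x = 2 * (base (R x) + (mx (fun e => Em D (base (R x) + e)) (off (R x))).-1) by [].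
have Em0 : bits B (fun o => Em D (base (R x) + o)) %% 2 ^ off (R x) =
    bits (off (R x)) (fun o => Em D (base (R x) + o)).
  by rewrite bits_mod ?bits_lo // ltnW.
have Tm : ar s aTm (bits (off (R x)) (fun o => Em D (base (R x) + o))) =
    mx (fun e => Em D (base (R x) + e)) (off (R x)).
  by apply: (tm_bits (K := B)) => //; apply: ltnW.
(* The start of the block is always recorded and, when a split happens, lies strictly before [R x];
   so the table entry is positive and subtracting 1 is safe. *)
have gE : 0 < mx (fun o => Em D (base (R x) + o)) (off (R x)).
  apply: (@mx_gt0 _ _ 0); last by rewrite addn0 Em_base.
  by have := split2_base B_gt0 R_bound lx Dx s2; clear -rB; lia.
have lE : bits (off (R x)) (fun o => Em D (base (R x) + o)) <= N.
  by have := bits_lt (off (R x)) (fun o => Em D (base (R x) + o)); clear -epo2; lia.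
apply: (asgS (v := pre2 D x)).
- sx; rewrite Hb2 Ho2 mul1n HE Em0 Tm; do !split=> //; move: jN; rewrite jE;
    move: (mx _ _) gE lE; clear -W_ge; lia.
- by sx; rewrite Hb2 Ho2 mul1n HE Em0 Tm jE; move: (mx _ _) gE; clear; lia.
have adj := addr_ok jN; have adh := addr_ok hN.
apply: (asgS (v := bits B f)); [by sx | by sx |].
set f0 := fun o => f o && (o < off (R x)); set f1 := fun o => f o && ~~ (o < off (R x)).
have Ef0 : bits B f %% 2 ^ off (R x) = bits B f0 by rewrite bits_mod // ltnW.
have Ef1 : bits B f - bits B f0 = bits B f1.
  by apply: bits_sub => i li; rewrite /f1 /f0; case: (f i) => //=; case: (i < _).
have l0 : bits B f0 <= bits B f by rewrite -Ef0; apply: leq_mod.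
apply: (asgS (v := bits B f0)); [by sx; rewrite Ho2 mul1n; do !split | by sx; rewrite Ho2 mul1n |].
apply: (stoS (a := pre2 D x) (v := bits B f0)); [by sx | by sx | by sx | by sx | by [] |].
apply: (stoS (a := 2 * R x) (v := bits B f1)); [by sx | by sx | by sx | by sx | by [] |].
have EM : bits B (fun o => Em D (base (R x) + o)) + 2 ^ off (R x) =
    bits B (fun o => Em (mark D x) (base (R x) + o)).
  apply: bits_set => //; first by rewrite -rB; case/andP: s2 => _ /negbTE.
  move=> i li; rewrite (Em_mark B_gt0 R_bound lx Dx) s2 /=.
  by rewrite -(eqn_add2l (base (R x)) i) -rB.
have bM := @bitsB (fun o => Em D (base (R x) + o)).
apply: (stoS (a := base (R x)) (v := bits B (fun o => Em (mark D x) (base (R x) + o)))).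
- by sx.
- by sx; rewrite Hb2 Ho2 HE mul1n; do !split=> //; clear -epo2 bM W_ge; lia.
- by sx.
- by sx; rewrite Hb2 Ho2 HE mul1n.
- by [].
have jh : (pre2 D x == 2 * R x) = false.
  by apply/eqP => jh; move: lg; rewrite (_ : g = R x) ?ltnn //; clear -jg jh; lia.
apply: wp_mono; [apply: (@insert_spec va vhi _ (pre2 D x) (2 * R x) c T); sx=> // | by [] |].
move=> s' [fr af io [nx' pv' lab']]; split.
- move=> y ny; rewrite fr; first by move: ny; rewrite !inE; sx; do !case: eqP.
  by move: ny; rewrite !inE; case: (y == 19); rewrite ?orbT.
- move=> i ni; rewrite af; first by move: ni; rewrite !inE; sx; do !case: eqP.
  by move: ni; rewrite !inE; do !case: eqP.
- by case: io.
- move=> b lb bb'; rewrite af //; sx; case: eqP => [->//|ne]; rewrite mE //.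
  apply: eq_bits => o lo; rewrite (Em_mark B_gt0 R_bound lx Dx) s2 /=.
  rewrite (_ : b + o == R x = false) ?orbF //; apply/eqP => eo.
  by apply: ne; rewrite -eo -bb' base_add.
- split=> //.
  + by move=> k /negbTE h1 /negbTE h2; rewrite af //; sx; rewrite h1 h2.
  + move=> f' Pf'; rewrite !af //; sx; rewrite jh !eqxx.
    have G0 : bits B f' %% 2 ^ off (R x) = bits B (fun o => f' o && (o < off (R x))).
      by rewrite bits_mod // ltnW.
    have G1 : bits B f' - bits B (fun o => f' o && (o < off (R x))) =
        bits B (fun o => f' o && ~~ (o < off (R x))).
      by apply: bits_sub => i li; case: (f' i) => //=; case: (i < _).
    by rewrite -Ef1 -Ef0 -Pf Pf' G0 G1.
Qed.

End Structure.

(** * The invariant, and splitting pieces at the ends of a cut *)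

Section Operations.

Variables (w : nat) (q : nat -> nat) (N B : nat) (R : nat -> nat).
Hypothesis W_ge : 1024 * (N + 2) <= 2 ^ w.
Hypothesis B_gt0 : 0 < B.
Hypothesis B_le : 2 ^ B <= N + 1.
Hypothesis R_bound : forall x, x < N -> x < R x <= N.
Hypothesis R_laminar : forall x y, x < N -> x <= y < R x -> R y <= R x.

Local Notation base := (base B).
Local Notation off := (off B).
Local Notation wp := (wp w q).
Local Notation F := (F B R).
Local Notation live := (live N B R).
Local Notation Em := (Em B R).
Local Notation inn := (inn B R).
Local Notation ns := (ns B R).
Local Notation split2 := (split2 B R).
Local Notation pre2 := (pre2 B R).
Local Notation statics := (statics N B R).
Local Notation masks := (masks N B R).

(** [L] is ghost data: the program stores only links. Sortedness is what turns the order of names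
    into contiguity on the ring. *)
Definition lists (D : nat -> bool) (L : nat -> seq nat) (s : st) : Prop :=
  [/\ forall c k, (k \in L c) = live D k && (ar s aLab k == c),
      forall c, sorted ltn (L c) &
      forall c, ring (ar s aNx) (ar s aPv) (L c)].

Definition classes (D : nat -> bool) (s : st) : Prop :=
  forall k k', live D k -> live D k' -> (ar s aLab k = ar s aLab k' <-> ns D k k').

(** This keeps the position of the next cut free as a label. Label 0 is safe because the virtual
    root is never marked. *)
Definition labels (D : nat -> bool) (s : st) : Prop :=
  forall k, live D k -> (ar s aLab k == 0) || D (ar s aLab k).

Definition sums (D wt : nat -> bool) (s : st) : Prop :=
  forall c, (c == 0) || D c ->
    ar s aCs c = \sum_(0 <= y < N | ar s aLab (F D y) == c) wt y.

Record Inv (D wt : nat -> bool) (L : nat -> seq nat) (s : st) : Prop := MkInv {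
  inv_D : forall d, D d -> 0 < d < N;
  inv_wt : forall y, wt y -> y < N;
  inv_st : statics s;
  inv_mk : masks D wt s;
  inv_ls : lists D L s;
  inv_cl : classes D s;
  inv_lb : labels D s;
  inv_sm : sums D wt s }.

Lemma live_le D k : live D k -> k <= 2 * N + 1.
Proof. by case/andP => H _; clear -H; lia. Qed.

Lemma odd_even a b : (2 * a + 1 == 2 * b) = false.
Proof. by apply/eqP; clear; lia. Qed.

Lemma frame_trans xs ys s1 s2 s3 : frame xs s1 s2 -> frame ys s2 s3 -> frame (xs ++ ys) s1 s3.
Proof. by move=> h1 h2 y; rewrite mem_cat negb_or => /andP[n1 n2]; rewrite h2 // h1. Qed.

Lemma aframe_trans xs ys s1 s2 s3 : aframe xs s1 s2 -> aframe ys s2 s3 -> aframe (xs ++ ys) s1 s3.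
Proof. by move=> h1 h2 y; rewrite mem_cat negb_or => /andP[n1 n2]; rewrite h2 // h1. Qed.

Lemma frame_sub xs ys s s' : {subset xs <= ys} -> frame xs s s' -> frame ys s s'.
Proof. by move=> h f y ny; apply: f; apply: contra ny => /h. Qed.

Lemma aframe_sub xs ys s s' : {subset xs <= ys} -> aframe xs s s' -> aframe ys s s'.
Proof. by move=> h f y ny; apply: f; apply: contra ny => /h. Qed.

Lemma sameio_trans s1 s2 s3 : sameio s1 s2 -> sameio s2 s3 -> sameio s1 s3.
Proof. by move=> [a b c] [a' b' c']; split; rewrite ?a' ?b' ?c'. Qed.

Section Cut.

Variables (D wt : nat -> bool) (L : nat -> seq nat) (s0 : st) (x : nat).
Hypothesis I0 : Inv D wt L s0.
Hypotheses (x_lt : x < N) (x_new : D x = false) (x_var : vr s0 vx = x).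

Let D_lt d : D d -> d < N.
Proof. by move/(inv_D I0) => /andP[]. Qed.

Let k0 := F D x.
Let k1 := 2 * x + 1.
Let hi := 2 * R x.
Let j := pre2 D x.
Let C := ar s0 aLab k0.

Let Lk0 : live D k0.
Proof. exact: F_live (ltnW x_lt). Qed.

Lemma k0_in : k0 \in L C.
Proof. by case: (inv_ls I0) => -> _ _; rewrite Lk0 eqxx. Qed.

Lemma ns_k0 k : ns D k k0 <-> ns D k k1.
Proof.
by split=> H d Dd; move: (H d Dd) => ->; rewrite inn_k1 (inn_k0 B_gt0 R_bound R_laminar).
Qed.

Lemma in_C k : live D k -> (k \in L C) <-> ns D k k1.
Proof.
move=> Lk; case: (inv_ls I0) => -> _ _; rewrite Lk /= -ns_k0.
by rewrite -(inv_cl I0 Lk Lk0); split=> [/eqP|->].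
Qed.

Lemma j_neq_k0 : split2 D x -> j != k0.
Proof.
move=> s2; apply: contraTneq (inn_x_pre2 B_gt0 R_bound x_lt x_new s2) => e.
by rewrite -/j e (inn_x_k0 B_gt0 R_bound).
Qed.

Lemma j_in : split2 D x -> j \in L C.
Proof.
move=> s2; apply/in_C; first exact: (pre2_live B_gt0 R_bound).
by move=> d Dd; rewrite (inn_pre2 B_gt0 R_bound R_laminar) // inn_k1.
Qed.

(** The intermediate state: the masks already describe the pieces after the cut, while the new
    pieces still carry the label and share the ring of the old class. The bound on the size is the
    hypothesis of [phi_split] in the making. *)
Definition prep_post (M1 M2 : seq nat) (s : st) : Prop :=
  let M := M1 ++ k0 :: k1 :: M2 in
  [/\ [/\ frame [:: vb; vo; vm; vk; ve; vo2; vb2; vk1; vhi; vc; vt; vu; va] s0 s,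
          aframe [:: aPm; aMM; aEM; aNx; aPv; aLab] s0 s, sameio s0 s &
          [/\ vr s vk = k0, vr s vk1 = k1, vr s vhi = hi & vr s vc = C]],
      masks (mark D x) wt s,
      [/\ sorted ltn M, ring (ar s aNx) (ar s aPv) M,
          (forall c, c != C -> ring (ar s aNx) (ar s aPv) (L c)) &
          forall k, (k \in M) = live (mark D x) k && (ar s aLab k == C)] &
      [/\ forall k, live D k -> ar s aLab k = ar s0 aLab k,
          ar s aLab k1 = C, split2 D x -> ar s aLab hi = C &
          (size M <= size (L C) + 1) ||
          [&& split2 D x & size M == size (L C) + 2]]].

Lemma prep_spec T : wp prep_cmd s0 T (fun s => exists M1 M2, prep_post M1 M2 s).
Proof.
have [mM mE mW mP] := inv_mk I0; have [lm lsort lring] := inv_ls I0.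
have Hr := R_bound x_lt.
have k1N : k1 <= 2 * N + 1 by rewrite /k1; clear -x_lt; lia.
have hiN : hi <= 2 * N + 1 by rewrite /hi; clear -Hr; lia.
have k0N := live_le Lk0.
have k1new : live D k1 = false by apply: k1_new.
have mem_le c k : k \in L c -> k <= 2 * N + 1 by rewrite lm => /andP[/live_le].
have k01 := k0_lt B_gt0 R_bound x_lt x_new.
apply: wp_seq0; apply: wp_mono; [exact: (find_spec q W_ge B_gt0 B_le 0 (inv_st I0) (inv_mk I0) x_var x_lt) | by [] |].
move=> s1 [f1 a1 io1 [b1 o1 kk1]].
have st1 : statics s1 by case: (inv_st I0) => *; split; rewrite ?a1 // f1.
have mk1 : masks D wt s1 by case: (inv_mk I0) => *; split; rewrite ?a1.
apply: wp_seq0; apply: wp_mono; [apply: (split1_spec q W_ge B_gt0 B_le R_bound 0 st1 mk1 D_lt x_lt x_new) => //; by rewrite f1 | by [] |].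
move=> u2 [f2 a2 io2 [b2 o2 kk2 h2 c2] [M2 P2 [g0 [g1 [G0 G1 HG]]]]].
have [nxk pvk] := ring_mem (lring C) k0_in.
have c2' : vr u2 vc = C by rewrite c2 a1.
have nx2 : ar u2 aNx = ar s0 aNx by rewrite a2 // a1.
have pv2 : ar u2 aPv = ar s0 aPv by rewrite a2 // a1.
have lab2 : ar u2 aLab = ar s0 aLab by rewrite a2 // a1.
apply: wp_seq0; apply: wp_mono.
- apply: (insert_spec q W_ge B_gt0 B_le (p := vk) (y := vk1) (s := u2) (P := k0) (Y := k1) (c := C) 0) => //; first by rewrite f2.
  by rewrite nx2; apply: mem_le nxk.
- by [].
move=> s3 [f3 a3 io3 [nx3 pv3 lab3]].
rewrite nx2 pv2 in nx3 pv3; rewrite lab2 in lab3.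
have [S1 [S2 LCE]] : exists S1 S2, L C = S1 ++ k0 :: S2.
  by case: (splitPr k0_in) => S1 S2; exists S1, S2.
have srt := lsort C; have rng := lring C; rewrite LCE in srt rng.
have unq : uniq (S1 ++ k0 :: S2) by apply: sorted_uniq srt; [exact: ltn_trans | exact: ltnn].
have k1L c : k1 \notin L c by rewrite lm k1new.
have ring3 : ring (ar s3 aNx) (ar s3 aPv) (S1 ++ k0 :: k1 :: S2).
  by rewrite nx3 pv3; apply: ring_insert => //; rewrite -LCE.
have S2gt : all (ltn k0) S2.
  move: srt; rewrite (sorted_pairwise ltn_trans) pairwise_cat => /and3P[_ _] /=.
  by case/andP.
have memC k : k \in S1 ++ k0 :: S2 -> live D k /\ ns D k k1.
  rewrite -LCE => Hk; have Lk : live D k by move: Hk; rewrite lm => /andP[].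
  by split=> //; apply/in_C.
(* By [k0_adjacent] the class has nothing between [k0] and [k1]. *)
have S2gt1 : all (ltn k1) S2.
  apply/allP => k kS; have [Lk Nk] : live D k /\ ns D k k1.
    by apply: memC; rewrite mem_cat inE kS !orbT.
  have kk0 : k0 < k := allP S2gt _ kS; rewrite /= ltnNge; apply/negP => lek.
  apply: (k0_adjacent B_gt0 R_bound R_laminar D_lt x_lt x_new Lk Nk).
  rewrite kk0 /= ltn_neqAle lek andbT; apply: contraTneq Lk => ->; by rewrite k1new.
have srt3 : sorted ltn (S1 ++ k0 :: k1 :: S2) by apply: sorted_insert.
have unq3 : uniq (S1 ++ k0 :: k1 :: S2) by apply: sorted_uniq srt3;
  [exact: ltn_trans | exact: ltnn].
have disj c k : c != C -> k \in L c -> k \notin L C.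
  by move=> nc; rewrite !lm => /andP[-> /eqP->].
have ring3c c : c != C -> ring (ar s3 aNx) (ar s3 aPv) (L c).
  move=> nc; rewrite nx3 pv3; apply: etrans (lring c); apply: eq_ring => k kc;
    have kC := disj c k nc kc.
    rewrite /ins_nx /upd; case: eqP => [e|_]; first by have := k1L c; rewrite -e kc.
    by case: eqP => [e|_] //; rewrite e k0_in in kC.
  rewrite /ins_pv /upd; case: eqP => [e|_]; first by rewrite e nxk in kC.
  by case: eqP => [e|_] //; have := k1L c; rewrite -e kc.
have lab3k k : live D k -> ar s3 aLab k = ar s0 aLab k.
  by move=> Lk; rewrite lab3 /upd; case: eqP => // e; rewrite -e Lk in k1new.
have lab3k1 : ar s3 aLab k1 = C by rewrite lab3 /upd eqxx.
have st3 : statics s3.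
  case: st1 => *; split; rewrite ?a3 ?a2 //.
  by rewrite f3 // f2.
have mE3 b : b <= N -> base b = b -> ar s3 aEM b = bits B (fun o => Em D (b + o)).
  by move=> lb bb; rewrite a3 // a2 // a1 mE.
(* [pre2] lies in the new interval, so by [cut_range] it comes behind [k1], and the second insertion
   does not disturb the first. *)
have jM : split2 D x -> j \in S2.
  move=> s2; have jL := j_in s2; move: (jL); rewrite LCE mem_cat inE (negbTE (j_neq_k0 s2)) /=.
  case/orP => // jS1.
  have : j < k0.
    move: srt; rewrite (sorted_pairwise ltn_trans) pairwise_cat => /andP[/allrelP h _].
    by apply: h => //; rewrite mem_head.
  have := cut_range B_gt0 R_bound D_lt x_lt x_new (k := j).
  rewrite (inn_x_pre2 B_gt0 R_bound) // -/k1 => h.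
  have : k1 <= j < 2 * R x.
    rewrite -h //; last by apply/in_C => //; apply: (pre2_live B_gt0 R_bound).
    by rewrite (live_mark B_gt0 R_bound) // (pre2_live B_gt0 R_bound).
  by rewrite -/k0 -/k1 in k01; clear -k01; lia.
have pm3 k : ar s3 aPm k = ar u2 aPm k by rewrite a3.
have jk1 : j == k1 = false by rewrite eq_sym; apply: odd_even.
have pm3j : split2 D x -> exists f, ar s3 aPm j = bits B f /\
    forall o, o < B -> base (R x) + o < N -> f o = (F D (base (R x) + o) == j).
  move=> s2; have [g [jg bg _ _ _]] := pre2P B_gt0 R_bound x_lt x_new s2.
  have [f [Pf Hf]] := mP _ (pre2_live B_gt0 R_bound x_lt x_new s2).
  exists f; rewrite pm3 P2 ?(negbTE (j_neq_k0 s2)) ?j_neq_k0 ?jk1 // a1 Pf; split=> //.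
  by have bj : base (pre2 D x %/ 2) = base (R x) by [rewrite jg half2 bg]; rewrite bj in Hf.
apply: wp_mono.
- apply: (split2_spec q W_ge B_gt0 B_le R_bound (D := D) (s := s3) (x := x) (c := C) T st3) => //.
  + by rewrite f3 // f2.
  + by rewrite f3.
  + by rewrite f3.
  + by rewrite f3.
  + by rewrite f3.
  + move=> s2; split; last by have [f [Pf _]] := pm3j s2; exists f.
    have jj : j \in S1 ++ k0 :: k1 :: S2 by rewrite mem_cat !inE jM ?orbT.
    have [+ _] := ring_mem ring3 jj; rewrite mem_cat !inE.
    case/or4P => [h|/eqP->//|/eqP->//|h]; apply: (mem_le C); rewrite LCE mem_cat inE h ?orbT //.
- by [].
move=> s4 [f4 a4 io4 mE4 H4].
have Fk y : y <= N -> live D (F D y) by apply: F_live.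
have Fm y : y <= N -> F (mark D x) y = if (F D y == k0) && ini R x y then k1
  else if [&& split2 D x, F D y == j & R x <= y] then hi else F D y.
  by move=> ly; rewrite (F_mark B_gt0 R_bound R_laminar D_lt x_lt x_new ly).
have hinew : split2 D x -> live D hi = false by move=> s2; apply: hi_new.
have hk1 : hi == k1 = false by rewrite eq_sym; apply: odd_even.
have fr04 : frame [:: vb; vo; vm; vk; ve; vo2; vb2; vk1; vhi; vc; vt; vu; va] s0 s4.
  apply: frame_sub (frame_trans (frame_trans (frame_trans f1 f2) f3) f4).
  by apply/allP.
have af04 : aframe [:: aPm; aMM; aEM; aNx; aPv; aLab] s0 s4.
  apply: aframe_sub (aframe_trans (aframe_trans (aframe_trans (xs := [::]) _ a2) a3) a4).
    by apply/allP.
  by move=> i _; rewrite a1.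
have io04 : sameio s0 s4 by apply: sameio_trans (sameio_trans (sameio_trans io1 io2) io3) io4.
have mk4 : masks (mark D x) wt s4.
  split=> //.
  - by move=> b lb bb; rewrite a4 // a3 // M2.
  - by move=> b lb bb; rewrite af04 // mW.
  - move=> k; rewrite (live_mark B_gt0 R_bound x_lt x_new) => Hk.
    have pm4 : ~~ (split2 D x && ((k == j) || (k == hi))) -> ar s4 aPm k = ar u2 aPm k.
      move=> nk; rewrite -pm3; move: H4 nk; case: (split2 D x) => /= [[h _ _ _ _]|h _].
        by rewrite negb_or => /andP[n1 n2]; apply: h.
      by rewrite h.
    (* The second split leaves the masks of [k0] and [k1] alone: [j] differs from [k0] by [j_neq_k0]
       and from [k1] by parity, and [hi] is new. *)
    case: (k =P k0) => [ek|/eqP nk0].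
      exists g0; rewrite pm4; last first.
        by rewrite ek; apply/andP => -[s2]; rewrite eq_sym (negbTE (j_neq_k0 s2)) /= => /eqP h;
          have := hinew s2; rewrite -h Lk0.
      rewrite ek; split=> // o lo; rewrite (F_base R B_gt0) => lN; have [-> _] := HG o lo lN.
      rewrite Fm; last exact: ltnW.
      case: (F D _ =P F D x) => [e|ne] /=.
        case: ifP => _ /=; first by apply/esym/eqP => h; rewrite h Lk0 in k1new.
        case: ifP => [/and3P[s2 /eqP h _]|_]; last by rewrite e eqxx.
        by have := j_neq_k0 s2; rewrite -h e eqxx.
      case: ifP => [/and3P[s2 _ _]|_]; last by apply/esym/eqP.
      by apply/esym/eqP => h; have := hinew s2; rewrite h Lk0.
    case: (k =P k1) => [ek|/eqP nk1].
      exists g1; rewrite pm4; last by rewrite ek [k1 == j]eq_sym jk1 [k1 == hi]eq_sym hk1 andbF.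
      rewrite ek; split=> // o lo; rewrite half21 => lN; have [_ ->] := HG o lo lN.
      have lN' := ltnW lN; rewrite Fm //; case: ifP => h; first by rewrite eqxx.
      case: ifP => _; first by rewrite hk1.
      by apply/esym/eqP => h'; have := Fk _ lN'; rewrite h' k1new.
    rewrite (negbTE nk1) /= in Hk.
    case s2: (split2 D x) Hk H4 pm4 => Hk H4 pm4; last first.
      rewrite orbF in Hk; have [f [Pf Hf]] := mP _ Hk; exists f.
      rewrite pm4 // P2 // a1; split=> // o lo lN; rewrite Hf // Fm ?(ltnW lN) // s2 /=.
      case: ifP => // /andP[/eqP-> _]; rewrite -/k0 eq_sym (negbTE nk0).
      by apply/esym/eqP => h; rewrite -h k1new in Hk.
    have [f [Pf Hf]] := pm3j s2; have [_ p4 _ _ _] := H4.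
    have [Pj Ph] := p4 f Pf.
    have [g [jg bg _ _ _]] := pre2P B_gt0 R_bound x_lt x_new s2.
    have rr := base_mod B (R x).
    have ro o : (R x <= base (R x) + o) = ~~ (o < off (R x)) by rewrite {1}rr leq_add2l -leqNgt.
    case: (k =P j) => [ek|/eqP nj].
      exists (fun o => f o && (o < off (R x))); rewrite ek; split=> // o lo.
      rewrite [j]jg half2 bg => lN; rewrite Hf // Fm ?(ltnW lN) // s2 /= ro.
      case: (F D _ =P k0) => [e|ne] /=.
        have jk0 : (k0 == j) = false by rewrite eq_sym (negbTE (j_neq_k0 s2)).
        rewrite -jg e jk0 /=; case: ifP => _; last by rewrite jk0.
        by rewrite eq_sym jk1.
      rewrite -jg; case: (F D _ =P j) => [e|ne'] /=; last by apply/esym/eqP.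
      case: (o < off (R x)) => /=; first by rewrite e eqxx.
      apply/esym/eqP => h; have := hinew s2; by rewrite h (pre2_live B_gt0 R_bound).
    case: (k =P hi) => [ek|/eqP nh].
      exists (fun o => f o && ~~ (o < off (R x))); rewrite ek; split=> // o lo.
      rewrite half2 => lN; have lN' := ltnW lN; rewrite Hf // Fm // s2 /= ro.
      have nF : (F D (base (R x) + o) == hi) = false.
        by apply/eqP => h; have := Fk _ lN'; rewrite h hinew.
      case: (F D _ =P k0) => [e|ne] /=.
        have jk0 : (k0 == j) = false by rewrite eq_sym (negbTE (j_neq_k0 s2)).
        rewrite e in nF; rewrite e jk0 /=; case: ifP => _; last by rewrite nF.
        by rewrite eq_sym hk1.
      by case: (F D _ =P j) => [e|ne'] /=; [case: (o < off (R x)); rewrite ?eqxx ?nF | rewrite nF].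
    rewrite (negbTE nh) orbF in Hk; have [f' [Pf' Hf']] := mP _ Hk; exists f'.
    rewrite pm4; last by rewrite (negbTE nj) (negbTE nh).
    rewrite P2 // a1; split=> // o lo lN; rewrite Hf' // Fm ?(ltnW lN) //.
    case: ifP => [/andP[/eqP-> _]|_].
      by rewrite -/k0 [k0 == k]eq_sym (negbTE nk0) [k1 == k]eq_sym (negbTE nk1).
    case: ifP => // /and3P[_ /eqP-> _].
    by rewrite [j == k]eq_sym (negbTE nj) [hi == k]eq_sym (negbTE nh).
have vars4 : [/\ vr s4 vk = k0, vr s4 vk1 = k1, vr s4 vhi = hi & vr s4 vc = C].
  by split; rewrite f4 // f3 // f2.
have mem3 k : (k \in S1 ++ k0 :: k1 :: S2) = (k == k1) || (k \in L C).
  by rewrite LCE !mem_cat !inE; case: (k == k1); rewrite ?orbT.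
have sz3 : size (S1 ++ k0 :: k1 :: S2) = size (L C) + 1.
  by rewrite LCE !size_cat /= !addnS addn0.
case s2: (split2 D x) H4 => H4; last first.
  have nx4 : ar s4 aNx = ar s3 aNx by apply: H4.
  have pv4 : ar s4 aPv = ar s3 aPv by apply: H4.
  have lab4 : ar s4 aLab = ar s3 aLab by apply: H4.
  exists S1, S2; split=> //.
    split=> //; rewrite ?nx4 ?pv4 // => k;
      rewrite mem3 lab4 (live_mark B_gt0 R_bound x_lt x_new) s2.
    case: (k =P k1) => [->|nk] /=; first by rewrite lab3k1 eqxx orbT.
    by rewrite orbF lm; case Lk: (live D k); rewrite //= lab3k.
  by split=> [k Lk|||] //; rewrite ?lab4 ?sz3 ?leqnn ?s2 //; apply: lab3k.
have [_ _ nx4 pv4 lab4] := H4.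
have [T1 [T2 S2E]] : exists T1 T2, S2 = T1 ++ j :: T2.
  by case: (splitPr (jM s2)) => T1 T2; exists T1, T2.
have hnew := hinew s2.
have hM : hi \notin S1 ++ k0 :: k1 :: S2 by rewrite mem3 hk1 lm hnew.
pose P1 := S1 ++ k0 :: k1 :: T1.
have PE : S1 ++ k0 :: k1 :: S2 = P1 ++ j :: T2 by rewrite S2E /P1 -catA.
have PE' : S1 ++ k0 :: k1 :: T1 ++ j :: hi :: T2 = P1 ++ j :: hi :: T2 by rewrite /P1 -catA.
rewrite PE in ring3 srt3 unq3 hM mem3 sz3.
have mem4 k : (k \in P1 ++ j :: hi :: T2) = (k == hi) || (k == k1) || (k \in L C).
  by rewrite -orbA -mem3 !mem_cat !inE; case: (k == hi); rewrite ?orbT.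
have T2gt : all (ltn hi) T2.
  move: (srt3); rewrite (sorted_pairwise ltn_trans) pairwise_cat => /and3P[_ _] /= /andP[/allP h _].
  apply/allP => k kT; have jk : j < k := h k kT.
  have kS : k \in S2 by rewrite S2E mem_cat inE kT !orbT.
  have [Lk Nk] : live D k /\ ns D k k1 by apply: memC; rewrite mem_cat inE kS !orbT.
  rewrite /= ltnNge; apply/negP => lek.
  apply: (pre2_adjacent B_gt0 R_bound R_laminar D_lt x_lt x_new s2 Lk Nk).
  rewrite jk /= ltn_neqAle lek andbT; apply: contraTneq Lk => ->; by rewrite hnew.
exists S1, (T1 ++ j :: hi :: T2); rewrite /prep_post PE'; split=> //.
  split.
  - by apply: sorted_insert => //; apply: (pre2_lt B_gt0 R_bound x_lt x_new s2).
  - by rewrite nx4 pv4; apply: ring_insert.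
  - move=> c nc; rewrite nx4 pv4; apply: etrans (ring3c c nc).
    have jj : j \in P1 ++ j :: T2 by rewrite mem_cat mem_head orbT.
    have [nj _] := ring_mem ring3 jj; rewrite mem3 in nj.
    apply: eq_ring => k kc; have kC := disj c k nc kc.
      rewrite /ins_nx /upd; case: eqP => [e|_]; first by move: kc; rewrite lm e hnew.
      by case: eqP => [e|_] //; rewrite e j_in in kC.
    rewrite /ins_pv /upd; case: eqP => [e|_].
      case/orP: nj => [/eqP h|h]; last by rewrite e h in kC.
      by have := k1L c; rewrite -h -e kc.
    by case: eqP => [e|_] //; move: kc; rewrite lm e hnew.
  - move=> k; rewrite mem4 lab4 (live_mark B_gt0 R_bound x_lt x_new) s2 /upd -/k1 -/hi.
    case: (k =P hi) => [->|nh] /=; first by rewrite ?eqxx !orbT.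
    case: (k =P k1) => [->|nk] /=; first by rewrite lab3k1 eqxx orbT.
    by rewrite orbF lm; case Lk: (live D k); rewrite //= lab3k.
split.
- move=> k Lk; rewrite lab4 /upd; case: eqP => [e|_]; last exact: lab3k.
  by rewrite e hnew in Lk.
- by rewrite lab4 /upd eq_sym hk1.
- by move=> _; rewrite lab4 /upd eqxx.
- apply/orP; right; rewrite s2 /=; move: sz3; rewrite !size_cat /= => h; apply/eqP; clear -h; lia.
Qed.

End Cut.
End Operations.

(** * Walking, relinking and relabelling *)

Section Relabel.

Variables (w : nat) (q : nat -> nat) (N B : nat) (R : nat -> nat).
Hypothesis W_ge : 1024 * (N + 2) <= 2 ^ w.
Hypothesis B_gt0 : 0 < B.
Hypothesis B_le : 2 ^ B <= N + 1.
Hypothesis R_bound : forall x, x < N -> x < R x <= N.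
Hypothesis R_laminar : forall x y, x < N -> x <= y < R x -> R y <= R x.

Local Notation base := (base B).
Local Notation off := (off B).
Local Notation wp := (wp w q).
Local Notation F := (F B R).
Local Notation live := (live N B R).
Local Notation Em := (Em B R).
Local Notation inn := (inn B R).
Local Notation ns := (ns B R).
Local Notation split2 := (split2 B R).
Local Notation pre2 := (pre2 B R).
Local Notation statics := (statics N B R).
Local Notation masks := (masks N B R).

(** The ring is read from [k1], so that the inside comes first and [k0] is last. After [i]
    iterations the pointers are [i] entries from the two ends, and the loop stops when one of the
    sides is used up. *)
Lemma walk_spec s k0 k1 hi inner outer : 0 < size outer ->
  ring (ar s aNx) (ar s aPv) ((k1 :: inner) ++ outer) ->
  vr s vk = k0 -> vr s vk1 = k1 -> vr s vhi = hi -> last 0 outer = k0 ->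
  (forall y : nat, y \in k1 :: inner -> k1 <= y < hi) -> (forall y : nat, y \in outer -> ~~ (k1 <= y < hi)) ->
  (forall y : nat, y \in (k1 :: inner) ++ outer -> y <= 2 * N + 1) ->
  wp walk_cmd s (minn (size inner).+1 (size outer)) (fun s' =>
    [/\ frame [:: va; vz; vxs; vys] s s', ar s' = ar s, sameio s s' &
      ((size inner).+1 <= size outer /\ vr s' vxs = k1 /\ vr s' vys = last k1 inner) \/
      (size outer <= (size inner).+1 /\ vr s' vxs = head 0 outer /\ vr s' vys = k0)]).
Proof.
move=> o0 rng Hk Hk1 Hhi lo Hin Hout Hle.
set t := (k1 :: inner) ++ outer in rng Hle.
have szt : size t = (size inner).+1 + size outer by rewrite size_cat.
have tin i : i < (size inner).+1 -> k1 <= nth 0 t i < hi.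
  by move=> li; rewrite nth_cat /= li; apply: Hin; apply: mem_nth.
have tout i : (size inner).+1 <= i < size t -> ~~ (k1 <= nth 0 t i < hi).
  move=> li; rewrite nth_cat /= ltnNge (proj1 (andP li)) /=; apply: Hout; apply: mem_nth.
  by move: li; rewrite szt => /andP[l1 l2]; rewrite ltn_subLR // ltnW.
have tle i : i < size t -> nth 0 t i <= 2 * N + 1 by move=> li; apply: Hle; apply: mem_nth.
have twoW : 2 < 2 ^ w by clear -W_ge; lia.
have oneW : 1 < 2 ^ w by clear -W_ge; lia.
apply: (asgS (v := k1)); [by sx | by sx |].
apply: (asgS (v := k0)); [by sx | by sx |].
pose P1 := (size inner).+1; pose P2 := size outer; rewrite -/P1 -/P2 in szt tin tout o0 *.
pose Iw (k : nat) (s' : st) := exists i, [/\ i < P1, i < P2, k = minn P1 P2 - i.+1,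
  [/\ frame [:: va; vz; vxs; vys] s s', ar s' = ar s & sameio s s'] &
  vr s' va = nth 0 t i /\ vr s' vz = nth 0 t (P1 + P2 - i.+1)].
have nxE i : i < P1 -> ar s aNx (nth 0 t i) = nth 0 t i.+1.
  by move=> li; have [] := ring_nth rng (i := i) _; rewrite ?szt; clear -li o0; lia.
have pvE i : i < P2 -> 0 < P1 -> ar s aPv (nth 0 t (P1 + P2 - i.+1)) = nth 0 t (P1 + P2 - i.+2).
  move=> li p0; have [] := ring_nth rng (i := P1 + P2 - i.+2) _; first by rewrite szt;
    clear -li p0; lia.
  by rewrite (_ : (P1 + P2 - i.+2).+1 = P1 + P2 - i.+1) //; clear -li p0; lia.
have inE' y : (1 - (y < k1)) * (y < hi) = (k1 <= y < hi).
  by rewrite ltnNge; case: (k1 <= y); case: (y < hi).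
have insf (y : nat) : (k1 <= y < hi) <= 1 by case: (_ && _).
have tinb i : i < size t -> (k1 <= nth 0 t i < hi) = (i < P1).
  move=> li; case: (ltnP i P1) => h; first exact: tin.
  by apply/negbTE/tout; rewrite h.
have ok i : i < P1 -> i < P2 -> [/\ nth 0 t i <= 2 * N + 1, nth 0 t i.+1 <= 2 * N + 1,
    nth 0 t (P1 + P2 - i.+1) <= 2 * N + 1 & nth 0 t (P1 + P2 - i.+2) <= 2 * N + 1].
  by move=> l1 l2; split; apply: tle; rewrite szt; clear -l1 l2; lia.
have nb (b : bool) : b < 2 ^ w by case: b; rewrite ?oneW //; clear -oneW; lia.
have bb (b1 b2 : bool) : b1 * b2 < 2 ^ w by rewrite mulnb.
have bb2 (b c : bool) : b * (1 - c) < 2 ^ w by case: b; case: c; clear -oneW; lia.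
have b1 (b : bool) : b <= 1 by case: b.
have ad a : a <= 2 * N + 1 -> 32 * a + 96 <= 2 ^ w by clear -W_ge; lia.
have vars s' : frame [:: va; vz; vxs; vys] s s' -> [/\ vr s' vk = k0, vr s' vk1 = k1 & vr s' vhi = hi].
  by move=> fr; rewrite !fr.
rewrite -[minn P1 P2]addn0; apply: wp_seq.
apply: (wp_mono (T := minn P1 P2 - 1) (Q := fun s' => exists i,
     [/\ i < P1, i < P2, (i.+1 < P1) && (i.+1 < P2) = false,
       [/\ frame [:: va; vz; vxs; vys] s s', ar s' = ar s & sameio s s'] &
       vr s' va = nth 0 t i /\ vr s' vz = nth 0 t (P1 + P2 - i.+1)])); last first.
- move=> s' [i [l1 l2 ex [fr aE io] [Ha Hz]]].
  have [n1 n2 n3 n4] := ok i l1 l2; have [Hk' Hk1' Hhi'] := vars _ fr.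
  have H1 := nxE i l1; have lt1 : i.+1 < size t by rewrite szt; clear -l1 l2; lia.
  have sf : safe w (inside (aNx.[|$va])%X) s'.
    rewrite /inside; sx; rewrite Ha aE H1 Hk1' Hhi' inE'; do !split=> //; exact: ad.
  have evE : ev (inside (aNx.[|$va])%X) s' = (i.+1 < P1).
    by rewrite /inside; sx; rewrite Ha aE H1 Hk1' Hhi' inE' tinb.
  (* If the forward walk could still continue, the outside ran out first and is the smaller side;
     otherwise the inside is exhausted. *)
  apply: wp_if => //; rewrite evE => e.
  + apply: (asgS (v := nth 0 t (P1 + P2 - i.+1))) => //.
    apply: (asg1 (v := k0)); [by sx | by sx |].
    have p2 : i.+1 = P2 by case: (i.+1 < P1) e ex => //=; clear -l2; lia.
    split; [by move=> y ny; rewrite -fr //; move: ny; rewrite !inE; sx;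
      do !case: eqP | by [] | by [] |].
    right; split; first by case: (i.+1 =P P1) e => //; clear -p2 l1; lia.
    split=> //; sx; rewrite p2 addnK nth_cat /= ltnn subnn; by case: (outer).
  + apply: (asgS (v := k1)) => //.
    apply: (asg1 (v := nth 0 t i)); [by sx | by sx |].
    have p1 : i.+1 = P1 by case: (ltnP i.+1 P1) e => //=; clear -l1; lia.
    split; [by move=> y ny; rewrite -fr //; move: ny; rewrite !inE; sx;
      do !case: eqP | by [] | by [] |].
    left; split; first by rewrite -/P1 -/P2 -p1.
    split=> //; sx; rewrite nth_cat /= l1.
    by rewrite (last_nth 0); congr nth; case: p1.
- by apply: leq_subr.
apply: (wp_while (Inv := Iw)).
  move=> k s' [i [l1 l2 kE [fr aE io] [Ha Hz]]].
  have [n1 n2 n3 n4] := ok i l1 l2; have [Hk' Hk1' Hhi'] := vars _ fr.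
  have H1 := nxE i l1; have H2 := pvE i l2 (leq_ltn_trans (leq0n _) l1).
  have lt1 : i.+1 < size t by rewrite szt; clear -l1 l2; lia.
  have lt2 : P1 + P2 - i.+2 < size t by rewrite szt; clear -l1 l2; lia.
  have evE : ev (inside (aNx.[|$va]) * (#1 - inside (aPv.[|$vz])))%X s' =
      (i.+1 < P1) && (i.+1 < P2).
    rewrite /inside; sx; rewrite Ha Hz aE H1 H2 Hk1' Hhi' !inE' !tinb //.
    have -> : (P1 + P2 - i.+2 < P1) = ~~ (i.+1 < P2) by clear -l1 l2; apply/idP/idP; lia.
    by case: (i.+1 < P1); case: (i.+1 < P2).
  split; rewrite ?evE.
  - rewrite /inside; sx; rewrite Ha Hz aE H1 H2 Hk1' Hhi' !inE'.
    do !split=> //; try exact: ad; exact: bb2.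
  - by move=> e; exists i; split=> //; case: (_ && _) e.
  - move=> e; have [m1 m2] : i.+1 < P1 /\ i.+1 < P2 by apply/andP; case: (_ && _) e.
    exists 0; apply: (asgS (v := nth 0 t i.+1)).
    + by sx; rewrite Ha; split=> //; apply: ad.
    + by sx; rewrite Ha aE.
    apply: (asg1 (v := nth 0 t (P1 + P2 - i.+2))).
    + by sx; rewrite Hz; split=> //; apply: ad.
    + by sx; rewrite Hz aE.
    exists (minn P1 P2 - i.+2); split; first by rewrite kE; clear -m1 m2; lia.
    exists i.+1; split=> //; split=> //.
    by move=> y ny; rewrite -fr //; move: ny; rewrite !inE; sx; do !case: eqP.
exists 0; split=> //.
- split=> //; by move=> y; rewrite !inE; sx; do !case: eqP.
- split; sx=> //; rewrite -lo nth_cat /= (_ : P1 + P2 - 1 < P1 = false); last by clear -o0; lia.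
  by rewrite -nth_last; congr nth; rewrite /P1 /P2; clear -o0; lia.
Qed.

Lemma relink_spec s xs ys T : vr s vxs = xs -> vr s vys = ys ->
  xs <= 2 * N + 1 -> ys <= 2 * N + 1 -> ar s aPv xs <= 2 * N + 1 -> ar s aNx ys <= 2 * N + 1 ->
  wp relink_cmd s T (fun s' =>
    [/\ frame [:: vt; vu] s s', aframe [:: aNx; aPv] s s', sameio s s' &
      ar s' aNx = cut_nx (ar s aNx) (ar s aPv) xs ys /\
      ar s' aPv = cut_pv (ar s aNx) (ar s aPv) xs ys]).
Proof.
move=> Hx Hy l1 l2 l3 l4.
have ad a : a <= 2 * N + 1 -> 32 * a + 96 <= 2 ^ w by clear -W_ge; lia.
apply: (asgS (v := ar s aPv xs)); [by sx; rewrite Hx; split=> //; apply: ad | by sx; rewrite Hx |].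
apply: (asgS (v := ar s aNx ys)); [by sx; rewrite Hy; split=> //; apply: ad | by sx; rewrite Hy |].
apply: (stoS (a := ar s aPv xs) (v := ar s aNx ys)); [by sx | by sx | by sx | by sx | exact: ad |].
apply: (stoS (a := ys) (v := xs)); [by sx | by sx | by sx | by sx | exact: ad |].
apply: (stoS (a := ar s aNx ys) (v := ar s aPv xs)); [by sx | by sx | by sx | by sx | exact: ad |].
apply: (sto1 (a := xs) (v := ys)); [by sx | by sx | by sx | by sx | exact: ad |].
by split=> //; frame_tac.
Qed.

Definition nodesum (D wt : nat -> bool) (k : nat) : nat :=
  \sum_(0 <= y < N | F D y == k) wt y.

Lemma sum_nodesum D wt (t : seq nat) : uniq t ->
  \sum_(k <- t) nodesum D wt k = \sum_(0 <= y < N | F D y \in t) wt y.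
Proof.
move=> ut; rewrite /nodesum (exchange_big_dep xpredT) //= [RHS]big_mkcond /=; apply: eq_bigr => y _.
case: ifP => [yt|/negbT yt].
  rewrite -big_filter (_ : [seq i <- t | F D y == i] = [:: F D y]) ?big_seq1 //.
  rewrite (eq_filter (a2 := pred1 (F D y))); last by move=> k /=; rewrite eq_sym.
  by rewrite filter_pred1_uniq.
by rewrite big_seq_cond big1 // => k /andP[kt /eqP e]; rewrite e kt in yt.
Qed.

Lemma sum_wt_le (wt P : nat -> bool) : \sum_(0 <= y < N | P y) wt y <= N.
Proof.
apply: leq_trans (_ : \sum_(0 <= y < N) 1 <= N); last by rewrite sum_nat_const_nat subn0 muln1.
rewrite big_mkcond; apply: leq_sum => y _; by case: (P y); case: (wt y).
Qed.

(** Weights vanish from [N] on, which masks out the unspecified bits of a piece mask. Since a piece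
    stays in its block, the sum over the block is the sum over all positions. *)
Lemma popcount D wt s k : statics s -> masks D wt s -> (forall y, wt y -> y < N) -> live D k ->
  ar s aTp (Nat.land (ar s aWm (base (k %/ 2))) (ar s aPm k)) = nodesum D wt k /\
  ar s aWm (base (k %/ 2)) <= N.
Proof.
move=> [_ _ _ _ [sp0 spS]] [_ _ mW mP] wtN Lk.
have gN : k %/ 2 <= N by case/andP: Lk.
have bN : base (k %/ 2) <= N by apply: leq_trans gN; apply: base_le.
have [f [-> Hf]] := mP _ Lk; rewrite mW //; last exact: base_id.
rewrite bits_land (tp_bits (K := B)) //; split; last first.
  by have := bits_lt B (fun o => wt (base (k %/ 2) + o)); clear -B_le; lia.
transitivity (\sum_(o < B) wt (base (k %/ 2) + o) * (F D (base (k %/ 2) + o) == k)).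
  apply: eq_bigr => -[o lo] _ /=; rewrite mulnb; congr nat_of_bool.
  by case E: (wt _) => //=; rewrite Hf //; apply: wtN.
rewrite (@sum_block (fun y => wt y * (F D y == k)) _ _ N).
- rewrite /nodesum [RHS]big_mkcond /=; apply: eq_bigr => y _; case: eqP => _;
    first by rewrite muln1.
  by rewrite muln0.
- move=> y ly; case: (F D y =P k) => [<- _|]; last by rewrite muln0.
  by rewrite (F_base R B_gt0) base_le base_gt.
- by move=> y Ny; case E: (wt y) => //; move: (wtN _ E); rewrite ltnNge Ny.
Qed.

Lemma relabel_spec D wt s x c xs seg : statics s -> masks D wt s -> (forall y, wt y -> y < N) ->
  x < N -> c < N -> c != x -> uniq (xs :: seg) -> all (live D) (xs :: seg) ->
  ring (ar s aNx) (ar s aPv) (xs :: seg) ->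
  vr s vx = x -> vr s vc = c -> vr s vxs = xs -> vr s vys = last xs seg ->
  let S := \sum_(k <- xs :: seg) nodesum D wt k in
  S <= ar s aCs c ->
  wp relabel_cmd s (size seg).+1 (fun s' =>
    [/\ frame [:: vS; vy; vf; vt] s s', aframe [:: aLab; aCs] s s', sameio s s',
      (forall k, ar s' aLab k = if k \in xs :: seg then x else ar s aLab k) &
      ar s' aCs = upd (upd (ar s aCs) x S) c (ar s aCs c - S)]).
Proof.
move=> st0 mk0 wtN lx lc cx; set t := xs :: seg => ut lt rng Hx Hc Hxs Hys S HS.
have sB : vr s vB = B by case: st0.
have ad a : a <= 2 * N + 1 -> 32 * a + 96 <= 2 ^ w by clear -W_ge; lia.
have oneW : 1 < 2 ^ w by clear -W_ge; lia.
have twoW : 2 < 2 ^ w by clear -W_ge; lia.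
have zW : 0 < 2 ^ w by clear -W_ge; lia.
have x2 : x <= 2 * N + 1 by clear -lx; lia.
have c2 : c <= 2 * N + 1 by clear -lc; lia.
have SN : S <= N by rewrite /S sum_nodesum //; apply: sum_wt_le.
apply: (asgS (v := 0)); [by sx | by sx |].
apply: (asgS (v := xs)); [by sx | by sx |].
apply: (asgS (v := 1)); [by sx | by sx |].
pose Q' i (s' : st) := [/\ frame [:: vS; vy; vf; vt] s s', aframe [:: aLab] s s', sameio s s',
   (forall k, ar s' aLab k = if k \in take i t then x else ar s aLab k) &
   vr s' vS = \sum_(k <- take i t) nodesum D wt k].
(* After [i] iterations the first [i] nodes of the segment are done; the flag is cleared exactly
   when these are all. *)
pose Iw (k : nat) (s' : st) := exists i, [/\ Q' i s', k = size t - i &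
  (vr s' vf = 1 /\ i < size t /\ vr s' vy = nth 0 t i) \/ (vr s' vf = 0 /\ i = size t)].
have take_S i : i < size t -> take i.+1 t = rcons (take i t) (nth 0 t i).
  by move=> li; apply: take_nth.
have ps i : \sum_(k <- take i t) nodesum D wt k <= N.
  by rewrite sum_nodesum ?take_uniq //; apply: sum_wt_le.
rewrite -[(size seg).+1]addn0; apply: wp_seq.
apply: (wp_mono (T := (size seg).+1) (Q := Q' (size t))) => //.
  apply: (wp_while (Inv := Iw)).
    move=> k s' [i [[fr af io labi Si] kE dis]]; split=> //.
      move=> vf0; case: dis => [[h _]|[_ ei]]; first by rewrite /= h in vf0.
      by rewrite -ei; split.
    sx => nf; case: dis => [[_ [li Hy]]|[h _]]; last by rewrite h in nf.
    exists 0.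
    have yt : nth 0 t i \in t by apply: mem_nth.
    have Ly := allP lt _ yt; have ly := live_le Ly; have ady := ad _ ly.
    have y2 : nth 0 t i %/ 2 <= N by case/andP: Ly.
    have by2 := base_le B (nth 0 t i %/ 2); have bm := base_mod B (nth 0 t i %/ 2).
    have bN : base (nth 0 t i %/ 2) <= N by apply: leq_trans by2 y2.
    have [pc wl] := popcount st0 mk0 wtN Ly.
    have lnd : Nat.land (ar s aWm (base (nth 0 t i %/ 2))) (ar s aPm (nth 0 t i)) <= N.
      by apply: leq_trans wl; rewrite -ltnS; apply: land_ltl.
    apply: (stoS (a := nth 0 t i) (v := x)); [by sx | by sx | by sx | by sx; rewrite fr | by [] |].
    apply: (asgS (v := nth 0 t i %/ 2)); [by sx | by sx; rewrite Hy |].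
    apply: (asgS (v := base (nth 0 t i %/ 2))).
    + sx; rewrite fr // sB; do !split=> //; exact: leq_mod.
    + by sx; rewrite fr // sB -/(off _); clear -bm; lia.
    apply: (asgS (v := \sum_(k <- take i.+1 t) nodesum D wt k)).
    + sx; rewrite !af // Hy Si; do !split=> //.
      * by clear -bN W_ge; lia.
      * by clear -lnd W_ge; lia.
      * rewrite pc; have := ps i.+1; rewrite take_S // -cats1 big_cat big_seq1 /=.
        by clear -W_ge; lia.
    + by rewrite take_S // -cats1 big_cat big_seq1; sx; rewrite !af // Hy Si pc.
    apply: (asgS (v := 1 - (nth 0 t i == last xs seg))).
    + by sx; do !split=> //; case: (_ == _).
    + by sx; rewrite Hy fr // Hys.
    apply: (asg1 (v := ar s aNx (nth 0 t i))).
    + by sx; rewrite Hy.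
    + by sx; rewrite Hy af.
    exists (size t - i.+1); split; first by rewrite kE; clear -li; lia.
    exists i.+1; split=> //.
    + split=> //.
      * by move=> y ny; rewrite -fr //; move: ny; rewrite !inE; sx; do !case: eqP.
      * by move=> y ny; rewrite -(af y ny); move: ny; rewrite inE => /negbTE ny; sx; rewrite ny.
      * by move=> k'; rewrite take_S // mem_rcons inE; sx; rewrite labi; case: (k' == _).
    + have lastE : last xs seg = nth 0 t (size seg) by rewrite (last_nth 0).
      case: (ltnP i.+1 (size t)) => li'.
        have nu : (nth 0 t i == last xs seg) = (i == size seg).
          by rewrite lastE; apply: nth_uniq => //=.
        left; sx; rewrite nu (_ : i == size seg = false); last by apply/eqP => e;
          rewrite e /= ltnn in li'.
        by split=> //; split=> //; have [-> _] := ring_nth rng li'.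
      right; sx; have e : i = size seg by move: li li'; rewrite /=; clear; lia.
      by rewrite lastE -e eqxx; split; rewrite // e.
  exists 0; split.
  - split=> //; first by frame_tac.
    by rewrite take0 big_nil.
  - by rewrite subn0.
  - by left; sx; split.
move=> s' [fr af io lab' S']; rewrite take_size in lab' S'.
apply: (stoS (a := x) (v := S)); [by sx | by sx | by sx; rewrite fr | by sx | exact: ad |].
apply: (sto1 (a := c) (v := ar s aCs c - S)).
- by sx.
- sx; rewrite (fr vc) // Hc S' af //; split=> //; last by rewrite (negbTE cx).
  by split=> //; apply: ad.
- by sx; rewrite fr.
- by sx; rewrite (fr vc) // Hc S' af // (negbTE cx).
- exact: ad.
split=> //.
- move=> i; rewrite !inE negb_or => /andP[n1 n2]; rewrite -(af i) ?inE //.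
  by sx; rewrite (negbTE n2).
- by sx; rewrite af.
Qed.

End Relabel.

(** * A cut and its amortized cost *)

Section CutUpdate.

Variables (w : nat) (q : nat -> nat) (N B : nat) (R : nat -> nat).
Hypothesis W_ge : 1024 * (N + 2) <= 2 ^ w.
Hypothesis B_gt0 : 0 < B.
Hypothesis B_le : 2 ^ B <= N + 1.
Hypothesis R_bound : forall x, x < N -> x < R x <= N.
Hypothesis R_laminar : forall x y, x < N -> x <= y < R x -> R y <= R x.

Local Notation base := (base B).
Local Notation off := (off B).
Local Notation wp := (wp w q).
Local Notation F := (F B R).
Local Notation live := (live N B R).
Local Notation Em := (Em B R).
Local Notation inn := (inn B R).
Local Notation ns := (ns B R).
Local Notation split2 := (split2 B R).
Local Notation pre2 := (pre2 B R).
Local Notation statics := (statics N B R).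
Local Notation masks := (masks N B R).

Local Notation nodesum := (nodesum N B R).
Local Notation lists := (lists N B R).
Local Notation classes := (classes N B R).
Local Notation labels := (labels N B R).
Local Notation sums := (sums N B R).
Local Notation Inv := (Inv N B R).

Definition Pot (L : nat -> seq nat) : nat := \sum_(0 <= c < N) phi (size (L c)).

Lemma Pot_split L c0 x A A' : c0 < N -> x < N -> c0 != x -> L x = [::] ->
  Pot (fun c => if c == c0 then A else if c == x then A' else L c) + phi (size (L c0)) =
  Pot L + (phi (size A) + phi (size A')).
Proof.
move=> lc lx ne Lx; rewrite /Pot.
have H (f : nat -> nat) : \sum_(0 <= c < N) f c =
    f c0 + f x + \sum_(i < N | (i != Ordinal lc) && (i != Ordinal lx)) f i.
  by rewrite big_mkord (bigD1 (Ordinal lc)) //= (bigD1 (Ordinal lx)) /= ?addnA // -val_eqE eq_sym.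
rewrite !H eqxx eq_sym (negbTE ne) eqxx Lx.
set s1 := \sum_(i < N | _) _; set s2 := \sum_(i < N | _) _.
suff -> : s1 = s2 by rewrite /phi /=; lia.
by apply: eq_bigr => i /andP[/negbTE h1 /negbTE h2]; rewrite -!val_eqE /= in h1 h2; rewrite h1 h2.
Qed.

Lemma wp_exec c1 c2 s t s1 T Q : exec w q c1 s t s1 -> wp c2 s1 T Q -> wp (c1;; c2) s (t + T) Q.
Proof. by move=> X H; apply: wp_seq; exists t, s1; split. Qed.

Definition cut_vars : seq nat :=
  [:: vb; vo; vm; vk; ve; vo2; vb2; vk1; vhi; vc; vt; vu; va; vz; vxs; vys; vS; vy; vf].
Definition dyn_arrays : seq nat :=
  [:: aPm; aMM; aEM; aNx; aPv; aLab; aCs].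

(** Walking and relabelling each take at most as many iterations as the smaller side has pieces.
    [phi_split] pays for one of them up to 2, hence the doubled potential and the constant 4. *)
Lemma cut_spec D wt L s0 x : Inv D wt L s0 -> 0 < x < N -> D x = false -> vr s0 vx = x ->
  exists T L', T + 2 * Pot L' <= 2 * Pot L + 4 /\
    wp cut_cmd s0 T (fun s => [/\ Inv (mark D x) wt L' s, frame cut_vars s0 s,
      aframe dyn_arrays s0 s & sameio s0 s]).
Proof.
move=> I0 /andP[x_gt0 x_lt] x_new x_var.
have D_lt d : D d -> d < N by move/(inv_D I0) => /andP[].
have [lm0 lsort0 lring0] := inv_ls I0.
have [t1 [s1 [l1 X1 [M1 [M2 P]]]]] :=
  prep_spec q W_ge B_gt0 B_le R_bound R_laminar I0 x_lt x_new x_var 0.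
have {l1} ? : t1 = 0 by case: t1 l1 {X1}. subst t1.
move: P; rewrite /prep_post; set k0 := F D x; set k1 := 2 * x + 1; set hi := 2 * R x.
set C := ar s0 aLab k0; set M := M1 ++ k0 :: k1 :: M2.
move=> [[fr1 af1 io1 [Hk Hk1 Hhi Hc]] mk1 [srt rng rngc memM] [lab1 labk1 labhi szM]].
have Lk0 : live D k0 by apply: F_live (ltnW x_lt).
have Hr := R_bound x_lt.
have CD : (C == 0) || D C by apply: (inv_lb I0).
have Cx : C != x by apply: contraTneq CD => ->; rewrite x_new orbF -lt0n.
have CN : C < N by case/orP: CD => [/eqP->|/D_lt//]; apply: leq_ltn_trans x_lt.
have labx k : live D k -> ar s0 aLab k != x.
  by move=> Lk; apply: contraTneq (inv_lb I0 Lk) => ->; rewrite x_new orbF -lt0n.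
have liveM k : live (mark D x) k = [|| live D k, k == k1 | split2 D x && (k == hi)].
  exact: (live_mark B_gt0 R_bound x_lt x_new).
(* With respect to the old marks, each node present after the cut behaves like some old node with
   the same label; so labels still represent the old classes before relabelling. *)
have ns1 k : live (mark D x) k -> exists k', [/\ live D k', ns D k k' & ar s1 aLab k = ar s0 aLab k'].
  rewrite liveM => /or3P[Lk|/eqP->|/andP[sp /eqP->]].
  - by exists k; split=> //; apply: lab1.
  - exists k0; split=> // d Dd; first by rewrite inn_k1 (inn_k0 B_gt0 R_bound R_laminar).
  - exists k0; split=> //; last exact: labhi.
    by move=> d Dd; rewrite (inn_hi B_gt0 R_bound R_laminar D_lt) // (inn_k0 B_gt0 R_bound R_laminar).
have cl1 k k' : live (mark D x) k -> live (mark D x) k' ->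
    (ar s1 aLab k = ar s1 aLab k' <-> ns D k k').
  move=> /ns1[i [Li Ni ->]] /ns1[i' [Li' Ni' ->]]; rewrite (inv_cl I0 Li Li').
  by split=> h d Dd; [rewrite Ni // Ni' // h | rewrite -Ni // -Ni' // h].
have lab1x k : live (mark D x) k -> ar s1 aLab k != x by move=> /ns1[i [Li _ ->]]; apply: labx.
have Lk1 : live (mark D x) k1 by rewrite liveM eqxx orbT.
have nsM k : k \in M -> ns D k k1.
  by rewrite memM => /andP[Lk /eqP e]; apply/cl1 => //; rewrite e labk1.
have insM k : k \in M -> inn x k = (k1 <= k < hi).
  move=> kM; apply: (cut_range B_gt0 R_bound D_lt x_lt x_new) (nsM _ kM).
  by move: kM; rewrite memM => /andP[].
pose inner := [seq y <- M2 | y < hi]; pose tail := [seq y <- k1 :: M2 | hi <= y].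
have k1hi : k1 < hi by rewrite /k1 /hi; clear -Hr; lia.
have unqM : uniq M by apply: sorted_uniq srt; [exact: ltn_trans | exact: ltnn].
have ME : M = (M1 ++ [:: k0]) ++ k1 :: M2 by rewrite /M -catA.
have [srtA srtB AB] : [/\ sorted ltn (M1 ++ [:: k0]), sorted ltn (k1 :: M2) &
    forall a b, a \in M1 ++ [:: k0] -> b \in k1 :: M2 -> a < b].
  move: (srt); rewrite ME (sorted_pairwise ltn_trans) pairwise_cat => /and3P[/allrelP h1 h2 h3].
  by rewrite !(sorted_pairwise ltn_trans) h2 h3; split.
have BE : k1 :: M2 = (k1 :: inner) ++ tail.
  rewrite {1}(sorted_split hi srtB) -/tail; congr (_ ++ _); by rewrite /= k1hi.
have geB b : b \in k1 :: M2 -> k1 <= b.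
  rewrite inE => /orP[/eqP->//|bM]; move: srtB => /= /(order_path_min ltn_trans)/allP/(_ _ bM);
    exact: ltnW.
(* The ring behind the segment of the new interval starts with [tail] and wraps around to end in
   [k0]; [outerS] lists the same nodes in increasing order. *)
pose outer := tail ++ (M1 ++ [:: k0]).
pose outerS := (M1 ++ [:: k0]) ++ tail.
have inM k : k \in k1 :: inner = (k \in M) && (k1 <= k < hi).
  have -> : k1 :: inner = [seq y <- k1 :: M2 | y < hi] by rewrite /= k1hi.
  rewrite mem_filter ME mem_cat; case kB: (k \in k1 :: M2); rewrite ?orbT ?orbF /=.
    by rewrite (geB _ kB) andbT.
  rewrite andbF; case kA: (k \in _) => //=; apply/esym/negbTE.
  by have := AB k k1 kA (mem_head _ _); clear; lia.
have outM k : k \in outerS = (k \in M) && ~~ (k1 <= k < hi).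
  rewrite ME !mem_cat mem_filter -mem_cat; case kA: (k \in M1 ++ [:: k0]) => /=.
    by have := AB k k1 kA (mem_head _ _); clear; lia.
  case kB: (k \in k1 :: M2); rewrite ?andbF //= andbT (geB _ kB) /=; clear; lia.
have outS k : (k \in outer) = (k \in outerS) by rewrite /outer /outerS !mem_cat orbC.
have rngT : ring (ar s1 aNx) (ar s1 aPv) ((k1 :: inner) ++ outer).
  by rewrite /outer catA -BE ring_catC -ME.
have unqT : uniq ((k1 :: inner) ++ outer) by rewrite /outer catA -BE uniq_catC -ME.
have liveMM k : k \in M -> live (mark D x) k by rewrite memM => /andP[].
have o0 : 0 < size outer by rewrite /outer !size_cat /=; clear; lia.
have mT k : k \in (k1 :: inner) ++ outer -> k \in M.
  by rewrite mem_cat outS inM outM -andb_orr => /andP[].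
have [|k kin|k ko|k kT|t2 [s2 [l2 X2 [fr2 ar2 io2 dis]]]] :=
  @walk_spec w q N W_ge s1 k0 k1 hi inner outer o0 rngT Hk Hk1 Hhi.
- by rewrite /outer catA last_cat.
- by move: kin; rewrite inM => /andP[].
- by move: ko; rewrite outS outM => /andP[].
- by apply: (@live_le N B R (mark D x)); apply: liveMM; apply: mT.
pose p1 := (size inner).+1; pose p2 := size outer; rewrite -/p1 -/p2 in l2 dis.
have srtI : sorted ltn (k1 :: inner).
  by move: srtB; rewrite BE (sorted_pairwise ltn_trans) pairwise_cat -(sorted_pairwise ltn_trans) => /and3P[].
have srtO : sorted ltn outerS.
  rewrite (sorted_pairwise ltn_trans) pairwise_cat -!(sorted_pairwise ltn_trans) srtA /=.
  apply/andP; split.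
    apply/allrelP => a b aA; rewrite mem_filter => /andP[_ bB]; exact: AB aA bB.
  by apply: sorted_filter => //; apply: ltn_trans.
have sza : size outerS = p2 by rewrite /outerS /p2 /outer !size_cat addnC.
(* Both outcomes of the walk in one form: [xs :: seg] is the side to relabel, [b] tells whether it
   is the inside, and [segS] and [restS] are the two sides in sorted order. *)
have [xs [seg [rest [segS [restS [b [F1 F2 F3 [F4 F4'] [F5 F5' F6 F6' F7]]]]]]]] :
  exists xs seg rest segS restS b,
  [/\ vr s2 vxs = xs /\ vr s2 vys = last xs seg,
      ring (ar s1 aNx) (ar s1 aPv) ((xs :: seg) ++ rest) /\ uniq ((xs :: seg) ++ rest),
      rest <> [::],
      (forall nx pv, ring nx pv (xs :: seg) = ring nx pv segS) /\
      (forall nx pv, ring nx pv rest = ring nx pv restS) &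
  [/\ sorted ltn segS /\ sorted ltn restS,
      (forall k, (k \in xs :: seg) = (k \in segS)) /\ (forall k, (k \in rest) = (k \in restS)),
      forall k, (k \in xs :: seg) = (k \in M) && ((k1 <= k < hi) == b),
      forall k, (k \in rest) = (k \in M) && ((k1 <= k < hi) != b) &
      (size seg).+1 <= minn p1 p2 /\ phi (size segS) + phi (size restS) = phi p1 + phi p2]].
  case: dis => [[le [h1 h2]]|[le [h1 h2]]].
    exists k1, inner, outer, (k1 :: inner), outerS, true.
    split=> //; first by case: (outer) o0.
      by split=> // nx pv; rewrite /outer ring_catC.
    split=> // [k|k|].
    - by rewrite inM eqb_id.
    - by rewrite outS outM; case: (k1 <= k < hi).
    - by rewrite sza /= (minn_idPl le).
  case oE: outer (o0) => [//|xs seg] _; exists xs, seg, (k1 :: inner), outerS, (k1 :: inner), false.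
  split=> //.
  - rewrite h1 h2 oE /=; split=> //.
    have -> : last xs seg = last 0 outer by rewrite oE.
    by rewrite /outer catA last_cat.
  - by rewrite -oE ring_catC uniq_catC.
  - by split=> // nx pv; rewrite -oE /outer ring_catC.
  - split=> // [|k|k|].
    + by split=> // k; rewrite -oE outS.
    + by rewrite -oE outS outM; case: (k1 <= k < hi).
    + by rewrite inM; case: (k1 <= k < hi).
    + by rewrite sza /= (minn_idPr le) addnC /p2 oE.
have segM k : k \in xs :: seg -> k \in M by rewrite F6 => /andP[].
have segU : uniq (xs :: seg) by case: F2 => _; rewrite cat_uniq => /and3P[].
case: rest F2 F3 F4' F5' F6' => [//|x2 rest] [rng2 unq2] _ F4' [F5a F5b] F6'.
have [pxs nys rngS rngR] := ring_cut rng2 unq2.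
have le2N k : k \in M -> k <= 2 * N + 1.
  by move=> /liveMM Lk; apply: (@live_le N B R (mark D x)).
have x2M : forall k, k \in x2 :: rest -> k \in M by move=> k; rewrite F6' => /andP[].
have [t3 [s3 [l3 X3 [fr3 af3 io3 [nx3 pv3]]]]] :
  wp relink_cmd s2 0 (fun s' =>
    [/\ frame [:: vt; vu] s2 s', aframe [:: aNx; aPv] s2 s', sameio s2 s' &
      ar s' aNx = cut_nx (ar s2 aNx) (ar s2 aPv) xs (last xs seg) /\
      ar s' aPv = cut_pv (ar s2 aNx) (ar s2 aPv) xs (last xs seg)]).
  apply: (relink_spec q W_ge) => //; try by case: F1.
  - by apply: le2N; apply: segM; rewrite mem_head.
  - by apply: le2N; apply: segM; rewrite mem_last.
  - by rewrite ar2 pxs; apply: le2N; apply: x2M; rewrite mem_last.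
  - by rewrite ar2 nys; apply: le2N; apply: x2M; rewrite mem_head.
have {l3} ? : t3 = 0 by case: t3 l3 {X3}. subst t3.
rewrite ar2 in nx3 pv3; rewrite -nx3 -pv3 in rngS rngR.
have af13 : aframe [:: aNx; aPv] s1 s3 by move=> i ni; rewrite af3 // ar2.
have fr13 : frame ([:: va; vz; vxs; vys] ++ [:: vt; vu]) s1 s3 := frame_trans fr2 fr3.
have st1 : statics s1.
  by case: (inv_st I0) => *; split; rewrite ?af1 // fr1.
have st3 : statics s3.
  by case: st1 => *; split; rewrite ?af13 // fr13.
have mk3 : masks (mark D x) wt s3 by case: mk1 => *; split; rewrite ?af13.
have FM y : y <= N -> live (mark D x) (F (mark D x) y) by apply: F_live.
have labF y : y <= N -> ar s1 aLab (F (mark D x) y) = ar s0 aLab (F D y).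
  move=> ly; rewrite (F_mark B_gt0 R_bound R_laminar D_lt x_lt x_new ly) -/k0 -/k1 -/hi.
  case: ifP => [/andP[/eqP-> _]|_]; first by rewrite labk1.
  case: ifP => [/and3P[sp /eqP-> _]|_]; last by rewrite lab1 //; apply: F_live.
  by rewrite labhi //; have := j_in B_gt0 R_bound R_laminar I0 x_lt x_new sp;
    rewrite lm0 => /andP[_ /eqP].
have FinM y : y <= N -> (F (mark D x) y \in M) = (ar s0 aLab (F D y) == C).
  by move=> ly; rewrite memM FM //= labF.
have cs1 : ar s1 aCs = ar s0 aCs by rewrite af1.
have csC : ar s0 aCs C = \sum_(0 <= y < N | F (mark D x) y \in M) wt y.
  rewrite (inv_sm I0) //; rewrite big_nat_cond [RHS]big_nat_cond; apply: eq_bigl => y.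
  case: (y < N) / ltnP => ly; rewrite ?andbF //= FinM //; exact: ltnW.
pose S := \sum_(k <- xs :: seg) nodesum (mark D x) wt k.
have SE : S = \sum_(0 <= y < N | F (mark D x) y \in xs :: seg) wt y by apply: sum_nodesum.
have csS : ar s0 aCs C = S + \sum_(0 <= y < N | (F (mark D x) y \in M) && (F (mark D x) y \notin xs :: seg)) wt y.
  rewrite csC (bigID (fun y => F (mark D x) y \in xs :: seg)) /= SE; congr (_ + _).
  by apply: eq_bigl => y; rewrite andbC; case: (boolP (_ \in xs :: seg)) => // /segM ->.
have liveS : all (live (mark D x)) (xs :: seg) by apply/allP => k /segM/liveMM.
have [t4 [s4 [l4 X4 [fr4 af4 io4 lab4 cs4]]]] :
  wp relabel_cmd s3 (size seg).+1 (fun s' =>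
    [/\ frame [:: vS; vy; vf; vt] s3 s', aframe [:: aLab; aCs] s3 s', sameio s3 s',
      (forall k, ar s' aLab k = if k \in xs :: seg then x else ar s3 aLab k) &
      ar s' aCs = upd (upd (ar s3 aCs) x S) C (ar s3 aCs C - S)]).
  apply: (relabel_spec q W_ge B_gt0 B_le (D := mark D x)) => //.
  - exact: (inv_wt I0).
  - by rewrite fr13 // fr1.
  - by rewrite fr13.
  - by rewrite fr3 //; case: F1.
  - by rewrite fr3 //; case: F1.
  - by rewrite af13 // cs1 csS; apply: leq_addr.
(* The larger side keeps the label [C]. *)
pose L' c := if c == C then restS else if c == x then segS else L c.
exists (minn p1 p2 + (size seg).+1), L'; split.
  have Lx : L x = [::].
    by case E: (L x) => [//|k t]; have := lm0 x k; rewrite E mem_head => /esym/andP[Lk /eqP e];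
      have := labx k Lk; rewrite e eqxx.
  have := @Pot_split L C x restS segS CN x_lt Cx Lx; rewrite -/L' => PL.
  have szMp : size M = p1 + p2.
    by rewrite ME BE /p1 /p2 /outer !size_cat /=; clear; lia.
  have two (u : seq nat) a a' : a != a' -> a \in u -> a' \in u -> 1 < size u.
    case: u => [//|b1 [|b2 u]] //; rewrite !inE => ne /eqP e1 /eqP e2; by rewrite e1 e2 eqxx in ne.
  (* When two pieces were added, both sides have at least two: [k1] and [pre2] inside, [k0] and [hi]
     outside. *)
  have ph : minn p1 p2 + (phi p1 + phi p2) <= phi (size (L C)) + 2.
    apply: phi_split => //; move: szM; rewrite szMp => /orP[->//|/andP[sp /eqP e]].
    apply/orP; right; rewrite e leqnn andbT; apply/andP; split.
      have jj : pre2 D x \in k1 :: inner.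
        have jM : pre2 D x \in M.
          rewrite memM liveM (pre2_live B_gt0 R_bound) //= lab1 ?(pre2_live B_gt0 R_bound) //.
          by have := j_in B_gt0 R_bound R_laminar I0 x_lt x_new sp; rewrite lm0 => /andP[].
        by rewrite inM jM -insM // (inn_x_pre2 B_gt0 R_bound).
      apply: (two _ _ _ _ (mem_head k1 inner) jj); apply/negbT; exact: odd_even.
    rewrite -sza; apply: (two _ k0 hi).
    - by apply/eqP => e'; have := hi_new N sp; rewrite -/hi -e' Lk0.
    - by rewrite /outerS !mem_cat mem_head orbT.
    - rewrite outM memM liveM sp eqxx !orbT /= labhi // eqxx /=; clear; lia.
  by case: F7 => szs phs; clear -PL ph szs phs; lia.
have lab34 k : ar s4 aLab k = if k \in xs :: seg then x else ar s1 aLab k.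
  by rewrite lab4 af13.
have xseg k : live (mark D x) k -> (ar s4 aLab k == x) = (k \in xs :: seg).
  by move=> Lk; rewrite lab34; case: ifP => _; rewrite ?eqxx // (negbTE (lab1x _ Lk)).
have nx4 : ar s4 aNx = ar s3 aNx by rewrite af4.
have pv4 : ar s4 aPv = ar s3 aPv by rewrite af4.
have xC : (x == C) = false by rewrite eq_sym (negbTE Cx).
have ls4 : lists (mark D x) L' s4.
  split.
  - move=> c k; rewrite /L'; case: (c =P C) => [->|/eqP nC].
      rewrite -F5b F6' memM lab34 F6 memM.
      by case Lk: (live _ k) => //=; case e: (ar s1 aLab k == C) => //=; case: (_ == b) => //=;
        rewrite ?xC ?e.
    case: (c =P x) => [->|/eqP nx].
      rewrite -F5a F6; case Lk: (live (mark D x) k); last by rewrite memM Lk.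
      by rewrite xseg // F6.
    rewrite lm0; case Lk: (live (mark D x) k) => /=; last first.
      by apply/negbTE; apply: contraFN Lk => /andP[Lk _]; rewrite liveM Lk.
    rewrite lab34; case: ifP => [|ns].
      rewrite F6 memM => /andP[/andP[_ /eqP e] _].
      rewrite [x == c]eq_sym (negbTE nx); apply/negbTE/negP => /andP[Lk0' /eqP e'].
      by rewrite lab1 // e' in e; rewrite e eqxx in nC.
    have Cc : (C == c) = false by rewrite eq_sym (negbTE nC).
    move: Lk; rewrite liveM => /or3P[Lk|/eqP->|/andP[sp /eqP->]].
    + by rewrite Lk lab1.
    + by rewrite labk1 (k1_new N B R x_new) Cc.
    + by rewrite labhi // (hi_new N sp) Cc.
  - by move=> c; rewrite /L'; case: F5 => ? ?; do 2!case: ifP => // _.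
  - move=> c; rewrite /L' nx4 pv4; case: (c =P C) => [_|/eqP nC]; first by rewrite -F4'.
    case: (c =P x) => [_|/eqP nx]; first by rewrite -F4.
    rewrite nx3 pv3; apply: etrans (rngc c nC).
    have dj k : k \in L c -> k \notin M.
      move=> kc; rewrite memM; apply/negP => /andP[_ /eqP e].
      by move: kc; rewrite lm0 => /andP[Lk /eqP e']; rewrite lab1 // e' in e; rewrite e eqxx in nC.
    have xsM : xs \in M by apply: segM; rewrite mem_head.
    have ysM : last xs seg \in M by apply: segM; rewrite mem_last.
    have pM : ar s1 aPv xs \in M by rewrite pxs; apply: x2M; rewrite mem_last.
    have nM : ar s1 aNx (last xs seg) \in M by rewrite nys; apply: x2M; rewrite mem_head.
    apply: eq_ring => k kc; have kM := dj k kc; rewrite /cut_nx /cut_pv /upd.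
      by do 2![case: eqP => [e|_]; first by rewrite e ?ysM ?pM in kM].
    by do 2![case: eqP => [e|_]; first by rewrite e ?xsM ?nM in kM].
have cl4 : classes (mark D x) s4.
  move=> k k' Lk Lk'.
  have sg i : live (mark D x) i -> (i \in xs :: seg) = (ar s1 aLab i == C) && (inn x i == b).
    move=> Li; rewrite F6; case iM: (i \in M); last by move: iM; rewrite memM Li /= => ->.
    by move: (iM); rewrite memM => /andP[_ ->] /=; rewrite insM.
  have nsE : ns (mark D x) k k' <-> ns D k k' /\ inn x k = inn x k'.
    split=> [h|[h1 h2] d /orP[|/eqP->//]]; last exact: h1.
    by split=> [d Dd|]; apply: h; rewrite /mark ?Dd ?eqxx ?orbT.
  rewrite nsE -(cl1 _ _ Lk Lk') !lab34; split.
    case: ifP => ks; case: ifP => ks'.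
    - move: ks ks'; rewrite !sg // => /andP[/eqP-> /eqP->] /andP[/eqP-> /eqP->] _; by [].
    - by move=> e; have := lab1x _ Lk'; rewrite -e eqxx.
    - by move=> e; have := lab1x _ Lk; rewrite e eqxx.
    move=> e; split=> //; move: ks ks'; rewrite !sg // -e.
    case: (ar s1 aLab k =P C) => [_|nC _ _] /=; first by case: (inn x k); case: (inn x k');
      case: (b).
    (* Outside the class [C] the new interval contains all nodes of a class or none, by
       [separated]. *)
    have h i i' : live (mark D x) i -> live (mark D x) i' -> ar s1 aLab i = ar s1 aLab i' ->
        ar s1 aLab i <> C -> inn x i -> inn x i'.
      move=> Li Li' ee nCi ii; apply/negPn/negP => ii'.
      have /(cl1 _ _ Li Li') nn := ee.
      have /(cl1 _ _ Li Lk1) := separated B_gt0 R_bound R_laminar D_lt x_lt x_new nn ii ii'.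
      by rewrite labk1 => /nCi.
    apply/idP/idP; first exact: h.
    by apply: h => //; rewrite -e.
  move=> [e ie]; have -> : (k \in xs :: seg) = (k' \in xs :: seg) by rewrite !sg // e ie.
  by case: ifP.
apply: (wp_mono (T := 0 + (t2 + (0 + t4))) (Q := fun s => s = s4)).
- apply: wp_exec X1 _; apply: wp_exec X2 _; apply: wp_exec X3 _.
  by exists t4, s4; split.
- by clear -l2 l4; lia.
move=> _ ->; split.
- split=> //.
  + by move=> d /orP[/(inv_D I0)//|/eqP->]; rewrite x_gt0.
  + exact: (inv_wt I0).
  + by case: st3 => *; split; rewrite ?af4 // fr4.
  + by case: mk3 => *; split; rewrite ?af4.
  + move=> k Lk; rewrite lab34; case: ifP => _; first by rewrite /mark eqxx !orbT.
    have [i [Li _ ->]] := ns1 k Lk; case/orP: (inv_lb I0 Li) => [->//|Di].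
    by rewrite /mark Di orbT.
  + move=> c Dc; rewrite cs4 /upd af13 // cs1.
    have bb (Pr Pr' : nat -> bool) : (forall y, y < N -> Pr y = Pr' y) ->
        \sum_(0 <= y < N | Pr y) wt y = \sum_(0 <= y < N | Pr' y) wt y.
      move=> h; rewrite big_nat_cond [RHS]big_nat_cond; apply: eq_bigl => y.
      by case: (ltnP y N) => ly; rewrite ?andbF //= h.
    case: (c =P C) => [->|/eqP nC].
      rewrite csS addKn; apply: bb => y ly; have Ly := FM y (ltnW ly).
      rewrite lab34 memM Ly /=; case: ifP => /= _; last by rewrite andbT.
      by rewrite andbF eq_sym (negbTE Cx).
    case: (c =P x) => [->|/eqP nx].
      by rewrite SE; apply: bb => y ly; rewrite xseg // FM // ltnW.
    have Dc' : (c == 0) || D c by move: Dc; rewrite /mark (negbTE nx) orbF.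
    rewrite (inv_sm I0 Dc'); apply: bb => y ly; rewrite -labF ?(ltnW ly) // lab34.
    case: ifP => // /segM; rewrite memM => /andP[_ /eqP->].
    by rewrite eq_sym (negbTE nC) eq_sym (negbTE nx).
- apply: frame_sub (frame_trans fr1 (frame_trans fr13 fr4)); by apply/allP.
- apply: aframe_sub (aframe_trans af1 (aframe_trans af13 af4)); by apply/allP.
- apply: sameio_trans io1 (sameio_trans io2 (sameio_trans io3 io4)).
Qed.

End CutUpdate.

(** * Queries and weight updates *)

Section UpdateQuery.

Variables (w : nat) (q : nat -> nat) (N B : nat) (R : nat -> nat).
Hypothesis W_ge : 1024 * (N + 2) <= 2 ^ w.
Hypothesis B_gt0 : 0 < B.
Hypothesis B_le : 2 ^ B <= N + 1.
Hypothesis R_bound : forall x, x < N -> x < R x <= N.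
Hypothesis R_laminar : forall x y, x < N -> x <= y < R x -> R y <= R x.

Local Notation base := (base B).
Local Notation off := (off B).
Local Notation wp := (wp w q).
Local Notation F := (F B R).
Local Notation live := (live N B R).
Local Notation Em := (Em B R).
Local Notation inn := (inn B R).
Local Notation ns := (ns B R).
Local Notation split2 := (split2 B R).
Local Notation pre2 := (pre2 B R).
Local Notation statics := (statics N B R).
Local Notation masks := (masks N B R).

Local Notation nodesum := (nodesum N B R).
Local Notation lists := (lists N B R).
Local Notation classes := (classes N B R).
Local Notation labels := (labels N B R).
Local Notation sums := (sums N B R).
Local Notation Inv := (Inv N B R).

Definition sameb (D : nat -> bool) (x y : nat) : bool :=
  all (fun d => D d ==> (ini R d x == ini R d y)) (iota 0 N).

Lemma samebP (D : nat -> bool) x y : (forall d, D d -> d < N) ->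
  reflect (forall d, D d -> ini R d x = ini R d y) (sameb D x y).
Proof.
move=> D_lt; apply: (iffP allP) => h d; last by move=> _; apply/implyP => /h->.
by move=> Dd; have := h d; rewrite mem_iota Dd (D_lt d Dd) => /(_ isT)/eqP.
Qed.

Lemma lab_same D wt L s x y : Inv D wt L s -> x <= N -> y <= N ->
  (ar s aLab (F D x) == ar s aLab (F D y)) = sameb D x y.
Proof.
move=> I lx ly; have D_lt d : D d -> d < N by move/(inv_D I) => /andP[].
have Fx := F_live R B_gt0 D lx; have Fy := F_live R B_gt0 D ly.
have M := F_match B_gt0 R_bound R_laminar D_lt.
apply/eqP/samebP => // [/(inv_cl I Fx Fy) h d Dd|h]; first by rewrite !M // h.
by apply/(inv_cl I Fx Fy) => d Dd; rewrite -!M // h.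
Qed.

Lemma Inv_frame D wt L s s' : ar s' = ar s -> vr s' vB = vr s vB -> Inv D wt L s -> Inv D wt L s'.
Proof.
move=> aE vE [h1 h2 [h3 h4 h5 h6 h7] [h8 h9 h10 h11] [h12 h13 h14] h15 h16 h17].
by split=> //; rewrite /statics /masks /lists /classes /labels /sums ?aE ?vE //; split;
  rewrite ?aE ?vE.
Qed.

Lemma lab_lt D wt L s x : Inv D wt L s -> x < N ->
  ((ar s aLab (F D x) == 0) || D (ar s aLab (F D x))) /\ ar s aLab (F D x) < N.
Proof.
move=> I lx; have H := inv_lb I (F_live R B_gt0 D (ltnW lx)); split=> //.
by case/orP: H => [/eqP->|/(inv_D I)/andP[]//]; apply: leq_ltn_trans lx.
Qed.

Definition query_vars : seq nat := [:: vb; vo; vm; vk; vc; vt].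

Lemma query_spec D wt L s x T : Inv D wt L s -> vr s vx = x -> x < N ->
  wp query_cmd s T (fun s' => [/\ Inv D wt L s', frame query_vars s s', ar s' = ar s &
    [/\ si s' = si s, sc s' = sc s &
     so s' = rcons (so s) (\sum_(0 <= y < N | sameb D y x) wt y)]]).
Proof.
move=> I Hx lx.
apply: wp_seq0; apply: wp_mono; [exact: (find_spec q W_ge B_gt0 B_le 0 (inv_st I) (inv_mk I) Hx lx) | by [] |].
move=> s1 [f1 a1 [i1 i2 i3] [_ _ k1]].
have Fl : F D x <= 2 * N + 1 by apply: (@live_le N B R D); apply: F_live (ltnW lx).
have [cD cN] := lab_lt I lx.
apply: wp_wr.
  by sx; rewrite k1 a1; do !split=> //; clear -Fl cN W_ge; lia.
split=> //.
- by apply: Inv_frame I => //=; rewrite f1.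
- by apply: frame_sub f1; apply/allP.
split=> //=; rewrite i3 k1 a1; congr rcons; rewrite (inv_sm I cD).
rewrite big_nat_cond [RHS]big_nat_cond; apply: eq_bigl => y.
by case: (ltnP y N) => ly; rewrite ?andbF //= (lab_same I) // ltnW.
Qed.

(** The old term is added on the left instead of being subtracted on the right, which avoids
    truncated subtraction. *)
Lemma sum_set_wt (P wt : nat -> bool) x v : x < N ->
  \sum_(0 <= y < N | P y) set_wt wt x v y + P x * wt x =
  \sum_(0 <= y < N | P y) wt y + P x * v.
Proof.
move=> lx; have H (f : nat -> bool) : \sum_(0 <= y < N | P y) f y =
    P x * f x + \sum_(i < N | i != Ordinal lx) P i * f i.
  rewrite big_mkcond big_mkord (bigD1 (Ordinal lx)) //=; congr (_ + _).
    by case: (P x); rewrite ?mul1n.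
  by apply: eq_bigr => i _; case: (P i); rewrite ?mul1n.
rewrite !H /set_wt eqxx.
set a := \sum_(i < N | _) _; set b := \sum_(i < N | _) _.
suff -> : a = b by lia.
by apply: eq_bigr => i /negbTE ni; rewrite -val_eqE /= in ni; rewrite ni.
Qed.

Lemma update_spec D wt L s x (v : bool) T : Inv D wt L s -> vr s vx = x -> x < N -> vr s vr2 = v ->
  wp update_cmd s T (fun s' => [/\ Inv D (set_wt wt x v) L s', frame query_vars s s',
    aframe [:: aCs; aWm] s s' & sameio s s']).
Proof.
move=> I Hx lx Hv.
apply: wp_seq0; apply: wp_mono; [exact: (find_spec q W_ge B_gt0 B_le 0 (inv_st I) (inv_mk I) Hx lx) | by [] |].
move=> s1 [f1 a1 io1 [b1 o1 k1]].
have Fl : F D x <= 2 * N + 1 by apply: (@live_le N B R D); apply: F_live (ltnW lx).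
have [cD cN] := lab_lt I lx; set c := ar s aLab (F D x) in cD cN.
have [mM mE mW mP] := inv_mk I.
have xB := base_mod B x; have lB : off x < B by apply: off_lt.
have bN : base x <= N by apply: leq_trans (base_le B x) (ltnW lx).
have bb := base_id B_gt0 x.
have W1 : ar s aWm (base x) = bits B (fun o => wt (base x + o)) by apply: mW.
have ep := expB B_le (ltnW lB).
have ad a : a <= 2 * N + 1 -> 32 * a + 96 <= 2 ^ w by clear -W_ge; lia.
have bN2 : base x <= 2 * N + 1 by clear -bN; lia.
have cN2 : c <= 2 * N + 1 by clear -cN; lia.
have oneW : 1 < 2 ^ w by clear -W_ge; lia.
have twoW : 2 < 2 ^ w by clear -W_ge; lia.
have epW : 2 ^ off x < 2 ^ w by clear -W_ge ep; lia.
apply: (asgS (v := c)); [by sx; rewrite k1; split=> //; apply: ad | by sx; rewrite k1 a1 |].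
apply: (asgS (v := wt x)).
- by sx; rewrite b1 o1 mul1n; do !split=> //; apply: ad.
- by sx; rewrite b1 o1 a1 mul1n W1 bits_bit // -xB.
have cE := inv_sm I cD; rewrite -/c in cE.
have csN : ar s aCs c <= N by rewrite cE; apply: sum_wt_le.
have sE := sum_set_wt (fun y => ar s aLab (F D y) == c) wt v lx.
have Px : (ar s aLab (F D x) == c) by [].
rewrite Px !mul1n -cE in sE.
have vr1 : vr s1 vr2 = v by rewrite f1.
apply: (stoS (a := c) (v := ar s aCs c + v - wt x)).
- by sx.
- sx; rewrite a1 vr1; do !split=> //; [exact: ad | by case: (v); clear -csN W_ge; lia|].
  by rewrite -sE; apply: leq_addl.
- by sx.
- by sx; rewrite a1 vr1.
- exact: ad.
have WE : bits B (fun o => wt (base x + o)) + v * 2 ^ off x =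
    bits B (fun o => set_wt wt x v (base x + o)) + wt x * 2 ^ off x.
  (* Both masks are compared with the common mask in which the bit of [x] is cleared. *)
  pose f0 o := wt (base x + o) && (o != off x).
  have A (u : bool) (g : nat -> bool) : (forall o, o < B -> g o = if o == off x then u else wt (base x + o)) ->
      bits B g = bits B f0 + u * 2 ^ off x.
    move=> hg; case: u hg => hg; rewrite ?mul1n ?mul0n ?addn0.
      rewrite (bits_set (h := g)) //; first by rewrite /f0 eqxx andbF.
      by move=> j lj; rewrite hg // /f0; case: (j == off x); rewrite ?orbT ?andbT ?orbF.
    by apply: eq_bits => j lj; rewrite hg // /f0; case: (j == off x); rewrite ?andbF ?andbT.
  rewrite (A (wt x)); last by move=> o _; case: eqP => // ->; rewrite -xB.
  rewrite (A v (fun o => set_wt wt x v (base x + o))); first by clear; lia.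
  move=> o _; rewrite /set_wt (_ : (base x + o == x) = (o == off x)) //.
  by rewrite -(eqn_add2l (base x) o) -xB.
have bW : bits B (fun o => wt (base x + o)) <= N.
  by have := bits_lt B (fun o => wt (base x + o)); clear -B_le; lia.
apply: (sto1 (a := base x) (v := bits B (fun o => set_wt wt x v (base x + o)))).
- by sx.
- sx; rewrite b1 o1 a1 vr1 W1 WE; do !split=> //; try exact: ad.
  + by case: (v); clear -epW; lia.
  + rewrite -WE; case: (v); clear -bW ep W_ge; lia.
  + by case: (wt x); clear -epW; lia.
  + exact: leq_addl.
- by sx.
- by sx; rewrite b1 o1 a1 vr1 W1 WE addnK.
- exact: ad.
have f1' : frame query_vars s s1 by apply: frame_sub f1; apply/allP.
split.
- have [j1 j2 [j3 j4 j5 j6 j7] j8 [j12 j13 j14] j15 j16 j17] := I.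
  split=> //.
  + by move=> y; rewrite /set_wt; case: eqP => [->|_ /j2].
  + by split=> //; sx; rewrite ?a1 ?f1.
  + split=> [b lb bb'|b lb bb'|b lb bb'|k Lk]; sx; rewrite ?a1.
    * exact: mM.
    * exact: mE.
    * case: eqP => [->//|ne]; rewrite mW //; apply: eq_bits => o lo.
      rewrite /set_wt (_ : b + o == x = false) //; apply/eqP => e.
      by apply: ne; rewrite -e -bb' base_add.
    * exact: mP.
  + by split=> //; sx; rewrite ?a1.
  + by move=> k k'; sx; rewrite a1; apply: j15.
  + by move=> k; sx; rewrite a1; apply: j16.
  + move=> c' Dc'; sx; rewrite a1 /=; case: (c' =P c) => [->|nc].
      by rewrite -sE addnK.
    have := sum_set_wt (fun y => ar s aLab (F D y) == c') wt v lx.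
    rewrite (_ : ar s aLab (F D x) == c' = false) ?mul0n ?addn0; last by apply/eqP => e; apply: nc.
    by rewrite (inv_sm I Dc') => ->.
- by move=> y ny; rewrite -f1' //; move: ny; rewrite !inE; sx; do !case: eqP.
- move=> i ni; rewrite -a1; move: ni; rewrite !inE; sx; do !case: eqP => //.
- by case: io1.
Qed.

End UpdateQuery.

(** * Initialization *)

(** The encoding gives [n] as the parent of a root, so the roots become children of the virtual root
    without a special case. Each vertex is pushed on the front of the child list of its parent. *)
Definition read_cmd : cmd :=
  Rd vr0;;
  vn <-- $vr0;;
  vN <-- ($vn + #1);;
  vi <-- #0;;
  While ($vi < $vn)%X
    (Rd vr0;;
     aPar.[=$vi] <-- $vr0;;
     aSib.[=$vi] <-- aFst.[|$vr0];;
     aFst.[=$vr0] <-- ($vi + #1);;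
     aW.[=$vi] <-- $vr1;;
     vi <-- ($vi + #1));;
  aPar.[=$vn] <-- $vN.

Definition dfs_cmd : cmd :=
  vt <-- #1;;
  va <-- $vn;;
  While ($va < $vN)%X
    (vb <-- aFst.[|$va];;
     If ($vb)%X
       (vb <-- ($vb - #1);;
        aFst.[=$va] <-- aSib.[|$vb];;
        aIn.[=$vb] <-- $vt;;
        aPp.[=$vt] <-- aIn.[|$va];;
        vt <-- ($vt + #1);;
        va <-- $vb)
       (aR.[=aIn.[|$va]] <-- $vt;;
        va <-- aPar.[|$va])).

Fixpoint chain (sib : nat -> nat) (h : nat) (l : seq nat) : bool :=
  if l is v :: l' then (h == v.+1) && chain sib (sib v) l' else h == 0.

Lemma chain_upd sib v y h l : v \notin l -> chain (upd sib v y) h l = chain sib h l.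
Proof.
elim: l h => //= u l IH h; rewrite inE negb_or => /andP[uv vl].
by rewrite IH // /upd (eq_sym u v) (negbTE uv).
Qed.

Section Init.

Variables (w : nat) (q : nat -> nat) (n : nat) (par : nat -> option nat) (wt : nat -> bool).
Hypothesis W_ge : 1024 * (n + 3) <= 2 ^ w.
Hypothesis Hf : forest n par.

Local Notation wp := (wp w q).
Local Notation N := n.+1.

(* Vertex n is a virtual root above all trees. *)
Definition up0 (v : nat) : nat := if v < n then odflt n (par v) else n.

Lemma up0_le v : up0 v <= n.
Proof.
rewrite /up0; case: ltnP => // lv; case E: (par v) => [u|] //=.
by case: Hf => h _; apply: ltnW; apply: h E.
Qed.

Definition s_init (ops : seq (nat * nat * nat)) : st :=
  St (fun _ => 0) (fun _ _ => 0)
     ((n, 0, 0) :: [seq (odflt n (par v), nat_of_bool (wt v), 0) | v <- iota 0 n] ++ ops) 0 [::].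

Definition read_post (ops : seq (nat * nat * nat)) (s : st) : Prop :=
  [/\ vr s vn = n, vr s vN = N,
      (forall v, v < n -> ar s aPar v = up0 v) /\ ar s aPar n = N,
      (forall v, v < n -> ar s aW v = wt v) &
  [/\ (forall i, i \notin [:: aPar; aSib; aFst; aW] -> ar s i = fun _ => 0),
      si s = ops, sc s = n.+1, so s = [::] &
      exists Ch : nat -> seq nat, forall p,
        [/\ chain (ar s aSib) (ar s aFst p) (Ch p), uniq (Ch p) &
            forall v, (v \in Ch p) = (v < n) && (up0 v == p)]]].

Lemma read_spec ops : (forall c, c <= n.+1 -> q c = 0) ->
  wp read_cmd (s_init ops) n (read_post ops).
Proof.
move=> q0.
have ad a : a <= n.+1 -> 32 * a + 96 <= 2 ^ w by clear -W_ge; lia.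
have oneW : 1 < 2 ^ w by clear -W_ge; lia.
have nW : n + 1 < 2 ^ w by clear -W_ge; lia.
apply: wp_seq0; apply: wp_rd; first by rewrite /= q0.
apply: (asgS (v := n)); [by [] | by [] |].
apply: (asgS (v := N)); [by sx | by sx; rewrite addn1 |].
apply: (asgS (v := 0)); [by sx; clear -oneW; lia | by [] |].
pose Iw (k : nat) (s : st) := exists i, [/\ i <= n, k = n - i,
  [/\ vr s vn = n, vr s vN = N & vr s vi = i],
  [/\ (forall v, v < i -> ar s aPar v = up0 v), (forall v, v < i -> ar s aW v = wt v) &
      (forall j, j \notin [:: aPar; aSib; aFst; aW] -> ar s j = fun _ => 0)] &
  [/\ si s = [seq (odflt n (par v), nat_of_bool (wt v), 0) | v <- iota i (n - i)] ++ ops,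
      sc s = i.+1, so s = [::] &
      exists Ch : nat -> seq nat, forall p,
        [/\ chain (ar s aSib) (ar s aFst p) (Ch p), uniq (Ch p) &
            forall v, (v \in Ch p) = (v < i) && (up0 v == p)]]].
rewrite -[X in wp _ _ X _]addn0; apply: wp_seq.
apply: (wp_mono (T := n) (Q := fun s => Iw 0 s)) => //.
  apply: (wp_while (Inv := Iw)).
    move=> k s [i [li kE [Hn HN Hi] [hP hW h0] [hsi hsc hso [Ch hC]]]]; split.
    - by sx.
    - sx; rewrite Hi Hn; case: ltnP => // lni _.
      have e : i = n by apply/eqP; rewrite eqn_leq li.
      exists i; split=> //; first by rewrite e subnn.
      by split=> //; exists Ch.
    sx; rewrite Hi Hn; case: ltnP => // lni _; exists 0.
    have up : odflt n (par i) = up0 i by rewrite /up0 lni.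
    have upl := up0_le i.
    have hsi' : si s = (up0 i, nat_of_bool (wt i), 0) ::
        [seq (odflt n (par v), nat_of_bool (wt v), 0) | v <- iota i.+1 (n - i.+1)] ++ ops.
      by rewrite hsi -up -(subnSK lni).
    apply: wp_seq0; apply: wp_rd; first by rewrite hsc hso q0.
    rewrite /rdst hsi' /= hsc hso.
    set s1 := St _ _ _ _ _.
    have v1 : vr s1 vr0 = up0 i by [].
    have v2 : vr s1 vr1 = wt i by [].
    have v3 : vr s1 vi = i by sx.
    have v4 : vr s1 vn = n by sx.
    have v5 : vr s1 vN = N by sx.
    have a1 : ar s1 = ar s by [].
    have i1 : si s1 = [seq (odflt n (par v), nat_of_bool (wt v), 0) | v <- iota i.+1 (n - i.+1)] ++ ops by [].
    have i2 : sc s1 = i.+2 by [].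
    have i3 : so s1 = [::] by [].
    move: s1 v1 v2 v3 v4 v5 a1 i1 i2 i3 => s1 v1 v2 v3 v4 v5 a1 i1 i2 i3.
    have lin : i <= n.+1 by clear -lni; lia.
    have upn : up0 i <= n.+1 by clear -upl; lia.
    apply: (stoS (a := i) (v := up0 i)); [by sx | by sx | by sx | by sx | exact: ad |].
    apply: (stoS (a := i) (v := ar s aFst (up0 i))).
      by sx. by sx; rewrite v1; split=> //; apply: ad. by sx. by sx; rewrite v1 a1. exact: ad.
    apply: (stoS (a := up0 i) (v := i.+1)).
      by sx. by sx; rewrite v3; split=> //; clear -lni nW; lia. by sx. by sx;
        rewrite v3 addn1. exact: ad.
    apply: (stoS (a := i) (v := wt i)); [by sx | by sx | by sx | by sx | exact: ad |].
    apply: (asg1 (v := i.+1)).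
      by sx; rewrite v3; split=> //; clear -lni nW; lia. by sx; rewrite v3 addn1.
    exists (n - i.+1); split; first by rewrite kE; clear -lni; lia.
    exists i.+1; split=> //.
    - split.
      + move=> v; sx; rewrite a1; case: eqP => [->//|ne lv]; apply: hP; clear -ne lv; lia.
      + move=> v; sx; rewrite a1; case: eqP => [->//|ne lv]; apply: hW; clear -ne lv; lia.
      + move=> j nj; rewrite -(h0 j nj); move: nj; rewrite !inE !negb_or; sx.
        by move=> /and4P[/negbTE-> /negbTE-> /negbTE-> /negbTE->]; rewrite a1.
    split=> //.
    exists (fun p => if p == up0 i then i :: Ch p else Ch p) => p.
    have [c1 c2 c3] := hC p.
    have iC : i \notin Ch p by rewrite c3 ltnn.
    have cu : chain (upd (ar s aSib) i (ar s aFst (up0 i))) (ar s aFst p) (Ch p).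
      by rewrite chain_upd.
    sx; rewrite a1; case: (p =P up0 i) => [e|ne].
      split.
      + rewrite /= eqxx /= -e; move: cu; rewrite /upd eqxx -e; exact.
      + by rewrite /= iC.
      + move=> v; rewrite inE c3; case: (v =P i) => [->|nv] /=; first by rewrite ltnSn e eqxx.
        by rewrite (_ : (v < i) = (v < i.+1)) //; clear -nv; apply/idP/idP; lia.
    split=> // v; rewrite c3.
    case: (v =P i) => [->|nv]; first by rewrite ltnn ltnSn /=; apply/esym/negbTE/eqP => e;
      apply: ne.
    by rewrite (_ : (v < i) = (v < i.+1)) //; clear -nv; apply/idP/idP; lia.
  exists 0; split=> //.
  - by rewrite subn0.
  - by split=> //; [rewrite subn0 | exists (fun _ => [::])].
move=> s [i [li /esym/eqP kE [Hn HN Hi] [hP hW h0] [hsi hsc hso hC]]].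
have e : i = n by apply/eqP; rewrite eqn_leq li -subn_eq0.
rewrite {}e in Hi hP hW hsi hsc hC.
apply: (sto1 (a := n) (v := N)); [by sx | by sx | by sx | by sx | exact: ad |].
split=> //.
- split=> [v lv|]; sx; last by rewrite eqxx.
  by rewrite ltn_eqF //; apply: hP.
- split=> //.
  + move=> j nj; rewrite -(h0 j nj); move: nj; rewrite !inE !negb_or; sx.
    by move=> /and4P[/negbTE->].
  + by rewrite hsi subnn.
Qed.

(** * Ancestors and the preorder traversal *)

Definition isanc (u v : nat) : Prop := exists k, iter k up0 v = u.

Lemma isanc_refl u : isanc u u. Proof. by exists 0. Qed.

Lemma isanc_trans u v x : isanc u v -> isanc v x -> isanc u x.
Proof. by move=> [k <-] [k' <-]; exists (k + k'); rewrite iterD. Qed.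

Lemma isanc_up u v : isanc u v <-> u = v \/ isanc u (up0 v).
Proof.
split=> [[[|k] <-]|[->|[k <-]]]; [by left | right | exact: isanc_refl | ].
  by exists k; rewrite iterSr.
by exists k.+1; rewrite iterSr.
Qed.

Lemma up0_root : up0 n = n. Proof. by rewrite /up0 ltnn. Qed.

Lemma isanc_root u : isanc u n -> u = n.
Proof. by move=> [k <-]; elim: k => //= k ->; rewrite up0_root. Qed.

Lemma reach_root v : v <= n -> isanc n v.
Proof.
rewrite leq_eqVlt => /orP[/eqP->|lv]; first exact: isanc_refl.
case: Hf => hu /(_ v lv) [k]; elim: k v lv => [|k IH] v lv h.
  by exists 1; rewrite /= /up0 lv; rewrite /anc /= in h; rewrite h.
case E: (par v) => [u|]; last by exists 1; rewrite /= /up0 lv E.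
have lu := hu v u lv E; apply/isanc_up; right.
have -> : up0 v = u by rewrite /up0 lv E.
by apply: IH => //; move: h; rewrite /anc iterSr {2}/up E.
Qed.

(** A ghost stack: the path from the current vertex to the virtual root, whose entries are exactly
    the ancestors of the current vertex. *)
Fixpoint stkok (stk : seq nat) : Prop :=
  if stk is v :: stk' then
    if stk' is u :: _ then [/\ v < n, up0 v = u & stkok stk'] else v = n
  else True.

Lemma stkok_isanc v stk u : stkok (v :: stk) -> isanc u v <-> u \in v :: stk.
Proof.
elim: stk v => [|x stk IH] v.
  by move=> /= ->; rewrite inE; split=> [/isanc_root->//|/eqP->]; exact: isanc_refl.
move=> [lv e ok]; rewrite isanc_up e inE; have := IH x ok.
by split=> [[->|/H->]|/orP[/eqP->|/H]]; rewrite ?eqxx ?orbT //; [left | right].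
Qed.

Definition dfs_post (s0 s : st) : Prop := exists ord : seq nat,
  [/\ [/\ uniq ord, size ord = N, forall v, (v \in ord) = (v <= n) & nth 0 ord 0 = n],
      [/\ forall v, v <= n -> ar s aIn v = index v ord,
          ar s aPp 0 = 0 /\ (forall k, 0 < k < N -> ar s aPp k = index (up0 (nth 0 ord k)) ord) &
          forall v, v < n -> index (up0 v) ord < index v ord],
      (forall u v, u <= n -> v <= n ->
         (isanc u v <-> index u ord <= index v ord < ar s aR (index u ord))),
      (forall u, u <= n -> ar s aR (index u ord) <= N) &
      [/\ aframe [:: aFst; aIn; aPp; aR] s0 s, frame [:: va; vb; vt] s0 s & sameio s0 s]].

Lemma dfs_spec ops s0 : read_post ops s0 -> wp dfs_cmd s0 (2 * n + 1) (dfs_post s0).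
Proof.
move=> [Hn HN [hP hPn] hW [h0 hsi hsc hso [Ch0 hC0]]].
have ad a : a <= n.+1 -> 32 * a + 96 <= 2 ^ w by clear -W_ge; lia.
have oneW : 1 < 2 ^ w by clear -W_ge; lia.
have nW : n + 2 < 2 ^ w by clear -W_ge; lia.
apply: (asgS (v := 1)); [by sx | by sx |].
apply: (asgS (v := n)); [by sx | by sx |].
(* An unvisited vertex has credit 2, for entering and leaving it, and a vertex on the stack has 1.
   Intervals of vertices on the stack are still open and provisionally end at [size ord]. *)
pose Iw (k : nat) (s : st) := exists (ord stk : seq nat) (Ch : nat -> seq nat),
  [/\ [/\ uniq ord, (forall v, v \in ord -> v <= n), nth 0 ord 0 = n /\ n \in ord,
          k = 2 * (N - size ord) + size stk & stkok stk /\ {subset stk <= ord}],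
      [/\ forall v, v \in ord -> ar s aIn v = index v ord,
          ar s aPp 0 = 0 /\ (forall k, 0 < k < size ord -> ar s aPp k = index (up0 (nth 0 ord k)) ord),
          forall v, v \in ord -> v != n -> up0 v \in ord /\ index (up0 v) ord < index v ord &
          vr s vt = size ord /\ vr s va = head N stk],
      [/\ forall p, chain (ar s aSib) (ar s aFst p) (Ch p) /\ uniq (Ch p),
          forall p v, v \in Ch p -> [/\ v < n, up0 v = p & v \notin ord],
          forall v, v < n -> v \in ord \/ v \in Ch (up0 v) &
          forall v, v \in ord -> v \notin stk -> Ch v = [::]],
      [/\ forall u v, u \in ord -> v \in ord -> (isanc u v <->
            index u ord <= index v ord < (if u \in stk then size ord else ar s aR (index u ord))) &
          forall u, u \in ord -> u \notin stk -> ar s aR (index u ord) <= size ord] &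
      [/\ aframe [:: aFst; aIn; aPp; aR] s0 s, frame [:: va; vb; vt] s0 s & sameio s0 s]].
have szo (ord : seq nat) : uniq ord -> (forall v, v \in ord -> v <= n) -> size ord <= N.
  move=> uo ho; have := @uniq_leq_size _ ord (iota 0 N) uo; rewrite size_iota; apply.
  by move=> v /ho; rewrite mem_iota /= add0n ltnS.
apply: (wp_while (Inv := Iw)).
  move=> k s [ord [stk [Ch [[uo on [o0 no] kE [sok sub]] [hI [hp0 hp] hup [ht ha]] [c1 c2 c3 c4] [i1 i2] [af fr io]]]]].
  have vnE : vr s vN = N by rewrite fr.
  have szo' := szo _ uo on.
  split; first by sx.
  - sx; rewrite ha vnE; case: stk ha kE sok sub c4 i1 i2 => [|v stk] /= ha kE sok sub c4 i1 i2.
      move=> _.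
      (* Induction on the distance to the root: the parent of [v] has been visited, and with an
         empty stack its child list is used up. *)
      have all_in v : v <= n -> v \in ord.
        move=> lv; have [m] := reach_root lv; elim: m v lv => [|m IH] v lv; first by move=> /= ->.
        rewrite iterSr => h; have ou := IH _ (up0_le v) h.
        move: lv; rewrite leq_eqVlt => /orP[/eqP->//|lv].
        by case: (c3 v lv) => //; rewrite c4.
      have so : size ord = N.
        apply/eqP; rewrite eqn_leq szo' /=.
        have := @uniq_leq_size _ (iota 0 N) ord (iota_uniq _ _); rewrite size_iota; apply=> v.
        by rewrite mem_iota add0n /= ltnS => /all_in.
      have memo v : (v \in ord) = (v <= n) by apply/idP/idP; [exact: on | exact: all_in].
      exists ord; split=> //.
      + split=> [v lv||v lv].
        * by apply: hI; apply: all_in.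
        * by split=> // k' lk; apply: hp; rewrite so.
        * by have [||_ ] := hup v; rewrite ?memo ?(ltnW lv) // ltn_eqF.
      + by move=> u v lu lv; apply: i1; apply: all_in.
      + by move=> u lu; rewrite -so; apply: i2 => //; apply: all_in.
    have : v <= n by apply: on; apply: sub; rewrite mem_head.
    by rewrite ltnS => ->.
  sx; rewrite ha vnE; case: stk ha kE sok sub c4 i1 i2 => [|cur stk] /=; first by rewrite ltnn.
  move=> ha kE sok sub c4 i1 i2 _; exists 0.
  have co : cur \in ord by apply: sub; rewrite mem_head.
  have cn := on _ co; have cn1 : cur <= n.+1 by apply: leqW.
  have [cc cu] := c1 cur.
  apply: (asgS (v := ar s aFst cur)); [by sx; rewrite ha; split=> //; apply: ad | by sx;
    rewrite ha |].
  have icur : index cur ord < size ord by rewrite index_mem.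
  have icn : index cur ord <= n.+1 by apply: leq_trans szo'; apply: ltnW.
  case E: (Ch cur) cc => [|c l].
    move=> /= /eqP F0; apply: wp_if; sx; [by [] | by rewrite F0 |] => _.
    apply: (stoS (a := index cur ord) (v := size ord)).
    + by sx; rewrite ha; split=> //; apply: ad.
    + by sx.
    + by sx; rewrite ha hI.
    + by sx.
    + exact: ad.
    apply: (asg1 (v := head N stk)).
    + by sx; rewrite ha; split=> //; apply: ad.
    + sx; rewrite ha af //; move: sok; case: (stk) => [/= ->//|u stk'] /= [lc <- _]; exact: hP.
    exists (2 * (N - size ord) + size stk); split; first by rewrite kE; clear; lia.
    (* A second occurrence of [cur] would make it an ancestor of its own parent, which has a smaller
       position. *)
    have curstk : cur \notin stk.
      apply/negP => cs; case: stk sok cs i1 {kE sub c4 i2} => // u stk [lc e ok] cs i1.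
      have an := proj2 (stkok_isanc cur ok) cs.
      have [ou lt] := hup cur co (negbT (ltn_eqF lc)).
      have uord : u \in ord by rewrite -e.
      have [h _] := i1 cur u co uord.
      by have := h an; rewrite -e; clear -lt; lia.
    have icur_ne v : v \in ord -> v != cur -> (index v ord == index cur ord) = false.
      move=> vo ne; apply/negbTE; apply: contra ne => /eqP e.
      by rewrite -(nth_index 0 vo) e nth_index.
    exists ord, stk, Ch; split=> //.
    + split=> //; split; last by move=> v vs; apply: sub; rewrite inE vs orbT.
      by move: sok; case: (stk) => // u stk' [].
    + split=> //.
      move=> v vo; case: (v =P cur) => [->//|/eqP ne] vs; apply: c4 => //.
      by rewrite inE negb_or ne.
    + split.
      * move=> u v uu vo; rewrite (i1 u v uu vo) inE; sx.
        case: (u =P cur) => [->|/eqP ne] /=; first by rewrite (negbTE curstk) eqxx.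
        by rewrite icur_ne.
      * move=> u uu us; sx; case: (u =P cur) => [->|/eqP ne]; first by rewrite eqxx.
        by rewrite icur_ne //; apply: i2 => //; rewrite inE negb_or ne.
    + split=> //.
      * move=> i ni; rewrite -(af i ni); move: ni; rewrite !inE !negb_or; sx.
        by case/and4P => _ _ _ /negbTE->.
      * by move=> y ny; rewrite -(fr y ny); move: ny; rewrite !inE; sx; do !case: eqP.
  case/andP => /eqP Fc cl.
  have cIn : c \in Ch cur by rewrite E mem_head.
  have [lcn upc cno] := c2 cur c cIn.
  have cn1' : c <= n.+1 by clear -lcn; lia.
  have szlt : size ord < N.
    rewrite -(size_iota 0 N); apply: (@uniq_leq_size _ (c :: ord)); first by rewrite /= uo cno.
    by move=> v; rewrite inE mem_iota add0n ltnS => /orP[/eqP->|/on//]; apply: ltnW.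
  have szn : size ord <= n.+1 by apply: ltnW.
  apply: wp_if; sx; [by [] | | by rewrite Fc] => _.
  apply: (asgS (v := c)); [by sx; rewrite Fc; split=> //; clear; lia | by sx; rewrite Fc subn1 |].
  apply: (stoS (a := cur) (v := ar s aSib c)).
    by sx. by sx; split=> //; apply: ad. by sx. by sx. exact: ad.
  apply: (stoS (a := c) (v := size ord)); [by sx | by sx | by sx | by sx | exact: ad |].
  have ccur : (cur == c) = false by apply/negbTE; apply: contraNneq cno => <-.
  apply: (stoS (a := size ord) (v := index cur ord)).
    by sx. by sx; rewrite ha; split=> //; apply: ad. by sx. by sx; rewrite ha ccur hI. exact: ad.
  apply: (asgS (v := (size ord).+1)).
    by sx; rewrite ht; split=> //; clear -szlt nW; lia. by sx; rewrite ht addn1.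
  apply: (asg1 (v := c)); [by sx | by sx |].
  exists (2 * (N - (size ord).+1) + (size stk).+2); split; first by rewrite kE; clear -szlt; lia.
  have idx v : v \in ord -> index v (rcons ord c) = index v ord.
    by move=> vo; rewrite -cats1 index_cat vo.
  have idc : index c (rcons ord c) = size ord.
    by rewrite -cats1 index_cat (negbTE cno) /= eqxx addn0.
  have memr v : (v \in rcons ord c) = (v == c) || (v \in ord) by rewrite mem_rcons inE.
  have ilt v : v \in ord -> index v ord < size ord by rewrite index_mem.
  have nth_r k' : k' < size ord -> nth 0 (rcons ord c) k' = nth 0 ord k'.
    by move=> lk; rewrite nth_rcons lk.
  have anc_ord u v : v \in ord -> isanc u v -> u \in ord.
    move=> vo [m <-]; elim: m => //= m IH; case: (iter m up0 v =P n) => [->|/eqP ne].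
      by rewrite up0_root.
    by have [] := hup _ IH ne.
  have o_gt0 : 0 < size ord by case: (ord) no.
  exists (rcons ord c), (c :: cur :: stk), (fun p => if p == cur then l else Ch p); split.
  - split.
    + by rewrite rcons_uniq cno.
    + by move=> v; rewrite memr => /orP[/eqP->|/on//]; apply: ltnW.
    + by rewrite nth_r // memr no orbT.
    + by rewrite size_rcons.
    + split=> // v; rewrite inE memr => /orP[->//|/sub->]; by rewrite orbT.
  - split.
    + move=> v; rewrite memr; sx; case: (v =P c) => [->|ne] vo; first by rewrite idc.
      by rewrite idx // hI.
    + split; first by sx; rewrite (ltn_eqF o_gt0).
      move=> k' lk; sx; rewrite size_rcons in lk; case: (k' =P size ord) => [->|ne].
        by rewrite nth_rcons ltnn eqxx upc idx.
      have lk' : 0 < k' < size ord by clear -lk ne; lia.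
      rewrite nth_r; last by case/andP: lk'.
      rewrite hp // idx //.
      have vo : nth 0 ord k' \in ord by apply: mem_nth; case/andP: lk'.
      have ne' : nth 0 ord k' != n.
        rewrite -o0 nth_uniq //; [by clear -lk'; lia | by case/andP: lk'].
      by have [] := hup _ vo ne'.
    + move=> v; rewrite !memr; case: (v =P c) => [-> _ _|ne /= vo vn].
        by rewrite upc co orbT idx // idc ilt.
      by have [h1 h2] := hup v vo vn; rewrite h1 orbT !idx.
    + by sx; rewrite size_rcons.
  - have ucl := cu; rewrite E /= in ucl; case/andP: ucl => cl_ ul.
    split.
    + move=> p; sx; by case: (p =P cur) => [_|ne]; [split | apply: c1].
    + move=> p v; rewrite memr negb_or.
      have h : v \in (if p == cur then l else Ch p) -> v \in Ch p /\ v != c.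
        case: (p =P cur) => [->|ne] vl.
          by rewrite E inE vl orbT; split=> //; apply: contraNneq cl_ => <-.
        split=> //; apply/eqP => e; rewrite e in vl; have [_ h _] := c2 _ _ vl.
        by apply: ne; rewrite -h upc.
      by move=> /h[vC ->]; have [h1 h2 h3] := c2 p v vC.
    + move=> v lv; rewrite memr; case: (v =P c) => [->|ne] /=; first by left.
      case: (c3 v lv) => [->|vC]; [by left | right].
      case: (up0 v =P cur) => [e|//]; by move: vC; rewrite e E inE => /orP[/eqP|].
    + move=> v; rewrite memr inE negb_or => /orP[/eqP->|vo] /andP[nc ns];
        first by rewrite eqxx in nc.
      by move: (ns); rewrite inE negb_or => /andP[/negbTE-> _]; apply: c4.
  - split.
    + move=> u v; rewrite !memr size_rcons => uu vo; sx.
      have csk : isanc u c <-> u = c \/ u \in cur :: stk.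
        by rewrite isanc_up upc (stkok_isanc u sok).
      case: (v =P c) vo => [-> _|nv /= vo].
        rewrite csk idc; case: (u =P c) uu => [-> _|nu /= uu].
          by rewrite idc mem_head leqnn ltnSn; split=> // _; left.
        rewrite idx // [u \in c :: _]inE (introF eqP nu) /= (ltnW (ilt u uu)) /=.
        case us: (u \in cur :: stk); first by rewrite ltnSn; split=> // _; right.
        split=> [[//|//]|]; have := i2 u uu (negbT us); rewrite ltnNge => ->; by [].
      rewrite (idx v) //; case: (u =P c) uu => [-> _|nu /= uu].
        split=> [/(anc_ord _ _ vo)|]; first by rewrite (negbTE cno).
        by rewrite idc; have := ilt v vo; clear; lia.
      rewrite (i1 u v uu vo) idx // [u \in c :: _]inE (introF eqP nu) /=.
      case: (u \in cur :: stk) => //; have := ilt v vo => lv; by rewrite lv ltnS (ltnW lv).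
    + move=> u; rewrite memr inE negb_or => /orP[/eqP->|uu] /andP[nc ns];
        first by rewrite eqxx in nc.
      by sx; rewrite idx // size_rcons; apply: leqW; apply: i2.
  - split=> //.
    + move=> i ni; rewrite -(af i ni); move: ni; rewrite !inE !negb_or; sx.
      by case/and4P => /negbTE-> /negbTE-> /negbTE-> _.
    + by move=> y ny; rewrite -(fr y ny); move: ny; rewrite !inE; sx; do !case: eqP.
exists [:: n], [:: n], Ch0; split=> //.
- split=> //; [by move=> v; rewrite inE => /eqP-> | by rewrite mem_head | by rewrite /=; clear;
    lia | by split].
- split=> //.
  + by move=> v; rewrite inE => /eqP->; rewrite /= eqxx /setv /= h0.
  + by split; [rewrite /= h0 | move=> k; rewrite /=; clear; lia].
  + by move=> v; rewrite inE => ->.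
- split.
  + by move=> p; have [] := hC0 p.
  + move=> p v vC; have [_ _ h] := hC0 p; move: vC; rewrite h => /andP[lv /eqP up]; split=> //.
    by rewrite inE ltn_eqF.
  + by move=> v lv; right; have [_ _ ->] := hC0 (up0 v); rewrite lv eqxx.
  + by move=> v ->.
- split.
  + move=> u v; rewrite !inE => /eqP-> /eqP->; rewrite /= eqxx; split=> // _; exact: isanc_refl.
  + by move=> u ->.
- split=> //; frame_tac.
Qed.

End Init.

(** * Block length, tables and initial masks *)

Definition bsize_cmd : cmd :=
  vB <-- #1;;
  vq <-- #2;;
  While (#1 - ($vN < #2 * $vq))%X (vq <-- (#2 * $vq);; vB <-- ($vB + #1)).

Definition tables_cmd : cmd :=
  vi <-- #1;;
  While ($vi < $vq)%X
    (aTm.[=$vi] <-- (aTm.[|$vi %/ #2] + #1);;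
     aTp.[=$vi] <-- (aTp.[|$vi %/ #2] + $vi %% #2);;
     vi <-- ($vi + #1)).

(** The blocks cover the positions up to and including [N], because an interval may end at [N]. The
    loop links the last block to one that does not exist; the two final assignments close the ring
    instead. *)
Definition blocks_cmd : cmd :=
  vi <-- #0;;
  While (#1 - ($vN < $vi))%X
    (aEM.[=$vi] <-- #1;;
     aPm.[=#2 * $vi] <-- ($vq - #1);;
     aNx.[=#2 * $vi] <-- (#2 * ($vi + $vB));;
     aPv.[=#2 * ($vi + $vB)] <-- (#2 * $vi);;
     vi <-- ($vi + $vB));;
  aNx.[=#2 * ($vi - $vB)] <-- #0;;
  aPv.[=#0] <-- (#2 * ($vi - $vB)).

(** Ancestors lie at or before the position of the parent. If the parent is in the same block its
    mask is extended by one bit; otherwise no proper ancestor is in the block. Position 0 is its own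
    parent, but its mask is still 0 when it is read. *)
Definition ancestors_cmd : cmd :=
  vi <-- #0;;
  While ($vi < $vN)%X
    (aAM.[=$vi] <-- ((#1 <<< ($vi %% $vB)) +
       (aPp.[|$vi] %/ $vB == $vi %/ $vB) * aAM.[|aPp.[|$vi]]);;
     vi <-- ($vi + #1)).

Definition weights_cmd : cmd :=
  vi <-- #0;;
  While ($vi < $vn)%X
    (vx <-- aIn.[|$vi];;
     vo <-- ($vx %% $vB);;
     vb <-- ($vx - $vo);;
     aWm.[=$vb] <-- (aWm.[|$vb] + (aW.[|$vi] <<< $vo));;
     aCs.[=#0] <-- (aCs.[|#0] + aW.[|$vi]);;
     vi <-- ($vi + #1)).

Section Setup.

Variables (w : nat) (q : nat -> nat) (N : nat).
Hypothesis W_ge : 1024 * (N + 2) <= 2 ^ w.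
Hypothesis N_gt0 : 0 < N.
Local Notation wp := (wp w q).

(** Blocks have length at least 1 even for [N = 1], which is why the bound reads [N + 1]. *)
Lemma bsize_spec s : vr s vN = N -> wp bsize_cmd s N (fun s' =>
  [/\ 0 < vr s' vB, 2 ^ vr s' vB <= N + 1, N < 2 ^ (vr s' vB).+1, vr s' vq = 2 ^ vr s' vB &
    [/\ frame [:: vB; vq] s s', ar s' = ar s & sameio s s']]).
Proof.
move=> HN.
have oneW : 1 < 2 ^ w by clear -W_ge; lia.
have twoW : 2 < 2 ^ w by clear -W_ge; lia.
apply: (asgS (v := 1)); [by sx | by sx |].
apply: (asgS (v := 2)); [by sx | by sx |].
pose Iw (k : nat) (s' : st) := exists b, [/\ 0 < b, 2 ^ b <= N + 1, k = N - b,
  vr s' vB = b /\ vr s' vq = 2 ^ b & [/\ frame [:: vB; vq] s s', ar s' = ar s & sameio s s']].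
apply: (wp_mono (T := N - 1) _ (leq_subr _ _) (fun _ h => h)).
apply: (wp_while (Inv := Iw)).
  move=> k s' [b [b0 b2 kE [Hb Hq] [fr aE io]]].
  have HN' : vr s' vN = N by rewrite fr.
  have e2 : 2 * 2 ^ b = 2 ^ b.+1 by rewrite expnS.
  have lb : b < 2 ^ b by apply: ltn_expl.
  split.
  - by sx; rewrite HN' Hq; do !split=> //; [clear -b2 W_ge; lia | case: (_ < _)].
  - by sx; rewrite HN' Hq e2; case: ltnP => // h _; rewrite Hb; split.
  - sx; rewrite HN' Hq e2; case: ltnP => // h _; exists 0.
    apply: (asgS (v := 2 ^ b.+1)); [by sx; rewrite Hq e2; split=> //; clear -h W_ge; lia | by sx;
      rewrite Hq e2 |].
    apply: (asg1 (v := b.+1)); [by sx; rewrite Hb; split=> //; clear -lb b2 W_ge; lia | by sx;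
      rewrite Hb addn1 |].
    exists (N - b.+1); split; first by rewrite kE; move: h; rewrite -e2; clear -lb; lia.
    exists b.+1; split=> //; first by clear -h; lia.
    split=> //; by move=> y ny; rewrite -(fr y ny); move: ny; rewrite !inE; sx; do !case: eqP.
exists 1; split=> //; first by rewrite expn1; clear -N_gt0; lia.
by split=> //; frame_tac.
Qed.

Variable B : nat.
Hypotheses (B_gt0 : 0 < B) (B_le : 2 ^ B <= N + 1).

Lemma tables_spec s : vr s vq = 2 ^ B -> ar s aTm 0 = 0 -> ar s aTp 0 = 0 ->
  wp tables_cmd s (N + 1) (fun s' =>
  [/\ ar s' aTm 0 = 0 /\ (forall i, 0 < i < 2 ^ B -> ar s' aTm i = (ar s' aTm (i %/ 2)).+1),
      ar s' aTp 0 = 0 /\ (forall i, 0 < i < 2 ^ B -> ar s' aTp i = ar s' aTp (i %/ 2) + i %% 2) &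
      [/\ frame [:: vi] s s', aframe [:: aTm; aTp] s s' & sameio s s']]).
Proof.
move=> Hq t0 p0.
have oneW : 1 < 2 ^ w by clear -W_ge; lia.
have twoW : 2 < 2 ^ w by clear -W_ge; lia.
apply: (asgS (v := 1)); [by sx | by sx |].
(* The bound of each table entry by its index is carried along to exclude overflow. *)
pose Iw (k : nat) (s' : st) := exists i, [/\ 0 < i <= 2 ^ B, k = 2 ^ B - i, vr s' vi = i,
  [/\ ar s' aTm 0 = 0, (forall j, 0 < j < i -> ar s' aTm j = (ar s' aTm (j %/ 2)).+1),
      ar s' aTp 0 = 0, (forall j, 0 < j < i -> ar s' aTp j = ar s' aTp (j %/ 2) + j %% 2) &
      forall j, j < i -> ar s' aTm j <= j /\ ar s' aTp j <= j] &
  [/\ frame [:: vi] s s', aframe [:: aTm; aTp] s s' & sameio s s']].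
apply: (wp_mono (T := 2 ^ B - 1) _ _ (fun _ h => h)); last by clear -B_le; lia.
apply: (wp_while (Inv := Iw)).
  move=> k s' [i [li kE Hi [m0 mS p0' pS bd] [fr af io]]].
  have Hq' : vr s' vq = 2 ^ B by rewrite fr.
  split; first by sx.
    sx; rewrite Hi Hq'; case: ltnP => // h _.
    have e : i = 2 ^ B by clear -li h; lia.
    by rewrite e in mS pS; split.
  sx; rewrite Hi Hq'; case: ltnP => // h _; exists 0.
  have i2 : i %/ 2 < i by clear -li; lia.
  have [b1 b2] := bd _ i2.
  apply: (stoS (a := i) (v := (ar s' aTm (i %/ 2)).+1)).
  - by sx.
  - by sx; rewrite Hi; do !split=> //; clear -i2 b1 h B_le W_ge; lia.
  - by sx.
  - by sx; rewrite Hi addn1.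
  - by clear -h B_le W_ge; lia.
  apply: (stoS (a := i) (v := ar s' aTp (i %/ 2) + i %% 2)).
  - by sx.
  - by sx; rewrite Hi; do !split=> //; clear -i2 b2 h B_le W_ge; lia.
  - by sx.
  - by sx; rewrite Hi.
  - by clear -h B_le W_ge; lia.
  apply: (asg1 (v := i.+1)); [by sx; rewrite Hi; split=> //; clear -h B_le W_ge; lia | by sx;
    rewrite Hi addn1 |].
  exists (2 ^ B - i.+1); split; first by rewrite kE; clear -h; lia.
  have i0 : (0 == i) = false by apply/eqP; clear -li; lia.
  exists i.+1; split=> //.
  - split; sx; rewrite ?i0 //.
    + move=> j lj; have -> : (j %/ 2 == i) = false by apply/eqP; clear -lj; lia.
      by case: (j =P i) => [->//|ne]; apply: mS; clear -lj ne; lia.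
    + move=> j lj; have -> : (j %/ 2 == i) = false by apply/eqP; clear -lj; lia.
      by case: (j =P i) => [->//|ne]; apply: pS; clear -lj ne; lia.
    + move=> j lj; case: (j =P i) => [->|ne]; first by clear -li b1 b2; lia.
      by apply: bd; clear -lj ne; lia.
  - split=> //; first by move=> y ny; rewrite -(fr y ny); move: ny; rewrite !inE; sx; case: eqP.
    move=> y ny; rewrite -(af y ny); move: ny; rewrite !inE !negb_or; sx.
    by case/andP => /negbTE-> /negbTE->.
exists 1; split=> //; first by rewrite expn_gt0.
  split=> //; try by move=> j; clear; lia.
  by case=> // _; sx; rewrite t0 p0.
by split=> //; frame_tac.
Qed.

Lemma ring_intro nx pv s : (forall i, i < size s ->
    nx (nth 0 s i) = nth 0 s (i.+1 %% size s) /\ pv (nth 0 s (i.+1 %% size s)) = nth 0 s i) ->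
  ring nx pv s.
Proof.
case: s => // a s H; rewrite /ring /=; apply/(pathP 0) => i; rewrite size_rcons => li.
have [h1 h2] := H i li; have E : nth 0 (rcons s a) i = nth 0 (a :: s) (i.+1 %% size (a :: s)).
  rewrite nth_rcons /=; move: li; rewrite ltnS leq_eqVlt => /orP[/eqP->|li].
    by rewrite ltnn eqxx modnn.
  by rewrite li modn_small.
have E' : nth 0 (a :: rcons s a) i = nth 0 (a :: s) i.
  by rewrite -rcons_cons nth_rcons /= li.
by rewrite E E' /lnk h1 h2 !eqxx.
Qed.

Definition nblocks : nat := (N %/ B).+1.
Definition block_nodes : seq nat := [seq 2 * (i * B) | i <- iota 0 nblocks].

Lemma nblocks_bound j : (j < nblocks) = (j * B <= N).
Proof. by rewrite ltnS leq_divRL. Qed.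

Lemma blocks_spec s : vr s vN = N -> vr s vB = B -> vr s vq = 2 ^ B ->
  wp blocks_cmd s (N + 1) (fun s' =>
  [/\ forall b, b <= N -> base B b = b -> ar s' aEM b = 1 /\ ar s' aPm (2 * b) = 2 ^ B - 1,
      ring (ar s' aNx) (ar s' aPv) block_nodes &
      [/\ frame [:: vi] s s', aframe [:: aEM; aPm; aNx; aPv] s s' & sameio s s']]).
Proof.
move=> HN HB Hq.
have BN : B <= N by have := @ltn_expl 2 B isT; clear -B_le; lia.
have oneW : 1 < 2 ^ w by clear -W_ge; lia.
have twoW : 2 < 2 ^ w by clear -W_ge; lia.
have zW : 0 < 2 ^ w by clear -W_ge; lia.
have q0 : 0 < 2 ^ B by rewrite expn_gt0.
apply: (asgS (v := 0)); [by sx | by sx |].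
pose Iw (k : nat) (s' : st) := exists j, [/\ j <= nblocks, k = nblocks - j, vr s' vi = j * B,
  [/\ forall i, i < j -> ar s' aEM (i * B) = 1, forall i, i < j -> ar s' aPm (2 * (i * B)) = 2 ^ B - 1,
      forall i, i < j -> ar s' aNx (2 * (i * B)) = 2 * (i.+1 * B) &
      forall i, i < j -> ar s' aPv (2 * (i.+1 * B)) = 2 * (i * B)] &
  [/\ frame [:: vi] s s', aframe [:: aEM; aPm; aNx; aPv] s s' & sameio s s']].
have inj i j : (i * B == j * B) = (i == j) by rewrite eqn_pmul2r.
have inj2 i j : (2 * (i * B) == 2 * (j * B)) = (i == j) by rewrite eqn_pmul2l // inj.
rewrite -[N + 1]addn0; apply: wp_seq; apply: (wp_mono (T := nblocks) (Q := Iw 0)).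
- apply: (wp_while (Inv := Iw)).
    move=> k s' [j [lj kE Hi [hE hP hX hV] [fr af io]]].
    have [HN' HB' Hq'] : [/\ vr s' vN = N, vr s' vB = B & vr s' vq = 2 ^ B] by rewrite !fr.
    split; first by sx; do !split=> //; case: (_ < _).
      sx; rewrite Hi HN'; case: ltnP => // h _; exists j; split=> //.
      by apply/esym/eqP; rewrite subn_eq0 leqNgt nblocks_bound -ltnNge.
    sx; rewrite Hi HN'; case: ltnP => // h _; exists 0.
    have jS : j.+1 * B = j * B + B by rewrite mulSnr.
    apply: (stoS (a := j * B) (v := 1)); [by sx | by sx | by sx | by sx | clear -h W_ge; lia |].
    apply: (stoS (a := 2 * (j * B)) (v := 2 ^ B - 1)).
      by sx; rewrite Hi; do !split=> //; clear -h W_ge; lia. by sx; rewrite Hq'; split.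
      by sx; rewrite Hi. by sx; rewrite Hq'. by clear -h W_ge; lia.
    apply: (stoS (a := 2 * (j * B)) (v := 2 * (j.+1 * B))).
      by sx; rewrite Hi; do !split=> //; clear -h W_ge; lia.
      by sx; rewrite Hi HB'; do !split=> //; clear -h BN W_ge; lia.
      by sx; rewrite Hi. by sx; rewrite Hi HB' jS. by clear -h W_ge; lia.
    apply: (stoS (a := 2 * (j.+1 * B)) (v := 2 * (j * B))).
      by sx; rewrite Hi HB'; do !split=> //; clear -h BN W_ge; lia.
      by sx; rewrite Hi; do !split=> //; clear -h W_ge; lia.
      by sx; rewrite Hi HB' jS. by sx; rewrite Hi. by rewrite jS; clear -h BN W_ge; lia.
    apply: (asg1 (v := j.+1 * B)).
      by sx; rewrite Hi HB'; split=> //; clear -h BN W_ge; lia. by sx; rewrite Hi HB' jS.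
    have ljn : j < nblocks by rewrite nblocks_bound.
    exists (nblocks - j.+1); split; first by rewrite kE; clear -ljn; lia.
    exists j.+1; split=> //.
    + split=> i li; sx; rewrite ?inj ?inj2 ?eqSS; (case: (i =P j) => [e|ne]; first by rewrite ?e).
      * by apply: hE; clear -li ne; lia.
      * by apply: hP; clear -li ne; lia.
      * by apply: hX; clear -li ne; lia.
      * by apply: hV; clear -li ne; lia.
    + split=> //; first by move=> y ny; rewrite -(fr y ny); move: ny; rewrite !inE; sx; case: eqP.
      move=> y ny; rewrite -(af y ny); move: ny; rewrite !inE !negb_or; sx.
      by case/and4P => /negbTE-> /negbTE-> /negbTE-> /negbTE->.
  exists 0; split=> //.
  by split=> //; frame_tac.
- by rewrite /nblocks addn1 ltnS; apply: leq_div.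
move=> s' [j [lj kE Hi [hE hP hX hV] [fr af io]]].
have ej : j = nblocks by clear -lj kE; lia.
rewrite {}ej in Hi hE hP hX hV.
have HB' : vr s' vB = B by rewrite fr.
set m := N %/ B; have nbE : nblocks = m.+1 by [].
have mB : m * B <= N by apply: leq_trunc_div.
have iE : nblocks * B - B = m * B by rewrite nbE mulSnr addnK.
have Bn : B <= nblocks * B by rewrite nbE mulSnr leq_addl.
apply: (stoS (a := 2 * (m * B)) (v := 0)).
  by sx; rewrite Hi HB' iE; do !split=> //; clear -mB W_ge; lia. by sx. by sx;
    rewrite Hi HB' iE. by sx.
  by clear -mB W_ge; lia.
apply: (sto1 (a := 0) (v := 2 * (m * B))).
  by sx. by sx; rewrite Hi HB' iE; do !split=> //; clear -mB W_ge; lia. by sx.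
  by sx; rewrite Hi HB' iE. by clear -W_ge; lia.
split.
- move=> b lb bb; have lt : b %/ B < nblocks by rewrite ltnS leq_div2r.
  by rewrite -{1 2}bb; sx; rewrite hE // hP.
- have nthE i : i < nblocks -> nth 0 block_nodes i = 2 * (i * B).
    by move=> li; rewrite (nth_map 0) ?size_iota // nth_iota.
  apply: ring_intro; rewrite size_map size_iota => i li.
  rewrite nthE // nthE ?ltn_mod //; sx; rewrite inj2.
  case: (i =P m) => [->|ne].
    by rewrite nbE modnn mul0n muln0 eqxx.
  have li' : i.+1 < nblocks by move: li; rewrite nbE; clear -ne; lia.
  rewrite modn_small // hX // hV //.
  have -> : (2 * (i.+1 * B) == 0) = false by rewrite muln_eq0 /= muln_eq0 /= -leqn0 leqNgt B_gt0.
  by [].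
- split=> //.
  move=> y ny; rewrite -(af y ny); move: ny; rewrite !inE !negb_or; sx.
  by case/and4P => _ _ /negbTE-> /negbTE->.
Qed.

Lemma ancestors_spec s R : vr s vN = N -> vr s vB = B ->
  (forall x, x < N -> x < R x <= N) -> ar s aPp 0 = 0 -> (forall k, ar s aAM k = 0) ->
  (forall k, 0 < k < N -> ar s aPp k < k /\
     forall y, y < N -> y != k -> ini R y k = ini R y (ar s aPp k)) ->
  wp ancestors_cmd s N (fun s' =>
  [/\ forall k, k < N -> ar s' aAM k = bits B (fun o => ini R (base B k + o) k) &
      [/\ frame [:: vi] s s', aframe [:: aAM] s s' & sameio s s']]).
Proof.
move=> HN HB Rb P0 A0 HP.
have oneW : 1 < 2 ^ w by clear -W_ge; lia.
have zW : 0 < 2 ^ w by clear -W_ge; lia.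
apply: (asgS (v := 0)); [by sx | by sx |].
pose Iw (k : nat) (s' : st) := exists i, [/\ i <= N, k = N - i, vr s' vi = i,
  (forall k, k < i -> ar s' aAM k = bits B (fun o => ini R (base B k + o) k)) /\
  (forall k, i <= k -> ar s' aAM k = 0) &
  [/\ frame [:: vi] s s', aframe [:: aAM] s s' & sameio s s']].
apply: (wp_while (Inv := Iw)).
  move=> k s' [i [li kE Hi [h1 h2] [fr af io]]].
  have [HN' HB'] : vr s' vN = N /\ vr s' vB = B by rewrite !fr.
  split; first by sx.
    sx; rewrite Hi HN'; case: ltnP => // h _; have e : i = N by clear -li h; lia.
    by rewrite e in h1.
  sx; rewrite Hi HN'; case: ltnP => // h _; exists 0.
  pose p := ar s aPp i.
  have pE : ar s' aPp i = p by rewrite af.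
  have pi : p <= i by rewrite /p; case: (posnP i) => [->|i0];
    [rewrite P0 | have [/ltnW] := HP i (introT andP (conj i0 h))].
  have ol := off_lt B_gt0 i.
  have e2 : 2 ^ off B i <= N + 1 by apply: leq_trans B_le; rewrite leq_exp2l // ltnW.
  have AMp : ar s' aAM p <= N.
    case: (ltnP p i) => [/h1->|/h2->//]; have := bits_lt B (fun o => ini R (base B p + o) p).
    by clear -B_le; lia.
  have beq : (p %/ B == i %/ B) = (base B p == base B i) by rewrite /base eqn_pmul2r.
  have iB := base_mod B i.
  have val : 2 ^ off B i + (base B p == base B i) * ar s' aAM p = bits B (fun o => ini R (base B i + o) i).
    case: (posnP i) => [i0|i0].
      have -> : ar s' aAM p = 0 by rewrite /p i0 P0; apply: h2; rewrite i0.
      rewrite muln0 addn0 -(bits1 ol); apply: eq_bits => o lo.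
      rewrite -(eqn_add2l (base B i) o) -iB i0 /base div0n mul0n add0n /ini leqn0.
      by case: eqP => // ->; have /andP[-> _] := Rb 0 N_gt0.
    have [lt hp] := HP i (introT andP (conj i0 h)); rewrite -/p in lt hp.
    have io' o : (base B i + o == i) = (o == off B i) by rewrite {2}iB eqn_add2l.
    case: (base B p =P base B i) => [e|ne].
      rewrite mul1n h1 // e addnC; apply: bits_set => //.
        by rewrite -iB /ini; clear -lt; lia.
      move=> o lo; rewrite -io'; case: (base B i + o =P i) => [->|nei].
        by rewrite /ini leqnn; have /andP[-> _] := Rb i h; rewrite orbT.
      rewrite orbF; case: (ltnP (base B i + o) N) => lN; first by apply: hp => //; apply/eqP.
      by rewrite /ini; clear -lN h lt; lia.
    rewrite mul0n addn0 -(bits1 ol); apply: eq_bits => o lo; rewrite -io'.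
    case: (base B i + o =P i) => [->|nei]; first by rewrite /ini leqnn; have /andP[-> _] := Rb i h.
    apply/esym/negbTE/negP => I1; apply: ne; have I2 : base B i + o < N by move: I1; rewrite /ini;
      clear -h; lia.
    move: I1; rewrite hp //; last by apply/eqP.
    by rewrite /ini => I1; apply: base_eq => //; have := base_gt B_gt0 i; clear -I1 lt; lia.
  apply: (stoS (a := i) (v := bits B (fun o => ini R (base B i + o) i))).
  - by sx.
  - sx; rewrite Hi HB' pE mul1n -/(off B i) beq val; do !split=> //.
    + by clear -e2 W_ge; lia.
    + by clear -h W_ge; lia.
    + by clear -h W_ge; lia.
    + by clear -pi h W_ge; lia.
    + by case: (_ == _); clear -AMp W_ge; lia.
    + by have := bits_lt B (fun o => ini R (base B i + o) i); clear -B_le W_ge; lia.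
  - by sx.
  - by sx; rewrite Hi HB' pE mul1n -/(off B i) beq val.
  - by clear -h W_ge; lia.
  apply: (asg1 (v := i.+1)); [by sx; rewrite Hi; split=> //; clear -h W_ge; lia | by sx;
    rewrite Hi addn1 |].
  exists (N - i.+1); split; first by rewrite kE; clear -h; lia.
  exists i.+1; split=> //.
  - split=> k' lk; sx; case: (k' =P i) => [e|ne]; rewrite ?e //.
    + by apply: h1; clear -lk ne; lia.
    + by clear -e lk; lia.
    + by apply: h2; clear -lk; lia.
  - split=> //; first by move=> y ny; rewrite -(fr y ny); move: ny; rewrite !inE; sx; case: eqP.
    by move=> y ny; rewrite -(af y ny); move: ny; rewrite !inE; sx; move/negbTE->.
exists 0; split; [by [] | by rewrite subn0 | by sx | by split=> // k _; apply: A0 | by split=> //;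
  frame_tac].
Qed.

Lemma weights_spec s n (ord : seq nat) (wt : nat -> bool) : N = n.+1 -> vr s vn = n -> vr s vB = B ->
  uniq ord -> size ord = N -> (forall v, v < n -> v \in ord) ->
  (forall v, v < n -> ar s aIn v = index v ord) -> (forall v, v < n -> ar s aW v = wt v) ->
  (forall b, ar s aWm b = 0) -> ar s aCs 0 = 0 ->
  wp weights_cmd s N (fun s' =>
  [/\ forall b, b <= N -> base B b = b -> ar s' aWm b =
        bits B (fun o => [&& b + o < N, nth 0 ord (b + o) < n & wt (nth 0 ord (b + o))]),
      ar s' aCs 0 = \sum_(0 <= v < n) wt v &
      [/\ frame [:: vi; vx; vo; vb] s s', aframe [:: aWm; aCs] s s' & sameio s s']]).
Proof.
move=> Nn Hn HB uo so oin hI hW W0 C0.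
have zW : 0 < 2 ^ w by clear -W_ge; lia.
have oneW : 1 < 2 ^ w by clear -W_ge; lia.
apply: (asgS (v := 0)); [by sx | by sx |].
pose wti i y := [&& y < N, nth 0 ord y < i & wt (nth 0 ord y)].
pose Iw (k : nat) (s' : st) := exists i, [/\ i <= n, k = n - i, vr s' vi = i,
  (forall b, b <= N -> base B b = b -> ar s' aWm b = bits B (fun o => wti i (b + o))) /\
  ar s' aCs 0 = \sum_(0 <= v < i) wt v &
  [/\ frame [:: vi; vx; vo; vb] s s', aframe [:: aWm; aCs] s s' & sameio s s']].
have sumle i : \sum_(0 <= v < i) wt v <= i.
  apply: leq_trans (_ : \sum_(0 <= v < i) 1 <= i); last by rewrite sum_nat_const_nat subn0 muln1.
  by apply: leq_sum => v _; case: (wt v).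
apply: (wp_mono (T := n) _ _ (fun _ h => h)); last by rewrite Nn.
apply: (wp_while (Inv := Iw)).
  move=> k s' [i [li kE Hi [h1 h2] [fr af io]]].
  have [Hn' HB'] : vr s' vn = n /\ vr s' vB = B by rewrite !fr.
  split; first by sx.
    sx; rewrite Hi Hn'; case: ltnP => // h _; have e : i = n by clear -li h; lia.
    by rewrite e in h1 h2; split.
  sx; rewrite Hi Hn'; case: ltnP => // h _; exists 0.
  have io' := oin _ h; pose x := index i ord.
  have lx : x < N by rewrite -so index_mem.
  have nx : nth 0 ord x = i by apply: nth_index.
  have IE : ar s' aIn i = x by rewrite af // hI.
  have WE : ar s' aW i = wt i by rewrite af // hW.
  have xB := base_mod B x; have ol := off_lt B_gt0 x; have bl := base_le B x.
  have bb := base_id B_gt0 x.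
  have bN : base B x <= N by clear -bl lx; lia.
  have e2 : 2 ^ off B x <= N + 1 by apply: leq_trans B_le; rewrite leq_exp2l // ltnW.
  have bM := bits_lt B (fun o => wti i (base B x + o)).
  have HM := h1 _ bN bb.
  have wS y : wti i.+1 y = wti i y || (wt i && (y == x)).
    rewrite /wti (ltnS (nth 0 ord y)) (leq_eqVlt (nth 0 ord y)); case: (ltnP y N) => ly /=;
      last first.
      by rewrite (_ : y == x = false) ?andbF //; apply/eqP; clear -ly lx; lia.
    have -> : (nth 0 ord y == i) = (y == x) by rewrite -{1}nx nth_uniq // so.
    case: (y =P x) => [->|ne] /=; last by rewrite andbF orbF.
    by rewrite nx ltnn /= andbT.
  have val : bits B (fun o => wti i (base B x + o)) + wt i * 2 ^ off B x =
      bits B (fun o => wti i.+1 (base B x + o)).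
    have ex o : (base B x + o == x) = (o == off B x) by rewrite {2}xB eqn_add2l.
    case E: (wt i); last first.
      by rewrite mul0n addn0; apply: eq_bits => o lo; rewrite wS E orbF.
    rewrite mul1n; apply: bits_set => // [|o lo]; first by rewrite -xB /wti nx ltnn andbF.
    by rewrite wS E -ex.
  apply: (asgS (v := x)); [by sx; rewrite Hi; split=> //; clear -h Nn W_ge; lia | by sx;
    rewrite Hi IE |].
  apply: (asgS (v := off B x)); [by sx | by sx; rewrite HB' |].
  apply: (asgS (v := base B x)); [by sx; split=> //; clear -xB; lia | by sx; clear -xB; lia |].
  apply: (stoS (a := base B x) (v := bits B (fun o => wti i.+1 (base B x + o)))).
  - by sx.
  - sx; rewrite Hi WE HM val; do !split=> //.
    + by clear -bN W_ge; lia.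
    + by clear -h Nn W_ge; lia.
    + by case: (wt i); clear -e2 W_ge; lia.
    + by have := bits_lt B (fun o => wti i.+1 (base B x + o)); clear -B_le W_ge; lia.
  - by sx.
  - by sx; rewrite Hi WE HM val.
  - by clear -bN W_ge; lia.
  have sl := sumle i.
  apply: (stoS (a := 0) (v := \sum_(0 <= v < i.+1) wt v)).
  - by sx.
  - sx; rewrite Hi WE h2; do !split=> //.
    + by clear -W_ge; lia.
    + by clear -h Nn W_ge; lia.
    + by case: (wt i); clear -sl h Nn W_ge; lia.
  - by sx.
  - by sx; rewrite Hi WE h2 big_nat_recr.
  - by clear -W_ge; lia.
  apply: (asg1 (v := i.+1)); [by sx; rewrite Hi; split=> //; clear -h Nn W_ge; lia | by sx;
    rewrite Hi addn1 |].
  exists (n - i.+1); split; first by rewrite kE; clear -h; lia.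
  exists i.+1; split=> //.
  - split; last by sx.
    move=> b lb be; sx; case: (b =P base B x) => [->//|ne]; rewrite h1 //; apply: eq_bits => o lo.
    rewrite wS (_ : b + o == x = false) ?andbF ?orbF //; apply/eqP => e.
    by apply: ne; rewrite -e -be base_add.
  - split=> //.
    + by move=> y ny; rewrite -(fr y ny); move: ny; rewrite !inE; sx; do !case: eqP.
    + by move=> y ny; rewrite -(af y ny); move: ny; rewrite !inE !negb_or; sx;
        case/andP => /negbTE-> /negbTE->.
exists 0; split; [by [] | by rewrite subn0 | by sx | | by split=> //; frame_tac].
split; last by sx; rewrite big_nil.
by move=> b lb be; sx; rewrite W0 bits0 // => o lo; rewrite /wti ltn0 andbF.
Qed.

End Setup.

Definition init_cmd : cmd :=
  read_cmd;; dfs_cmd;; bsize_cmd;; tables_cmd;; blocks_cmd;; ancestors_cmd;; weights_cmd.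

(** * The initial invariant *)

Section Initial.

Variables (w : nat) (q : nat -> nat) (n : nat) (par : nat -> option nat) (wt : nat -> bool).
Hypothesis W_ge : 1024 * (n + 3) <= 2 ^ w.
Hypothesis Hf : forest n par.

Local Notation wp := (wp w q).
Local Notation N := n.+1.
Local Notation up0 := (up0 n par).
Local Notation isanc := (isanc n par).

Record numbering (B : nat) (R : nat -> nat) (ord : seq nat) : Prop := Numbering {
  nb_B : 0 < B;
  nb_le : 2 ^ B <= N + 1;
  nb_bound : forall x, x < N -> x < R x <= N;
  nb_lam : forall x y, x < N -> x <= y < R x -> R y <= R x;
  nb_uniq : uniq ord;
  nb_size : size ord = N;
  nb_mem : forall v, (v \in ord) = (v <= n);
  nb_root : nth 0 ord 0 = n;
  nb_up : forall v, v < n -> index (up0 v) ord < index v ord;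
  nb_link : forall u v, u <= n -> v <= n -> (isanc u v <-> ini R (index u ord) (index v ord)) }.

Definition pos_weight (ord : seq nat) (wt' : nat -> bool) (y : nat) : bool :=
  [&& y < N, nth 0 ord y < n & wt' (nth 0 ord y)].

Lemma W_geN : 1024 * (N + 2) <= 2 ^ w.
Proof. by apply: leq_trans W_ge; rewrite leq_mul2l; lia. Qed.

Definition vertex_facts (ord : seq nat) (s : st) : Prop :=
  [/\ vr s vn = n, forall v, v < n -> ar s aIn v = index v ord &
      forall v, v < n -> ar s aPar v = up0 v].

Lemma sum_ord B R ord (f : nat -> nat) (P : nat -> bool) : numbering B R ord ->
  \sum_(0 <= y < N | P y) f (nth 0 ord y) = \sum_(0 <= v < N | P (index v ord)) f v.
Proof.
move=> nb; have pe : perm_eq ord (index_iota 0 N).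
  apply: uniq_perm; [exact: (nb_uniq nb) | exact: iota_uniq |].
  by move=> v; rewrite (nb_mem nb) mem_index_iota.
rewrite -[RHS](perm_big _ pe) /= [RHS](big_nth 0) (nb_size nb).
rewrite big_nat_cond [RHS]big_nat_cond; apply: eq_bigl => y.
case: (ltnP y N) => ly; rewrite ?andbF //= index_uniq ?(nb_size nb) //; exact: (nb_uniq nb).
Qed.

(** Without marks every block is one piece and all are in class 0. There are [N %/ B + 1] blocks,
    and [N < 2 ^ B.+1] bounds the logarithm in [phi] by [B], so the potential is at most
    [N %/ B * B]. *)
Lemma init_inv B R ord s : numbering B R ord -> N < 2 ^ B.+1 ->
  statics N B R s ->
  (forall b, b <= N -> base B b = b -> ar s aEM b = 1 /\ ar s aPm (2 * b) = 2 ^ B - 1) ->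
  ring (ar s aNx) (ar s aPv) (block_nodes N B) ->
  (forall b, b <= N -> base B b = b -> ar s aWm b = bits B (fun o => pos_weight ord wt (b + o))) ->
  ar s aCs 0 = \sum_(0 <= v < n) wt v ->
  (forall b, ar s aMM b = 0) -> (forall k, ar s aLab k = 0) ->
  let L c := if c == 0 then block_nodes N B else [::] in
  Inv N B R xpred0 (pos_weight ord wt) L s /\ Pot N L <= N.
Proof.
move=> nb lN st hE hR hW hC hM hL L; have B0 := nb_B nb.
have EmE g : Em B R xpred0 g = (off B g == 0) by rewrite /Em has_pred0 orbF.
have offb b o : base B b = b -> o < B -> off B (b + o) = o.
  move=> bb lo; have := base_mod B (b + o); rewrite -{2}bb base_add // bb => /addnI; by [].
have FE y : F B R xpred0 y = 2 * base B y.
  rewrite /F mx0 => [|//]; congr (2 * _).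
  rewrite (@mx_intro _ _ 0) ?addn0 ?Em_base // => j lj.
  rewrite EmE offb ?base_id //; first by apply/eqP; clear -lj; lia.
  by have := off_lt B0 y; clear -lj; lia.
have liveE k : live N B R xpred0 k = (k \in block_nodes N B).
  rewrite /live EmE; apply/idP/mapP => [/andP[kN]|[i]].
    case O: (odd k) => // /eqP o0; exists (k %/ 2 %/ B).
      by rewrite mem_iota /= add0n nblocks_bound //; apply: leq_trans (leq_trunc_div _ _) kN.
    have -> : k %/ 2 %/ B * B = k %/ 2 by rewrite -[RHS](modB_eq0 o0).
    by clear -O; lia.
  rewrite mem_iota /= add0n nblocks_bound // => iN ->; rewrite half2 odd2 iN /off modnMl eqxx //.
split; last first.
  rewrite /Pot big_nat_recl // big1 => [|i _]; last by rewrite /L /phi /=.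
  rewrite addn0 /L /= size_map size_iota /nblocks /phi.
  have h1 : (N %/ B).+1 - 2 <= N %/ B by rewrite subSS leq_subr.
  have h2 : trunc_log 2 ((N %/ B).+1 - 2) <= B.
    rewrite -ltnS -(ltn_exp2l (m := 2)) //; case: (posnP ((N %/ B).+1 - 2)) => [->|p].
      by rewrite trunc_log0 expn0; apply: leq_trans (_ : 1 < 2 ^ 1) _ => //; rewrite leq_exp2l.
    apply: leq_ltn_trans (trunc_logP _ p) _ => //; apply: leq_ltn_trans h1 _.
    by apply: leq_ltn_trans lN; apply: leq_div.
  by apply: leq_trans (leq_mul h1 h2) _; apply: leq_trunc_div.
have BE b : base B b = b -> bits B (fun o => Em B R xpred0 (b + o)) = 1.
  move=> bb; rewrite -[RHS](@bits1 B 0) //; apply: eq_bits => o lo; by rewrite EmE offb.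
split=> //.
- by move=> y /and3P[].
- split.
  + by move=> b _ _; rewrite hM bits0.
  + by move=> b lb bb; have [-> _] := hE b lb bb; rewrite BE.
  + exact: hW.
  + move=> k Lk; exists xpredT; rewrite bitsT.
    move: (Lk); rewrite /live EmE => /andP[kN]; case O: (odd k) => // /eqP o0.
    have bb := modB_eq0 o0; have kE : k = 2 * (k %/ 2) by clear -O; lia.
    have [_ Pk] := hE _ kN bb; rewrite kE Pk -kE; split=> // o lo _.
    by rewrite FE base_add // bb -kE eqxx.
- split.
  + by move=> c k; rewrite liveE hL /L eq_sym; case: eqP => _; rewrite ?andbT ?andbF.
  + move=> c; rewrite /L; case: ifP => // _; rewrite /block_nodes sorted_map.
    apply: (@sub_sorted _ ltn) (iota_ltn_sorted 0 _) => i j /=.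
    by rewrite ltn_mul2l ltn_mul2r B0.
  + by move=> c; rewrite /L; case: ifP.
- by move=> k k' _ _; rewrite !hL; split.
- by move=> k _; rewrite hL eqxx.
- move=> c; rewrite orbF => /eqP->; rewrite hC.
  rewrite [RHS](eq_bigl xpredT); last by move=> y; rewrite hL eqxx.
  rewrite [RHS](eq_big_nat _ _ (F2 := fun y => nat_of_bool ((nth 0 ord y < n) && wt (nth 0 ord y)))).
    rewrite [RHS](sum_ord (fun v => nat_of_bool ((v < n) && wt v)) xpredT nb) [RHS]big_nat_recr //= ltnn addn0.
    by apply: eq_big_nat => v /andP[_ ->].
  by move=> y /andP[_ ly]; rewrite /pos_weight ly.
Qed.

Definition init_post (ops : seq (nat * nat * nat)) (s : st) : Prop :=
  exists B R ord L,
  [/\ numbering B R ord, vertex_facts ord s, Inv N B R xpred0 (pos_weight ord wt) L s,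
      Pot N L <= N & [/\ si s = ops, sc s = n.+1 & so s = [::]]].

Lemma init_spec ops : (forall c, c <= n.+1 -> q c = 0) ->
  wp init_cmd (s_init n par wt ops) (10 * N) (init_post ops).
Proof.
move=> q0; have WN := W_geN.
have T10 : n + ((2 * n + 1) + (N + (N + 1 + (N + 1 + (N + N))))) <= 10 * N by lia.
apply: wp_mono T10 (fun _ h => h); apply: wp_seq.
apply: wp_mono; [exact: (read_spec wt W_ge Hf ops q0) | by [] |].
move=> s1 P1; apply: wp_seq; apply: wp_mono; [exact: (dfs_spec q W_ge Hf P1) | by [] |].
have [Hn1 HN1 [hP1 _] hW1 [h01 hsi1 hsc1 hso1 _]] := P1.
move=> s2 [ord [[uo so mo o0] [hI [hp0 hp] hup] hR hRN [af2 fr2 [io2a io2b io2c]]]].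
have HN2 : vr s2 vN = N by rewrite fr2.
have N0 : 0 < N by [].
apply: wp_seq; apply: wp_mono; [exact: (bsize_spec q WN N0 HN2) | by [] |].
move=> s3; set B := vr s3 vB; set R := ar s2 aR.
move=> [B0 Ble lN Hq3 [fr3 a3 [io3a io3b io3c]]].
have idx y : y < N -> index (nth 0 ord y) ord = y by move=> ly; rewrite index_uniq ?so.
have ny y : y < N -> nth 0 ord y <= n by move=> ly; rewrite -mo mem_nth // so.
have Rb x : x < N -> x < R x <= N.
  move=> lx; have [h _] := hR _ _ (ny x lx) (ny x lx); have := h (isanc_refl _ _ _).
  by have := hRN _ (ny x lx); rewrite idx // /R => h1 /andP[_ ->].
have link u v : u <= n -> v <= n -> (isanc u v <-> ini R (index u ord) (index v ord)) by apply: hR.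
have lam x y : x < N -> x <= y < R x -> R y <= R x.
  move=> lx Hy; have := Rb x lx => Hx; have ly : y < N by clear -Hy Hx; lia.
  (* The last position [z] of the interval of [y] belongs to a descendant of [y], hence of [x];
     laminarity is transitivity of ancestry. *)
  have := Rb y ly => Hy'; pose z := (R y).-1; have lz : z < N by rewrite /z; clear -Hy'; lia.
  have a1 : isanc (nth 0 ord x) (nth 0 ord y) by apply/link; rewrite ?ny ?idx.
  have a2 : isanc (nth 0 ord y) (nth 0 ord z).
    by apply/link; rewrite ?ny ?idx // /ini /z; clear -Hy'; lia.
  have /link := isanc_trans a1 a2; rewrite !ny // !idx // /ini => /(_ isT isT).
  by rewrite /z; clear -Hy'; lia.
have nb : numbering B R ord by split.
have ze i : i \notin [:: aPar; aSib; aFst; aW; aIn; aPp; aR] -> ar s3 i = fun _ => 0.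
  rewrite !inE !negb_or => ni; rewrite a3 af2 ?h01 // !inE; clear -ni; move: ni;
  by do !case: eqP.
apply: wp_seq; apply: wp_mono; [apply: (tables_spec q WN Ble Hq3); by rewrite ze | by [] |].
move=> s4 [tm4 tp4 [fr4 af4 [io4a io4b io4c]]].
have v34 y : y != vi -> vr s4 y = vr s3 y by move=> ne; apply: fr4; rewrite inE.
have HN3 : vr s3 vN = N by rewrite fr3.
apply: wp_seq; apply: wp_mono; [apply: (blocks_spec q WN B0 Ble); by rewrite v34 | by [] |].
move=> s5 [hE5 rng5 [fr5 af5 [io5a io5b io5c]]].
have v35 y : y != vi -> vr s5 y = vr s3 y by move=> ne; rewrite fr5 ?v34 ?inE.
have a35 i : i \notin [:: aTm; aTp; aEM; aPm; aNx; aPv] -> ar s5 i = ar s3 i.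
  by move=> ni; rewrite af5 ?af4 // !inE; move: ni; rewrite !inE; do !case: eqP.
apply: wp_seq; apply: wp_mono.
- apply: (ancestors_spec q WN N0 B0 Ble (R := R)); rewrite ?v35 // ?a35 // ?a3 //.
  + by move=> k; rewrite -a3 ze.
  + move=> k lk; rewrite hp //; have [k0 kN] := andP lk.
    have nk := ny k kN.
    have nk' : nth 0 ord k < n.
      rewrite ltn_neqAle nk andbT -o0 nth_uniq ?so //; by clear -k0; lia.
    have := hup _ nk'; rewrite idx // => lt; split=> // y yN yk.
    have ul := up0_le Hf (nth 0 ord k).
    have l1 := link _ _ (ny y yN) nk; have l2 := link _ _ (ny y yN) ul.
    rewrite !idx // in l1 l2; apply/idP/idP => h.
      apply/l2; have /isanc_up[e|//] := proj2 l1 h.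
      by move: yk; rewrite -(idx y yN) e idx // eqxx.
    by apply/l1; apply/isanc_up; right; apply/l2.
- by [].
move=> s6 [hA6 [fr6 af6 [io6a io6b io6c]]].
have v36 y : y != vi -> vr s6 y = vr s3 y by move=> ne; rewrite fr6 ?v35 ?inE.
have a36 i : i \notin [:: aTm; aTp; aEM; aPm; aNx; aPv; aAM] -> ar s6 i = ar s3 i.
  by move=> ni; rewrite af6 ?a35 // !inE; move: ni; rewrite !inE; do !case: eqP.
have Hn3 : vr s3 vn = n by rewrite fr3 // fr2.
have In3 v : v <= n -> ar s3 aIn v = index v ord by move=> lv; rewrite a3 hI.
apply: wp_mono.
- apply: (weights_spec q WN B0 Ble (n := n) (ord := ord) (wt := wt)); rewrite ?v36 // ?a36 //.
  + by move=> v lv; rewrite mo ltnW.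
  + by move=> v lv; rewrite In3 // ltnW.
  + by move=> v lv; rewrite a3 af2 // hW1.
  + by move=> b; rewrite ze.
  + by rewrite ze.
- by [].
move=> s7 [hW7 hC7 [fr7 af7 [io7a io7b io7c]]].
have a37 i : i \notin [:: aTm; aTp; aEM; aPm; aNx; aPv; aAM; aWm; aCs] -> ar s7 i = ar s3 i.
  by move=> ni; rewrite af7 ?a36 // !inE; move: ni; rewrite !inE; do !case: eqP.
have [I P] : let L c := if c == 0 then block_nodes N B else [::] in
    Inv N B R xpred0 (pos_weight ord wt) L s7 /\ Pot N L <= N.
  apply: (init_inv nb lN) => //.
  - split.
    + by rewrite fr7 // v36.
    + by move=> x _; rewrite a37 // a3.
    + by move=> x lx; rewrite af7 // hA6.
    + by rewrite af7 // af6 // af5.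
    + by rewrite af7 // af6 // af5.
  - by move=> b lb bb; rewrite !af7 // !af6 //; apply: hE5.
  - by rewrite !af7 // !af6.
  - by move=> b; rewrite a37 // ze.
  - by move=> k; rewrite a37 // ze.
exists B, R, ord, (fun c => if c == 0 then block_nodes N B else [::]); split=> //.
- split.
  + by rewrite fr7 // v36.
  + by move=> v lv; rewrite a37 // In3 // ltnW.
  + by move=> v lv; rewrite a37 // a3 af2 // hP1.
- split.
  + by rewrite io7a io6a io5a io4a io3a io2a.
  + by rewrite io7b io6b io5b io4b io3b io2b.
  + by rewrite io7c io6c io5c io4c io3c io2c.
Qed.

End Initial.

(** * The whole program *)

(** After this the marks are the roots of the input forest, so the later operations never meet an
    unmarked root other than the virtual one. *)
Definition roots_cmd : cmd :=
  vi <-- #0;;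
  While ($vi < $vn)%X
    (If (aPar.[|$vi] == $vn)%X (vx <-- aIn.[|$vi];; cut_cmd) Skip;;
     vi <-- ($vi + #1)).

Definition main_cmd : cmd :=
  Rd vr0;;
  While ($vr0 < #3)%X
    (vx <-- aIn.[|$vr1];;
     If ($vr0 == #0)%X cut_cmd (If ($vr0 == #1)%X update_cmd query_cmd);;
     Rd vr0).

Definition forest_cmd : cmd := init_cmd;; roots_cmd;; main_cmd.

Section Main.

Variables (w : nat) (n : nat) (par : nat -> option nat) (wt : nat -> bool) (ops : seq op).
Hypothesis W_ge : 1024 * (n + 3) <= 2 ^ w.
Hypothesis Hf : forest n par.

Local Notation N := n.+1.
Local Notation up0 := (up0 n par).
Local Notation isanc := (isanc n par).

(* Number of answers that must have been written once c records are read. *)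
Definition required (c : nat) : nat := count is_query (take (c - n.+2) ops).

Local Notation q := required.
Local Notation wp := (wp w q).

Variables (B : nat) (R : nat -> nat) (ord : seq nat).
Hypothesis nb : numbering n par B R ord.

Let B0 := nb_B nb.
Let Rb := nb_bound nb.
Let lam := nb_lam nb.
Let WN := W_geN W_ge.

(** The marks that correspond to a forest. The virtual root is left out: its interval contains all
    positions and separates none. *)
Definition pos_roots (par' : nat -> option nat) (x : nat) : bool :=
  [&& x < N, nth 0 ord x < n & ~~ par' (nth 0 ord x)].

Definition subforest (par' : nat -> option nat) : Prop :=
  forall v, par' v = None \/ par' v = par v.

Lemma idx y : y < N -> index (nth 0 ord y) ord = y.
Proof. by move=> ly; rewrite index_uniq ?(nb_size nb) //; exact: (nb_uniq nb). Qed.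

Lemma nidx v : v <= n -> nth 0 ord (index v ord) = v.
Proof. by move=> lv; rewrite nth_index // (nb_mem nb). Qed.

Lemma idx_lt v : v <= n -> index v ord < N.
Proof. by move=> lv; rewrite -(nb_size nb) index_mem (nb_mem nb). Qed.

Lemma idx_gt0 v : v < n -> 0 < index v ord.
Proof.
move=> lv; rewrite lt0n; apply/eqP => e; have := nidx (ltnW lv); rewrite e (nb_root nb).
by move=> e'; rewrite e' ltnn in lv.
Qed.

Section Roots.

Variable par' : nat -> option nat.
Hypothesis sf : subforest par'.

Lemma up_cases a : a < n -> (par' a = None /\ up par' a = a) \/
  (par' a != None /\ up par' a = up0 a /\ up0 a < n).
Proof.
move=> la; case E: (par' a) => [u|]; [right | left; by rewrite /up E].
split=> //; case: (sf a) => e; rewrite e // in E.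
by rewrite /up e E /= /up0 la E /=; split=> //; case: Hf => h _; apply: h E.
Qed.

Lemma anc_lt k v : v < n -> anc par' k v < n.
Proof.
by move=> lv; elim: k => //= k IH; case: (up_cases IH) => [[_ ->]|[_ [-> ->]]].
Qed.

Lemma isanc_anc k v : v < n -> isanc (anc par' k v) v.
Proof.
move=> lv; elim: k => [|k IH]; first exact: isanc_refl.
rewrite /anc iterS; case: (up_cases (anc_lt k lv)) => [[_ ->]|[_ [-> _]]] //.
by apply: isanc_trans IH; apply/isanc_up; right; apply: isanc_refl.
Qed.

(** Each step to a parent lowers the preorder position, and real vertices have positions from 1 to
    [n], so [n] steps cannot all be proper. *)
Lemma root_of_root v : v < n -> par' (root_of n par' v) = None.
Proof.
move=> lv.
have H k : par' (anc par' k v) = None \/ index (anc par' k v) ord + k <= index v ord.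
  elim: k => [|k IH]; first by right; rewrite addn0.
  rewrite /anc iterS -/(anc par' k v); have la := anc_lt k lv.
  case: (up_cases la) => [[e ->]|[ne [-> _]]]; first by left.
  right; case: IH => [e|le]; first by rewrite e in ne.
  by have := nb_up nb la; rewrite addnS; move: le; clear; lia.
case: (H n) => // le; have := idx_gt0 (anc_lt n lv); have := idx_lt (ltnW lv).
by move: le; clear; lia.
Qed.

(** The way up in the current forest stops at a root, so it cannot pass [d]. *)
Lemma isanc_root_of d v : v < n -> par' d = None -> isanc d v -> isanc d (root_of n par' v).
Proof.
rewrite /root_of => lv dN dv; elim: {2}n => // k IH; rewrite /anc iterS -/(anc par' k v).
case: (up_cases (anc_lt k lv)) => [[_ ->]|[ne [-> _]]] //.
by case/isanc_up: IH => // e; rewrite -e dN in ne.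
Qed.

Lemma isanc_idx u v : u <= n -> v <= n -> isanc u v -> index u ord <= index v ord.
Proof. by move=> lu lv /(nb_link nb lu lv)/andP[]. Qed.

Variable D : nat -> bool.
Hypothesis hD : forall x, D x = pos_roots par' x.

Lemma D_lt d : D d -> d < N.
Proof. by rewrite hD => /and3P[]. Qed.

(** If the marked intervals agree, the root of [u], whose interval is marked, is an ancestor of [v]
    and hence of the root of [v]; by symmetry the two roots have the same position. Conversely a
    marked ancestor of [u] is an ancestor of the root of [u], hence of everything in its tree. *)
Lemma root_same u v : u < n -> v < n ->
  (root_of n par' u == root_of n par' v) = sameb N R D (index u ord) (index v ord).
Proof.
move=> lu lv; have lun := ltnW lu; have lvn := ltnW lv.
have Dv d : D d -> [/\ nth 0 ord d <= n, par' (nth 0 ord d) = None & index (nth 0 ord d) ord = d].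
  rewrite hD => /and3P[dN dn]; case: (par' _) => // _; split=> //; [exact: ltnW | exact: idx].
have ru u' : u' < n -> [/\ root_of n par' u' < n, isanc (root_of n par' u') u' &
    D (index (root_of n par' u') ord)].
  move=> lu'; have l := anc_lt n lu'; split=> //; first exact: isanc_anc.
  by rewrite hD /pos_roots idx_lt ?(ltnW l) // nidx ?(ltnW l) // l root_of_root.
apply/eqP/samebP => [|e d Dd|h]; first exact: D_lt.
  have [dn dN de] := Dv d Dd; rewrite -de.
  have H u' v' : u' < n -> v' < n -> root_of n par' u' = root_of n par' v' ->
      ini R (index (nth 0 ord d) ord) (index u' ord) ->
      ini R (index (nth 0 ord d) ord) (index v' ord).
    move=> lu' lv' e'; move/(nb_link nb dn (ltnW lu')) => a; apply/(nb_link nb dn (ltnW lv')).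
    have := isanc_root_of lu' dN a; rewrite e' => b; apply: isanc_trans b _.
    exact: isanc_anc.
  by apply/idP/idP; apply: H.
have H u' v' : u' < n -> v' < n ->
    (forall d, D d -> ini R d (index u' ord) = ini R d (index v' ord)) ->
    index (root_of n par' u') ord <= index (root_of n par' v') ord.
  move=> lu' lv' hh; have [l1 a1 d1] := ru u' lu'; have [l2 _ _] := ru v' lv'.
  apply: isanc_idx; rewrite ?(ltnW l1) ?(ltnW l2) //.
  apply: isanc_root_of => //; first exact: root_of_root.
  by apply/(nb_link nb (ltnW l1) (ltnW lv')); rewrite -hh //;
    exact: (proj1 (nb_link nb (ltnW l1) (ltnW lu')) a1).
have [l1 _ _] := ru u lu; have [l2 _ _] := ru v lv.
rewrite -(nidx (ltnW l1)) -(nidx (ltnW l2)); congr nth; apply/eqP; rewrite eqn_leq !H //.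
by move=> d Dd; rewrite h.
Qed.

Lemma tree_sum_pos (wf wt' : nat -> bool) v : (forall y, wf y = pos_weight n ord wt' y) -> v < n ->
  \sum_(0 <= y < N | sameb N R D y (index v ord)) wf y = tree_sum n par' wt' v.
Proof.
move=> hw lv; rewrite /tree_sum.
transitivity (\sum_(0 <= y < N | sameb N R D y (index v ord))
   nat_of_bool ((nth 0 ord y < n) && wt' (nth 0 ord y))).
  rewrite big_nat_cond [RHS]big_nat_cond; apply: eq_bigr => y /andP[/andP[_ ly] _].
  by rewrite hw /pos_weight ly.
rewrite (sum_ord (fun u => nat_of_bool ((u < n) && wt' u))
  (fun y => sameb N R D y (index v ord)) nb).
rewrite big_mkcond big_nat_recr //= ltnn /= if_same addn0 big_mkord -big_mkcond /=.
rewrite [LHS]big_mkcond [RHS]big_mkcond; apply: eq_bigr => -[u lu] _ /=.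
by rewrite root_same // lu.
Qed.

End Roots.

Definition ready (par' : nat -> option nat) (wt' : nat -> bool) (L : nat -> seq nat) (s : st) : Prop :=
  vertex_facts n par ord s /\
  exists D wf, [/\ forall x, D x = pos_roots par' x, forall y, wf y = pos_weight n ord wt' y &
    Inv N B R D wf L s].

Lemma vertex_frame s s' xs ys : vertex_facts n par ord s -> frame xs s s' -> aframe ys s s' ->
  vn \notin xs -> aIn \notin ys -> aPar \notin ys -> vertex_facts n par ord s'.
Proof. by move=> [h1 h2 h3] fr af n1 n2 n3; split; rewrite ?fr ?af. Qed.

Lemma cut_ready par' wt' L s v : ready par' wt' L s -> v < n -> par' v <> None ->
  vr s vx = index v ord ->
  exists T L', T + 2 * Pot N L' <= 2 * Pot N L + 4 /\
    wp cut_cmd s T (fun s' => [/\ ready (cut_par par' v) wt' L' s', frame cut_vars s s' & sameio s s']).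
Proof.
move=> [vf [D [wf [hD hw I]]]] lv pv Hx.
have lx := idx_lt (ltnW lv); have x0 := idx_gt0 lv.
have Dx : D (index v ord) = false.
  by rewrite hD /pos_roots lx nidx ?(ltnW lv) // lv; case: (par' v) pv.
have [|T [L' [HT X]]] := @cut_spec w q N B R WN B0 (nb_le nb) Rb lam D wf L s (index v ord) I _ Dx Hx.
  by rewrite x0 lx.
exists T, L'; split=> //; apply: wp_mono X (leqnn _) _ => s' [I' fr af io]; split=> //.
split; first by apply: vertex_frame vf fr af _ _ _.
exists (mark D (index v ord)), wf; split=> // x; rewrite /mark hD /pos_roots /cut_par.
case: (ltnP x N) => xN /=; last by apply/eqP => e; rewrite -e ltnNge xN in lx.
have -> : (x == index v ord) = (nth 0 ord x == v).
  by apply/eqP/eqP => [->|<-]; rewrite ?nidx ?idx // ltnW.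
by case: eqP => [->|_]; rewrite ?orbF // lv orbT.
Qed.

Lemma roots_spec L s : vertex_facts n par ord s -> Inv N B R xpred0 (pos_weight n ord wt) L s ->
  wp roots_cmd s (5 * n + 2 * Pot N L) (fun s' => exists L',
    [/\ ready par wt L' s', 2 * Pot N L' <= 2 * Pot N L + 4 * n & sameio s s']).
Proof.
move=> vf I.
have oneW : 1 < 2 ^ w by clear -W_ge; lia.
have zW : 0 < 2 ^ w by clear -W_ge; lia.
apply: (asgS (v := 0)); [by sx | by sx |].
(* Each remaining vertex has credit 5: its iteration and the constant 4 of a possible cut. *)
pose Iw (k : nat) (s' : st) := exists i L', [/\ i <= n, k = 5 * (n - i) + 2 * Pot N L', vr s' vi = i,
   2 * Pot N L' <= 2 * Pot N L + 4 * i &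
   [/\ vertex_facts n par ord s', sameio s s' &
     exists D wf, [/\ forall x, D x = [&& x < N, nth 0 ord x < i & ~~ par (nth 0 ord x)],
       forall y, wf y = pos_weight n ord wt y & Inv N B R D wf L' s']]].
apply: (wp_while (Inv := Iw)).
  move=> k s' [i [L' [li kE Hi hP [vf' io' [D [wf [hD hw I']]]]]]].
  have [Hn hI hPar] := vf'.
  split; first by sx.
    sx; rewrite Hi Hn; case: ltnP => // h _; have e : i = n by clear -li h; lia.
    exists L'; rewrite e in hP hD; split=> //; split=> //.
    by exists D, wf.
  sx; rewrite Hi Hn; case: ltnP => // h _.
  have adi : 32 * i + 96 <= 2 ^ w by clear -h W_ge; lia.
  have fin (L2 : nat -> seq nat) (s2 : st) (D2 wf2 : nat -> bool) : vr s2 vi = i -> vertex_facts n par ord s2 -> sameio s s2 ->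
     2 * Pot N L2 <= 2 * Pot N L + 4 * i.+1 ->
     (forall x, D2 x = [&& x < N, nth 0 ord x < i.+1 & ~~ par (nth 0 ord x)]) ->
     (forall y, wf2 y = pos_weight n ord wt y) -> Inv N B R D2 wf2 L2 s2 ->
     wp (vi <-- ($vi + #1)) s2 0 (fun s'0 => Iw (5 * (n - i.+1) + 2 * Pot N L2) s'0).
    move=> vi2 vf2 io2 P2 hD2 hw2 I2.
    apply: (asg1 (v := i.+1)); [by sx; rewrite vi2; split=> //; clear -h W_ge; lia | by sx;
      rewrite vi2 addn1 |].
    exists i.+1, L2; split=> //; split=> //.
    by exists D2, wf2; split=> //; apply: Inv_frame I2.
  have upi : ar s' aPar i = up0 i by apply: hPar.
  have ltS x : x < N -> (nth 0 ord x < i.+1) = (nth 0 ord x < i) || (x == index i ord).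
    move=> xN; rewrite ltnS leq_eqVlt orbC; congr (_ || _).
    by apply/eqP/eqP => [<-|->]; rewrite ?idx // nidx // ltnW.
  case E: (par i) => [p|].
    have up : up0 i < n by rewrite /up0 h E /=; case: Hf => hf _; apply: hf E.
    exists 0; apply: wp_mono; last first.
    - by move=> s2 h2; exists (5 * (n - i.+1) + 2 * Pot N L'); split; [| exact: h2]; rewrite kE;
        clear -h; lia.
    - exact: leqnn.
    apply: wp_seq0; apply: wp_if; sx; first by rewrite Hi; do !split.
      by rewrite Hi upi Hn (ltn_eqF up).
    move=> _; apply: wp_skip; apply: (fin L' s' D wf) => //; first by clear -hP; lia.
    move=> x; rewrite hD; case: (ltnP x N) => xN //=; rewrite ltS //.
    by case: (x =P index i ord) => [->|_]; rewrite ?orbF // nidx ?(ltnW h) // E andbF ltnn.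
  have up : up0 i = n by rewrite /up0 h E.
  have lx := idx_lt (ltnW h); have x0 := idx_gt0 h.
  have Dx : D (index i ord) = false by rewrite hD lx nidx ?(ltnW h) // ltnn.
  have I1 : Inv N B R D wf L' (setv s' vx (index i ord)) by apply: Inv_frame I'.
  have [||T [L2 [HT X]]] := @cut_spec w q N B R WN B0 (nb_le nb) Rb lam D wf L' (setv s' vx (index i ord)) (index i ord) I1 _ Dx.
    by rewrite x0 lx.
    by sx.
  exists T; apply: (wp_mono (T := T) (Q := Iw (5 * (n - i.+1) + 2 * Pot N L2))) => //; last first.
    by move=> s2 h2; exists (5 * (n - i.+1) + 2 * Pot N L2); split=> //; rewrite kE; clear -h HT;
      lia.
  rewrite -[T]addn0; apply: wp_seq; apply: wp_if; sx; first by rewrite Hi; do !split.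
    move=> _; apply: (asgS (v := index i ord)); [by sx; rewrite Hi; split | by sx; rewrite Hi hI |].
    apply: wp_mono X (leqnn _) _ => s2 [I2 fr2 af2 io2].
    apply: (fin L2 s2 (mark D (index i ord)) wf) => //.
    - by rewrite fr2.
    - have vf1 : vertex_facts n par ord (setv s' vx (index i ord)) by case: vf' => *; split.
      exact: vertex_frame vf1 fr2 af2 _ _ _.
    - by apply: sameio_trans io' io2.
    - by clear -hP HT; lia.
    - move=> x; rewrite /mark hD; case: (ltnP x N) => xN /=; last by apply/eqP => e;
        rewrite -e ltnNge xN in lx.
      rewrite ltS //; case: (x =P index i ord) => [->|_]; rewrite ?orbF //.
      by rewrite nidx ?(ltnW h) // E !orbT.
  by rewrite Hi upi Hn up eqxx.
exists 0, L; split=> //; [by rewrite subn0 | by rewrite muln0 addn0 |].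
split=> //; exists xpred0, (pos_weight n ord wt); split=> //.
- by move=> x; rewrite ltn0 andbF.
- by apply: Inv_frame I.
Qed.

Lemma rd_ready par' wt' L s x : 2 < x -> ready par' wt' L s -> ready par' wt' L (rdst s x).
Proof.
move=> x2 [[h1 h2 h3] [D [wf [hD hw I]]]]; rewrite /rdst; case: (head _ _) => [[a b] c].
have E y : y <= 2 -> upd (upd (upd (vr s) x a) x.+1 b) x.+2 c y = vr s y.
  by move=> y2; rewrite /upd; do 3![case: eqP => [e|_]; first by move: y2 x2; rewrite e; clear;
    lia].
split; first by split=> //=; rewrite E.
by exists D, wf; split=> //; apply: Inv_frame I => //=; rewrite E.
Qed.

Lemma main_spec L s : ready par wt L s -> legal_seq n par ops ->
  si s = map enc_op ops ++ [:: end_rec] -> sc s = n.+1 -> so s = [::] ->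
  wp main_cmd s (5 * size ops + 2 * Pot N L) (fun s' => so s' = answers n par wt ops).
Proof.
move=> rdy leg hsi hsc hso.
have threeW : 3 < 2 ^ w by clear -W_ge; lia.
have oneW : 1 < 2 ^ w by clear -W_ge; lia.
have zW : 0 < 2 ^ w by clear -W_ge; lia.
(* One record is read ahead: the operation at the head of [rest] is already in the variables, hence
   the offset [n.+2] in the number of records consumed. *)
pose Iw (k : nat) (s' : st) := exists done rest par' wt' L',
  [/\ ops = done ++ rest, subforest par' /\ legal_seq n par' rest,
      ready par' wt' L' s' /\ k = 5 * size rest + 2 * Pot N L',
      so s' ++ answers n par' wt' rest = answers n par wt ops &
  [/\ size (so s') = count is_query done, sc s' = n.+2 + size done,
      (vr s' vr0, vr s' vr1, vr s' vr2) = head end_rec (map enc_op rest ++ [:: end_rec]) &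
      si s' = behead (map enc_op rest ++ [:: end_rec])]].
(* The only place where operations are read: the side condition of [Rd] holds because every query in
   [done] has been answered. *)
have fin done rest par' wt' L' s' : ops = done ++ rest -> subforest par' -> legal_seq n par' rest ->
    ready par' wt' L' s' -> so s' ++ answers n par' wt' rest = answers n par wt ops ->
    size (so s') = count is_query done -> sc s' = n.+1 + size done ->
    si s' = map enc_op rest ++ [:: end_rec] ->
    wp (Rd vr0) s' 0 (Iw (5 * size rest + 2 * Pot N L')).
  move=> oE sf lg rd ans sz sc' si'; apply: wp_rd.
    rewrite sc' -addSn /required addKn oE take_size_cat // sz; exact: leqnn.
  have := rd_ready (x := vr0) isT rd; rewrite /rdst si'.
  case Eh: (head _ _) => [[a b] c] rd'.
  by exists done, rest, par', wt', L'; split=> //; split=> //=; rewrite sc'.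
apply: wp_seq0; apply: wp_mono; [apply: (fin [::] ops par wt L s) => // | by [] |].
- by move=> v; right.
- by rewrite hso.
- by rewrite hso.
- by rewrite hsc addn0.
move=> s1 I1; apply: (wp_while (Inv := Iw)) I1 => {s1} k s1.
move=> [done [rest [par' [wt' [L' [oE [sf lg] [rd kE] ans [sz sc1 hd si1]]]]]]].
split; first by sx.
  case: rest oE lg kE ans hd si1 => [|o rest] oE lg kE ans hd si1 /=; last first.
    by case: o oE lg ans hd {kE si1} => [v|v b|v] _ _ _ [-> _ _].
  by rewrite cats0 in ans.
case: rest oE lg kE ans hd si1 => [|o rest] oE lg kE ans hd si1; first by move: hd => /= [-> _ _].
move=> _; have oE' : ops = rcons done o ++ rest by rewrite cat_rcons.
have sc2 : sc s1 = n.+1 + size (rcons done o) by rewrite sc1 size_rcons addnS.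
have [vf [D [wf [hD hw I]]]] := rd; have [Hn hI hPar] := vf.
have vin : exists v, [/\ v < n, vr s1 vr1 = v & ar s1 aIn v = index v ord].
  by case: o lg hd {oE kE ans si1 oE' sc2} => [v|v b|v] /= [lv _] [_ e _]; exists v; split=> //;
    apply: hI.
have [v [lv Hv Iv]] := vin.
pose x := index v ord.
have lx : x < N by apply: idx_lt (ltnW lv).
pose s2 := setv s1 vx x.
have rd2 : ready par' wt' L' s2.
  by split; [case: vf => *; split | exists D, wf; split=> //; apply: Inv_frame I].
have go T (L2 : nat -> seq nat) par2 wt2 : T + 2 * Pot N L2 <= 2 * Pot N L' + 4 -> subforest par2 ->
    legal_seq n par2 rest ->
    wp (If ($vr0 == #0)%X cut_cmd (If ($vr0 == #1)%X update_cmd query_cmd)) s2 T (fun s' =>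
      [/\ ready par2 wt2 L2 s', si s' = si s1, sc s' = sc s1,
        so s' ++ answers n par2 wt2 rest = answers n par wt ops &
        size (so s') = count is_query (rcons done o)]) ->
    exists t, wp (vx <-- aIn.[|$vr1];;
     If ($vr0 == #0)%X cut_cmd (If ($vr0 == #1)%X update_cmd query_cmd);; Rd vr0) s1 t
     (fun s' => exists k', k' + t < k /\ Iw k' s').
  move=> HT sf2 lg2 X; exists T; apply: (asgS (v := x)).
  - by sx; rewrite Hv; split=> //; clear -lv W_ge; lia.
  - by sx; rewrite Hv Iv.
  rewrite -[T]addn0; apply: wp_seq; apply: wp_mono X (leqnn _) _ => s3 [rd3 si3 sc3 so3 sz3].
  apply: wp_mono; [apply: (fin (rcons done o) rest par2 wt2 L2 s3) => // | by [] |].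
  - by rewrite sc3.
  - by rewrite si3 si1.
  move=> s4 I4; exists (5 * size rest + 2 * Pot N L2); split=> //.
  by rewrite kE /=; clear -HT; lia.
case: o oE lg kE ans hd oE' sc2 si1 vin fin go => [v'|v' b|v'] oE lg kE ans hd oE' sc2 si1 _ _ go.
- case: hd => h0 h1 _; have ev : v' = v by rewrite -h1.
  rewrite {}ev in oE lg ans oE' go; case: lg => _ [pv lg].
  have [T [L2 [HT X]]] := cut_ready rd2 lv pv (erefl : vr s2 vx = x).
  apply: (go T L2 (cut_par par' v) wt') => //.
    by move=> u; rewrite /cut_par; case: eqP => // _; left.
  apply: wp_if; sx; rewrite ?h0 //= => _; apply: wp_mono X (leqnn _) _ => s3 [rd3 fr3 [i3 c3 o3]].
  split=> //; rewrite o3 //.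
  by rewrite -cats1 count_cat /= !addn0.
- case: hd => h0 h1 h2; have ev : v' = v by rewrite -h1.
  rewrite {}ev in oE lg ans oE' go; case: lg => _ lg.
  have [_ [D2 [wf2 [hD2 hw2 I2]]]] := rd2.
  apply: (go 0 L' par' (set_wt wt' v b)) => //; first by clear; lia.
  apply: wp_if; sx; rewrite ?h0 // => _; apply: wp_if; sx; rewrite ?h0 // => _.
  apply: wp_mono; [apply: (@update_spec w q N B R WN B0 (nb_le nb) D2 wf2 L' s2 x b 0) => // | by [] |].
  move=> s3 [I3 fr3 af3 [i3 c3 o3]]; split=> //.
  + split; first by case: rd2 => vf2 _; apply: vertex_frame vf2 fr3 af3 _ _ _.
    exists D2, (set_wt wf2 x b); split=> // y; rewrite /set_wt hw2 /pos_weight.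
    case: (y =P x) => [->|ne]; first by rewrite lx nidx ?(ltnW lv) // lv eqxx.
    case: (ltnP y N) => yN //=; rewrite (_ : nth 0 ord y == v = false) //.
    by apply/eqP => e; apply: ne; rewrite /x -e idx.
  + by rewrite o3.
  + by rewrite o3 -cats1 count_cat /= !addn0.
- case: hd => h0 h1 _; have ev : v' = v by rewrite -h1.
  rewrite {}ev in oE lg ans oE' go; case: lg => _ lg.
  have [_ [D2 [wf2 [hD2 hw2 I2]]]] := rd2.
  apply: (go 0 L' par' wt') => //; first by clear; lia.
  apply: wp_if; sx; rewrite ?h0 // => _; apply: wp_if; sx; rewrite ?h0 // => _.
  apply: wp_mono; [apply: (@query_spec w q N B R WN B0 (nb_le nb) Rb lam D2 wf2 L' s2 x 0) => // | by [] |].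
  move=> s3 [I3 fr3 a3 [i3 c3 o3]].
  rewrite (tree_sum_pos sf hD2 hw2 lv) in o3.
  split=> //.
  + split; first by case: rd2 => vf2 _; apply: (vertex_frame (ys := [::]) vf2 fr3) => // i _;
      rewrite a3.
    by exists D2, wf2.
  + by rewrite o3 cat_rcons.
  + by rewrite o3 size_rcons -cats1 count_cat /= sz addn1.
Qed.

End Main.

(** * Assembly *)

Lemma prog_wf : wfc forest_cmd.
Proof. by vm_compute. Qed.

Lemma forest_wp w n par wt ops : 1024 * (n + 3) <= 2 ^ w -> forest n par -> legal_seq n par ops ->
  wp w (required n ops) forest_cmd (s_init n par wt (map enc_op ops ++ [:: end_rec]))
    (30 * (size ops + n + 1)) (fun s => so s = answers n par wt ops).
Proof.
move=> W_ge Hf leg.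
have le : 10 * n.+1 + ((5 * n + 2 * n.+1) + (5 * size ops + (2 * n.+1 + 4 * n))) <=
    30 * (size ops + n + 1) by lia.
apply: wp_mono le (fun _ h => h); apply: wp_seq; apply: wp_mono.
- apply: (init_spec wt W_ge Hf) => c lc.
  by rewrite /required (_ : c - n.+2 = 0) ?take0 //; lia.
- by [].
move=> s1 [B [R [ord [L [nb vf I PL [i1 c1 o1]]]]]].
apply: wp_seq; apply: wp_mono; [exact: (roots_spec ops W_ge Hf nb vf I) | by lia |].
move=> s2 [L2 [rd P2 [i2 c2 o2]]].
apply: wp_mono; [apply: (main_spec W_ge Hf nb rd leg); congruence | by lia | by []].
Qed.

Lemma enc_op_bound n par ops r : legal_seq n par ops -> r \in map enc_op ops ->
  [/\ r.1.1 < 3, r.1.2 < n & r.2 < 2].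
Proof.
elim: ops par => // o ops IH par /= lo; rewrite inE => /orP[/eqP->|ro].
  by case: o lo => [v|v b|v] [lv _]; split=> //=; case: b.
by case: o lo => [v|v b|v] [_]; [case=> _ | | ]; move/IH; apply.
Qed.

Lemma step_halt w P c : nth IHalt P (pc c) = IHalt -> step w P c = None.
Proof. by rewrite /step => ->. Qed.

(** As [n + 2] is at least 2, eleven of the twelve factors supply 2048 even for [n = 0], and the
    last one supplies linear growth. *)
Lemma word_size w n : (n + 2) ^ 12 <= 2 ^ w -> 1024 * (n + 3) <= 2 ^ w.
Proof.
apply: leq_trans; rewrite (_ : 12 = 11 + 1) // expnD expn1.
have : 2 ^ 11 <= (n + 2) ^ 11 by rewrite leq_exp2r //; lia.
rewrite (_ : 2 ^ 11 = 2048) // => h; nia.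
Qed.

(* A single Word RAM program P serves as the data structure: for word size
   w >= K log2 (n+2), on any forest with n vertices and any legal sequence of
   m operations, fed online, it halts after at most c (m + n + 1) steps
   (initialization included), having output exactly the answers to the
   tree-sum queries, each answer being written before the next operation is
   read. *)
Theorem theorem2 :
  exists (P : seq instr) (c K : nat),
    forall (w n : nat) (par : nat -> option nat) (wt : nat -> bool)
           (ops : seq op),
      (n + 2) ^ K <= 2 ^ w ->
      forest n par ->
      legal_seq n par ops ->
      let c0 := init_config (encode n par wt ops) in
      (exists T, T <= c * (size ops + n + 1) /\
                 halted w P (run w P T c0) /\
                 out (run w P T c0) = answers n par wt ops) /\
      (forall t j, j <= size ops ->
         n.+1 + j < consumed (run w P t c0) ->
         count is_query (take j ops) <= size (out (run w P t c0))).
Proof.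
set P := ccmd forest_cmd 0.
(* The compiled code runs for at most [csize forest_cmd * tau.+1] steps, and [tau] is at most
   [30 * (size ops + n + 1)]; the successor raises 30 to 31. *)
exists P, (csize forest_cmd * 31), 12 => w n par wt ops hw Hf leg c0.
have W_ge := word_size hw.
have [tau [s [ltau X ans]]] := forest_wp wt W_ge Hf leg.
have W128 : 128 < 2 ^ w by apply: leq_trans W_ge; rewrite mulnDr; lia.
have code : codeat P 0 (ccmd forest_cmd 0) by exists [::], [::]; rewrite cats0.
have rel0 : rel w (s_init n par wt (map enc_op ops ++ [:: end_rec])) (fun _ => 0).
  split=> //=; first by move=> a; lia.
  have nW : n < 2 ^ w by lia.
  move=> r; rewrite inE mem_cat => /or3P[/eqP->|/mapP[v]|].
  - by split=> //=; lia.
  - rewrite mem_iota add0n => /andP[_ lv] ->; split=> /=; [|by case: (wt v); lia | by lia].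
    case E: (par v) => [u|] //=; case: Hf => hu _; have := hu v u lv E; lia.
  - rewrite mem_cat mem_seq1 => /orP[/(enc_op_bound leg)[h1 h2 h3]|/eqP->]; last by split=> /=; lia.
    by split; [apply: leq_trans h1 _ | apply: leq_trans h2 _ | apply: leq_trans h3 _]; lia.
have g0 : goodio (required n ops) 0 [::] by rewrite /goodio /required sub0n take0.
have [t [m [lt S _]]] := ccmd_steps W128 X code prog_wf rel0 g0.
have [runE good_all] := steps_run S.
rewrite -/(init_config _) in runE good_all.
have hlt : step w P (run w P t c0) = None.
  rewrite /c0 -[encode _ _ _ _]/(si (s_init n par wt (map enc_op ops ++ [:: end_rec]))) runE.
  by apply: step_halt; rewrite nth_default // size_ccmd.
split.
  exists t; split; [|split].
  - by apply: leq_trans lt _; rewrite -mulnA leq_mul2l; apply/orP; right; lia.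
  - by rewrite /halted hlt.
  - by rewrite /c0 -[encode _ _ _ _]/(si (s_init n par wt (map enc_op ops ++ [:: end_rec]))) runE.
move=> t' j lj lc.
have g : good (required n ops) (run w P t' c0).
  (* Beyond the halting time the configuration is constant, so the condition at time [t] covers all
     later times. *)
  case: (leqP t' t) => [le|/ltnW le]; first exact: good_all.
  have -> : run w P t' c0 = run w P t c0; last exact: good_all.
  rewrite /run -(subnK le) iterD -/(run w P t c0).
  by elim: (t' - t) => //= k ->; rewrite hlt.
have jc : j <= consumed (run w P t' c0) - n.+2.
  by rewrite -(addKn n.+2 j) leq_sub2r // addSn.
apply: leq_trans g; rewrite /required -[X in _ <= count _ X](cat_take_drop j) count_cat.
by rewrite take_takel // leq_addr.
Qed.
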